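(* Let $\alpha\in(0,1)$, $T>0$, let $\Omega\subset\mathbb{R}^d$ ($d\in\{1,2,3\}$) be a bounded Lipschitz domain, and let $\mathcal{L}$ be a linear second-order elliptic operator in the spatial variable such that, for some $\lambda\in\mathbb{R}$, $\langle \mathcal{L}v,v\rangle\ge\lambda\|v\|^2$ for all $v\in H^1_0(\Omega)$. Consider the problem $$D_t^\alpha u+\mathcal{L}u=f(x,t)\ \text{ for }(x,t)\in\Omega\times(0,T],\qquad u(\cdot,0)=u_0\ \text{ in }\Omega,\qquad u=0\ \text{ on }\partial\Omega\text{ for }t>0 .$$ Suppose that a unique solution $u$ of this problem and its approximation $u_h$ are in $L_\infty(0,t;L_2(\Omega))\cap W^{1,\infty}(\epsilon,t;L_2(\Omega))$ for any $0<\epsilon<t\le T$, and also in $H^1_0(\Omega)$ for any $t>0$, while $u_h(\cdot,0)=u_0$ and $R_h(\cdot,t)=(D_t^\alpha+\mathcal{L})u_h(\cdot,t)-f(\cdot,t)$ for $t>0$. Then $$\|(u_h-u)(\cdot,t)\|\le (D_t^\alpha+\lambda)^{-1}\|R_h(\cdot,t)\|\qquad\text{for }0<t\le T,$$ where, for a scalar function $v$, $$(D_t^\alpha+\lambda)^{-1}v(t):=\int_0^t (t-s)^{\alpha-1}E_{\alpha,\alpha}(-\lambda[t-s]^\alpha)\,v(s)\,ds .$$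
   Context: $\langle\cdot,\cdot\rangle$ and $\|\cdot\|$ are the inner product and norm of $L_2(\Omega)$ ($\langle\mathcal{L}v,v\rangle$ being understood as the associated pairing for $v\in H_0^1(\Omega)$). $E_{\alpha,\beta}(s)=\sum_{k=0}^\infty \{\Gamma(\alpha k+\beta)\}^{-1}s^k$ is the generalized Mittag-Leffler function. The residual $R_h(\cdot,t)$ is understood to be in $L_2(\Omega)$ for $t>0$, so that $\|R_h(\cdot,t)\|$ makes sense. $D_t^\alpha$ is the Caputo derivative of order $\alpha$ in time: $D_t^\alpha v(\cdot,t):=\frac1{\Gamma(1-\alpha)}\int_0^t(t-s)^{-\alpha}\,\partial_s v(\cdot,s)\,ds$ for $t>0$. For the less smooth functions considered here (bounded on $(0,t)$ and Lipschitz in time on $[\epsilon,t]$ for each $0<\epsilon<t$, possibly discontinuous at $t=0$), it is understood via the formula obtained by integration by parts: $$\Gamma(1-\alpha)\,D_t^\alpha v(\cdot,t)=t^{-\alpha}\{v(\cdot,t)-v(\cdot,0)\}+\int_0^t\alpha(t-s)^{-\alpha-1}\{v(\cdot,t)-v(\cdot,s)\}\,ds .$$ *)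

(* Defs.v *)
From HB Require Import structures.
From mathcomp Require Import all_boot all_order all_algebra.
From mathcomp Require Import all_classical all_reals all_analysis.

Set Implicit Arguments.
Unset Strict Implicit.
Unset Printing Implicit Defensive.

Import Order.TTheory GRing.Theory Num.Theory numFieldNormedType.Exports.

Local Open Scope classical_set_scope.
Local Open Scope ring_scope.

(* Lebesgue measure on R^n = 'rV[R]_n.  The sigma-algebra is the one generated
   by the coordinates, i.e. the Borel sigma-algebra of R^n. *)

Definition measure_rV_display : measure_display.
Proof. exact: default_measure_display. Qed.

Section rV_measurable.
Context (R : realType) (n : nat).

Let coord (i : 'I_n) (x : 'rV[R]_n) : measurableTypeR R := x ord0 i.

Let rV_set0 : g_sigma_preimage coord set0.
Proof. exact: sigma_algebra0. Qed.

Let rV_setC A : g_sigma_preimage coord A -> g_sigma_preimage coord (~` A).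
Proof. exact: sigma_algebraC. Qed.

Let rV_bigcup (F : (set 'rV[R]_n)^nat) :
  (forall i, g_sigma_preimage coord (F i)) ->
  g_sigma_preimage coord (\bigcup_i (F i)).
Proof. exact: sigma_algebra_bigcup. Qed.

HB.instance Definition _ := @isMeasurable.Build measure_rV_display
  'rV[R]_n (g_sigma_preimage coord) rV_set0 rV_setC rV_bigcup.

End rV_measurable.

Section rV_lebesgue.
Context (R : realType).

Lemma measurable_coord n (i : 'I_n) :
  measurable_fun [set: 'rV[R]_n] (fun x => x ord0 i : measurableTypeR R).
Proof.
move=> _ Y mY; rewrite setTI; apply: sub_sigma_algebra => /=.
rewrite -bigcup_seq/=; exists i => /=; first by rewrite mem_index_enum.
by exists Y => //; rewrite setTI.
Qed.

Lemma measurable_fun_coord d (T : measurableType d) n (f : T -> 'rV[R]_n) :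
  (forall i, measurable_fun [set: T] (fun x => f x ord0 i : measurableTypeR R)) ->
  measurable_fun [set: T] f.
Proof.
move=> mf _ B mB; rewrite setTI.
suff : g_sigma_preimage
    (fun (i : 'I_n) (x : 'rV[R]_n) => x ord0 i : measurableTypeR R) `<=`
  [set A | measurable (f @^-1` A)] by apply.
apply: smallest_sub.
- split => /=.
  + by rewrite preimage_set0; exact: measurable0.
  + by move=> A mA; rewrite setTD preimage_setC; exact: measurableC.
  + by move=> F mF; rewrite preimage_bigcup; exact: bigcup_measurable.
- case: n => [|n] in f mf B mB *; first by rewrite big_ord0.
  rewrite -bigcup_mkord_ord; apply: bigcup_sub => i Ii.
  move=> A [C mC <-] /=; have := mf (inord i) measurableT _ mC.
  by rewrite !setTI.
Qed.

Definition rV_cons n (p : measurableTypeR R * 'rV[R]_n) : 'rV[R]_n.+1 :=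
  \row_i oapp (fun j => p.2 ord0 j) p.1 (unlift ord0 i).

Definition rV_uncons n (x : 'rV[R]_n.+1) : measurableTypeR R * 'rV[R]_n :=
  (x ord0 ord0, \row_j x ord0 (lift ord0 j)).

Lemma measurable_rV_cons n : measurable_fun setT (@rV_cons n).
Proof.
apply: measurable_fun_coord => i.
under eq_fun do rewrite mxE.
case: (unliftP ord0 i) => [j|] _ /=; last exact: measurable_fst.
exact: (measurableT_comp (measurable_coord j) measurable_snd).
Qed.

Lemma measurable_rV_uncons n : measurable_fun setT (@rV_uncons n).
Proof.
apply: measurable_fun_pair; first exact: measurable_coord.
apply: measurable_fun_coord => i; under eq_fun do rewrite mxE.
exact: measurable_coord.
Qed.

Lemma rV_consK n : cancel (@rV_cons n) (@rV_uncons n).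
Proof.
move=> [t x]; rewrite /rV_uncons /rV_cons mxE unlift_none/=; congr pair.
by apply/rowP => j; rewrite !mxE liftK.
Qed.

Section step.
Context n (m : {sigma_finite_measure set 'rV[R]_n -> \bar R}).

Definition lebesgue_rV_step : set 'rV[R]_n.+1 -> \bar R :=
  pushforward (@lebesgue_measure R \x m)%E (@rV_cons n).

Let preim_measurable (A : set 'rV[R]_n.+1) :
  measurable A -> measurable (@rV_cons n @^-1` A).
Proof.
by move=> mA; rewrite -[X in measurable X]setTI; exact: measurable_rV_cons.
Qed.

Let step0 : lebesgue_rV_step set0 = 0%E.
Proof. by rewrite /lebesgue_rV_step /pushforward preimage_set0 measure0. Qed.

Let step_ge0 A : (0 <= lebesgue_rV_step A)%E.
Proof. by rewrite /lebesgue_rV_step /pushforward measure_ge0. Qed.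

Let step_sigma_additive : semi_sigma_additive lebesgue_rV_step.
Proof.
move=> F mF tF mUF; rewrite /lebesgue_rV_step /pushforward preimage_bigcup.
apply: measure_semi_sigma_additive.
- by move=> i; exact: preim_measurable.
- apply/trivIsetP => /= i j _ _ ij; rewrite -preimage_setI.
  by move/trivIsetP : tF => /(_ _ _ _ _ ij) ->//; rewrite preimage_set0.
- by rewrite -preimage_bigcup; exact: preim_measurable.
Qed.

HB.instance Definition _ := isMeasure.Build _ _ _ lebesgue_rV_step
  step0 step_ge0 step_sigma_additive.

Let step_sigma_finite : sigma_finite setT lebesgue_rV_step.
Proof.
have /sigma_finiteP[F [TF ndF Foo]] := sigma_finiteT (@lebesgue_measure R).
have /sigma_finiteP[G [TG ndG Goo]] := sigma_finiteT m.
exists (fun i => @rV_uncons n @^-1` (F i `*` G i)).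
  rewrite -preimage_bigcup; apply/seteqP; split => // x _ /=.
  case: (rV_uncons x) => a b.
  have [i _ Fia] : (\bigcup_i F i) a by rewrite -TF.
  have [j _ Gjb] : (\bigcup_i G i) b by rewrite -TG.
  exists (maxn i j) => //; split.
  - by move: a Fia; exact/subsetPset/ndF/leq_maxl.
  - by move: b Gjb; exact/subsetPset/ndG/leq_maxr.
move=> i; have [mF ?] := Foo i; have [mG ?] := Goo i; split.
  rewrite -[X in measurable X]setTI; apply: measurable_rV_uncons => //.
  exact: measurableX.
rewrite /lebesgue_rV_step /pushforward -comp_preimage.
rewrite (_ : _ \o _ = id); last by rewrite funeqE; exact: rV_consK.
by rewrite preimage_id product_measure1E// lte_mul_pinfty// ge0_fin_numE.
Qed.

HB.instance Definition _ := Measure_isSigmaFinite.Build _ _ _ lebesgue_rV_step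
  step_sigma_finite.

End step.

Fixpoint lebesgue_rV n : {sigma_finite_measure set 'rV[R]_n -> \bar R} :=
  if n is n'.+1 then lebesgue_rV_step (lebesgue_rV n')
  else [the {sigma_finite_measure set 'rV[R]_0 -> \bar R}
        of dirac (0 : 'rV[R]_0)].

Lemma lebesgue_rV_box n (A : 'I_n -> set R) :
  (forall i, measurable (A i : set (measurableTypeR R))) ->
  let B := [set x : 'rV[R]_n | forall i, A i (x ord0 i)] in
  measurable B /\ lebesgue_rV n B = (\prod_(i < n) lebesgue_measure (A i))%E.
Proof.
elim: n A => [A _ B|n IH A mA B].
  have -> : B = setT by apply/seteqP; split => x // _ [].
  by split=> //; rewrite big_ord0 /= diracE mem_set.
have := IH (fun i => A (lift ord0 i)) (fun i => mA _).
set C := [set x : 'rV[R]_n | _] => -[mC CE].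
have -> : B = @rV_uncons n @^-1` (A ord0 `*` C).
  apply/seteqP; split => x; rewrite /B /C /=.
    by move=> Ax; split => //= i; rewrite mxE.
  move=> [A0 Ax] i; case: (unliftP ord0 i) => [j ->|->//].
  by have := Ax j; rewrite mxE.
have mAC : measurable (A ord0 `*` C : set (measurableTypeR R * _)).
  by apply: measurableX => //; exact: mA.
split.
  by rewrite -[X in measurable X]setTI; exact: measurable_rV_uncons.
rewrite /= /lebesgue_rV_step /pushforward -comp_preimage.
rewrite (_ : _ \o _ = id); last by rewrite funeqE; exact: rV_consK.
rewrite preimage_id product_measure1E//.
by rewrite big_ord_recl CE.
Qed.

End rV_lebesgue.

Section domain.
Context (R : realType) (d : nat).

(* Omega is nonempty, open, connected, bounded and, near every point of its
   boundary and in suitable orthonormal coordinates y = x Q, it is the part of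
   R^d above the graph of a Lipschitz function of the coordinates other
   than y_k. *)
Definition bounded_lipschitz_domain (Omega : set 'rV[R]_d) : Prop :=
  [/\ open Omega, Omega !=set0, connected Omega, bounded_set Omega &
      forall x0, (closure Omega `\` Omega) x0 ->
        exists (r : R) (Q : 'M[R]_d) (k : 'I_d) (gamma : 'rV[R]_d.-1 -> R),
          [/\ 0 < r, Q *m Q^T = 1%:M, lipschitz gamma &
              forall x, ball x0 r x ->
                (Omega x <-> gamma (col' k (x *m Q)) < (x *m Q) ord0 k)]].

Definition partial (i : 'I_d) (phi : 'rV[R]_d -> R) : 'rV[R]_d -> R :=
  fun x => 'D_(delta_mx ord0 i) phi x.

Definition smooth (phi : 'rV[R]_d -> R) : Prop :=
  forall s : seq 'I_d, continuous (foldr partial phi s) /\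
    forall i x, derivable (foldr partial phi s) x (delta_mx ord0 i).

End domain.

Section function_spaces.
Context (R : realType) (d : nat) (Omega : set 'rV[R]_d).

Local Notation mu := (lebesgue_rV R d).
Implicit Types (f v phi : 'rV[R]_d -> R) (g : 'I_d -> 'rV[R]_d -> R).

(* Elements of L_2(Omega), etc. are represented by functions on R^d whose
   values outside Omega are irrelevant. *)
Definition L2 f : Prop := (f \_ Omega) \in Lfun mu 2%:E.

Definition Linfty f : Prop := (f \_ Omega) \in Lfun mu +oo%E.

Definition L1loc f : Prop :=
  measurable_fun Omega f /\
  forall K, K `<=` Omega -> compact K -> (\int[mu]_(x in K) `|f x|%:E < +oo)%E.

Definition L2norm f : R := fine ('N[mu]_2%:E[EFin \o (f \_ Omega)])%E.

(* The L_2(Omega) inner product, also used for the pairing of a locally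
   integrable function with a test function. *)
Definition L2dot f v : R := \int[mu]_(x in Omega) (f x * v x).

Definition test_function phi : Prop :=
  [/\ smooth phi, compact (closure [set x | phi x != 0]) &
      closure [set x | phi x != 0] `<=` Omega].

Definition weak_gradient v g : Prop :=
  forall phi i, test_function phi ->
    L2dot v (partial i phi) = - L2dot (g i) phi.

(* v is in H^1_0(Omega), the closure of the test functions in H^1(Omega), and
   g is its weak gradient. *)
Definition H10_grad v g : Prop :=
  [/\ L2 v, forall i, L2 (g i), weak_gradient v g &
      exists phi : nat -> 'rV[R]_d -> R,
        [/\ forall n, test_function (phi n),
            L2norm (phi n \- v) @[n --> \oo] --> 0 &
            forall i, L2norm (partial i (phi n) \- g i) @[n --> \oo] --> 0]].

Definition H10 v : Prop := exists g, H10_grad v g.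

(* B is the Bochner integral over D of the L_2(Omega)-valued function F:
   the limit of the integrals of simple functions S n converging to F in
   L_1(D; L_2(Omega)). *)
Definition bochner_integral (D : set R) (F : R -> 'rV[R]_d -> R)
    (B : 'rV[R]_d -> R) : Prop :=
  [/\ forall s, D s -> L2 (F s), L2 B &
      exists (k : nat -> nat) (A : nat -> nat -> set (measurableTypeR R))
             (g : nat -> nat -> 'rV[R]_d -> R),
        let S n s x := \sum_(i < k n) \1_(A n i) s * g n i x in
        let IS n x := \sum_(i < k n) fine (lebesgue_measure (A n i)) * g n i x in
        [/\ forall n i, [/\ measurable (A n i), A n i `<=` D,
              (lebesgue_measure (A n i) < +oo)%E & L2 (g n i)],
            forall n, measurable_fun D (fun s => L2norm (F s \- S n s)),
            (\int[lebesgue_measure]_(s in D) (L2norm (F s \- S n s))%:E)%E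
              @[n --> \oo] --> 0%E &
            L2norm (B \- IS n) @[n --> \oo] --> 0]].

End function_spaces.

(* The coefficients of
     L v = - sum_i D_i (sum_j a_ij D_j v + b_i v) + sum_i c_i D_i v + e v. *)
Record second_order_operator (R : realType) (d : nat) := SecondOrderOperator {
  op_a : 'I_d -> 'I_d -> 'rV[R]_d -> R ;
  op_b : 'I_d -> 'rV[R]_d -> R ;
  op_c : 'I_d -> 'rV[R]_d -> R ;
  op_e : 'rV[R]_d -> R
}.

Section elliptic.
Context (R : realType) (d : nat) (Omega : set 'rV[R]_d).

Local Notation mu := (lebesgue_rV R d).
Implicit Types (L : second_order_operator R d).

(* Bounded measurable coefficients and a positive definite principal part at
   almost every point; uniform ellipticity is not required. *)
Definition elliptic L : Prop :=
  [/\ forall i j, Linfty Omega (op_a L i j),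
      forall i, Linfty Omega (op_b L i),
      forall i, Linfty Omega (op_c L i),
      Linfty Omega (op_e L) &
      {ae mu, forall x, Omega x -> forall xi : 'rV[R]_d, xi != 0 ->
        0 < \sum_i \sum_j op_a L i j x * xi ord0 i * xi ord0 j}].

(* The pairing <L v, phi>, where gv and gphi are the gradients of v and phi. *)
Definition op_pairing L (v : 'rV[R]_d -> R) (gv : 'I_d -> 'rV[R]_d -> R)
    (phi : 'rV[R]_d -> R) (gphi : 'I_d -> 'rV[R]_d -> R) : R :=
  \int[mu]_(x in Omega)
    (\sum_i (\sum_j op_a L i j x * gv j x + op_b L i x * v x) * gphi i x
     + (\sum_i op_c L i x * gv i x + op_e L x * v x) * phi x).

End elliptic.

Section special_functions.
Context (R : realType).

Definition Gamma (x : R) : R :=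
  \int[lebesgue_measure]_(s in `]0, +oo[) (s `^ (x - 1) * expR (- s)).

Definition mittag_leffler (alpha beta s : R) : R :=
  lim (series (fun k => (Gamma (alpha * k%:R + beta))^-1 * s ^+ k) @ \oo).

(* (D_t^alpha + lambda)^{-1} v (t), with values in the extended reals since the
   integral may be infinite. *)
Definition caputo_inv (alpha lambda : R) (v : R -> R) (t : R) : \bar R :=
  (\int[lebesgue_measure]_(s in `]0%R, t[)
     ((t - s) `^ (alpha - 1)
      * mittag_leffler alpha alpha (- lambda * (t - s) `^ alpha) * v s)%:E)%E.

End special_functions.

Section evolution.
Context (R : realType) (d : nat) (Omega : set 'rV[R]_d).

Local Notation mu := (lebesgue_rV R d).
Implicit Types (v : R -> 'rV[R]_d -> R) (F w : 'rV[R]_d -> R).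

(* w = D_t^alpha v (., t), in the form obtained by integration by parts. *)
Definition caputo (alpha : R) v (t : R) w : Prop :=
  exists2 B : 'rV[R]_d -> R,
    bochner_integral Omega `]0, t[
      (fun s x => alpha * (t - s) `^ (- alpha - 1) * (v t x - v s x)) B &
    w = (fun x => (Gamma (1 - alpha))^-1
                  * (t `^ (- alpha) * (v t x - v 0 x) + B x)).

(* v is in L_oo(0,t;L_2) and W^{1,oo}(eps,t;L_2) for all 0 < eps < t <= T; its
   initial value is only required to be locally integrable. *)
Definition time_regular (T : R) v : Prop :=
  L1loc Omega (v 0) /\
  forall t, 0 < t <= T ->
    [/\ L2 Omega (v t),
        exists M, forall s, 0 < s < t -> L2norm Omega (v s) <= M &
        forall eps, 0 < eps < t -> exists K, forall s1 s2,
          eps <= s1 <= t -> eps <= s2 <= t ->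
          L2norm Omega (v s1 \- v s2) <= K * `|s1 - s2|].

(* (D_t^alpha + L) v (., t) = F in the sense of distributions on Omega. *)
Definition evolution_eq (alpha : R) (L : second_order_operator R d) v (t : R)
    F : Prop :=
  exists g w, [/\ H10_grad Omega (v t) g, caputo alpha v t w &
    forall phi, test_function Omega phi ->
      L2dot Omega w phi
      + op_pairing Omega L (v t) g phi (fun i => partial i phi)
      = L2dot Omega F phi].

Definition is_solution (alpha T : R) (L : second_order_operator R d)
    (f : R -> 'rV[R]_d -> R) (u0 : 'rV[R]_d -> R) v : Prop :=
  [/\ time_regular T v,
      forall t, 0 < t <= T -> H10 Omega (v t),
      v 0 = u0 %[ae mu in Omega] &
      forall t, 0 < t <= T -> evolution_eq alpha L v t (f t)].

End evolution.

(* Main.v *)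
(* Let e = u_h - u, y(t) = ||e(.,t)||, r(t) = ||R_h(.,t)||, G = Gamma(1 - alpha).
   Subtracting the two equations and passing to the limit from test functions to
   e(.,t) in H^1_0 gives <D_t^alpha e, e> + lambda y^2 <= r y.  By Cauchy-Schwarz
   <e(t) - e(s), e(t)> >= y(t) (y(t) - y(s)) for all s, and for s close to t the
   left-hand side is at least - L (t - s) y(t), where L is a Lipschitz constant
   of e away from time 0.  Cutting the memory integral at c < t, with t - c of
   order d, yields up to O(d^(1 - alpha))
     G^-1 ((t - c)^-alpha y(t) - int_0^c alpha (t - s)^(-alpha - 1) y(s) ds)
       + lambda y(t) <= r(t).
   This is convolved with K(t) = t^(alpha - 1) E_{alpha,alpha}(- lambda t^alpha),
   which is nonnegative and solves the Volterra equation
   K + lambda k * K = k with k(t) = t^(alpha - 1) / Gamma(alpha).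

   To avoid differentiating y, the singular kernel alpha x^(-alpha - 1) is cut off
   below d to kappa_d.  Then kappa_d * k + Phi_d = d^-alpha k with an explicit
   nonnegative Phi_d, and Phi_d is G times an approximate identity; together with
   the Volterra equation this bounds y(t) by (K * r)(t) + O(d^(1 - alpha)) plus
   the contribution of the times before some a > 0, where y is only bounded.
   That contribution is O(a^(1 - alpha)); let d -> 0, then a -> 0. *)

Require Import Defs.
From mathcomp Require Import all_boot all_order all_algebra.
From mathcomp Require Import all_classical all_reals all_analysis.
From mathcomp Require Import measurable_realfun ess_sup_inf.
From mathcomp Require Import ring lra.

Set Implicit Arguments.
Unset Strict Implicit.
Unset Printing Implicit Defensive.

Import Order.TTheory GRing.Theory Num.Theory numFieldNormedType.Exports.

Local Open Scope classical_set_scope.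
Local Open Scope ring_scope.

(** * Convolution of nonnegative extended real functions *)

Section lebesgue_affine.
Context {R : realType}.
Local Notation mu := (@lebesgue_measure R).
Local Open Scope ereal_scope.
Implicit Types (f : R -> \bar R).

(** Two gaps in the data shape the argument: nothing makes r measurable, and u_0 is only locally
    integrable. So r enters through a lower integral, and the initial value is only ever paired with
    test functions; it drops out of the difference of the two equations before the limit to e(.,t).
    All kernels are nonnegative extended real functions on the line, zero for t <= 0. Tonelli then
    gives commutativity and associativity of convolution with no integrability to check; to avoid
    subtraction, lambda is split into positive and negative parts, placed on opposite sides.
    Nonnegativity of K does not go through complete monotonicity: for lambda <= 0 the series has
    nonnegative terms, and for lambda > 0 a first zero of K is excluded by log-convexity of k. The
    Volterra equation holds because K is a series of fractional integration kernels of indices alpha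
    j + alpha, which convolution with k shifts by one place. The order of the final limits is
    forced: the constant in O(d^(1 - alpha)) contains the Lipschitz constant of e on [a, T], which
    may blow up as a -> 0, while the one in O(a^(1 - alpha)) does not depend on a. *)

Lemma measurable_affine (a b : R) :
  measurable_fun setT (fun x : measurableTypeR R => (a * x + b)%R : measurableTypeR R).
Proof. by apply: measurable_funD => //; exact: measurable_funM. Qed.

(** Both sides are measures in [A] that agree on half-open intervals, which characterises Lebesgue
    measure. *)
Lemma lebesgue_measure_affine (a b : R) (A : set (measurableTypeR R)) :
  (0 < a)%R -> measurable A ->
  mu A = a%:E * pushforward mu (fun x : measurableTypeR R => (a * x + b)%R : measurableTypeR R) A.
Proof.
move=> a0 mA.
pose nu := measure_function_pushforward__canonical__measure_function_Measure
  mu (measurable_affine a b).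
rewrite (@lebesgue_measure_unique R (mscale (NngNum (ltW a0)) nu)) //.
move=> _ [[x y]] _ <-.
transitivity (a%:E * mu `]((x - b) / a)%R, ((y - b) / a)%R]%classic).
  rewrite !lebesgue_measure_itv/= !lte_fin ltr_pM2r ?invr_gt0// ltrD2r.
  case: ifPn => _; last by rewrite mule0.
  by rewrite -!EFinB -EFinM; congr EFin; field; rewrite gt_eqF.
rewrite /mscale/=; congr (_ * lebesgue_measure _).
apply/seteqP; split => z /=; rewrite !in_itv/= ltr_pdivrMr// ler_pdivlMr//;
  by rewrite ltrBlDr lerBrDr mulrC.
Qed.

Lemma ge0_integral_affine (a b : R) f : (0 < a)%R ->
  measurable_fun setT f -> (forall x, 0 <= f x) ->
  \int[mu]_x f x = a%:E * \int[mu]_x f (a * x + b)%R.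
Proof.
move=> a0 mf f0.
pose nu := measure_function_pushforward__canonical__measure_function_Measure
  mu (measurable_affine a b).
transitivity (\int[mscale (NngNum (ltW a0)) nu]_x f x).
  by apply: eq_measure_integral => A mA _; exact: lebesgue_measure_affine.
rewrite ge0_integral_mscale//=; congr (_ * _).
by rewrite (ge0_integral_pushforward (measurable_affine a b))// preimage_setT.
Qed.

Lemma ge0_integral_opp f : measurable_fun setT f -> (forall x, 0 <= f x) ->
  \int[mu]_x f x = \int[mu]_x f (- x)%R.
Proof.
move=> mf f0.
have mN : measurable_fun setT (-%R : measurableTypeR R -> measurableTypeR R).
  exact: oppr_measurable.
pose nu := measure_function_pushforward__canonical__measure_function_Measure mu mN.
transitivity (\int[nu]_x f x).
  apply: eq_measure_integral => A mA _; exact/esym/lebesgue_measureN.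
by rewrite (ge0_integral_pushforward mN)// preimage_setT.
Qed.

Lemma ge0_integral_shift (b : R) f :
  measurable_fun setT f -> (forall x, 0 <= f x) ->
  \int[mu]_x f (x + b)%R = \int[mu]_x f x.
Proof.
move=> mf f0; rewrite [RHS](ge0_integral_affine b ltr01)// mul1e.
by under [RHS]eq_integral do rewrite mul1r.
Qed.

Lemma ge0_integral_reflect (b : R) f :
  measurable_fun setT f -> (forall x, 0 <= f x) ->
  \int[mu]_x f (b - x)%R = \int[mu]_x f x.
Proof.
move=> mf f0; rewrite -(ge0_integral_shift b mf f0).
rewrite [RHS]ge0_integral_opp//; last first.
  apply: measurableT_comp => //.
  by apply: measurable_funD => //.
by apply: eq_integral => x _; rewrite addrC.
Qed.

End lebesgue_affine.

Section convolution.
Context {R : realType}.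
Local Notation mu := (@lebesgue_measure R).
Local Open Scope ereal_scope.
Implicit Types (f g h : R -> \bar R).

(** The class on which Tonelli applies unconditionally. Kernels that vanish for t <= 0 turn the
    full-line integral of [conv] into the Volterra integral over ]0, t[. *)
Definition nnker f := measurable_fun setT f /\ forall x, 0 <= f x.

Definition conv f g (t : R) : \bar R := \int[mu]_s (f (t - s)%R * g s).

Lemma measurable_reflect f (b : R) :
  measurable_fun setT f -> measurable_fun setT (fun s : R => f (b - s)%R).
Proof.
by move=> mf; apply: measurableT_comp => //; exact: measurable_funB.
Qed.

Lemma measurable_conv2 f g : measurable_fun setT f -> measurable_fun setT g ->
  measurable_fun setT
    (fun p : measurableTypeR R * measurableTypeR R => f (p.1 - p.2)%R * g p.2).
Proof.
move=> mf mg; apply: emeasurable_funM.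
  apply: (measurableT_comp mf); apply: measurable_funB => //.
by apply: (measurableT_comp mg).
Qed.

Lemma nnker_conv f g : nnker f -> nnker g -> nnker (conv f g).
Proof.
move=> [mf f0] [mg g0]; split; last first.
  by move=> t; apply: integral_ge0 => x _; exact: mule_ge0.
apply: (measurable_fun_fubini_tonelli_F
  (fun p : measurableTypeR R * measurableTypeR R => f (p.1 - p.2)%R * g p.2)).
  exact: measurable_conv2.
by move=> x; exact: mule_ge0.
Qed.

Lemma convC f g : nnker f -> nnker g -> conv f g = conv g f.
Proof.
move=> [mf f0] [mg g0]; apply/funext => t; rewrite /conv.
rewrite -(ge0_integral_reflect t (f := fun s => f (t - s)%R * g s)).
- by apply: eq_integral => s _; rewrite muleC; congr (g _ * f _); ring.
- by apply: emeasurable_funM => //; exact: measurable_reflect.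
- by move=> x; exact: mule_ge0.
Qed.

Lemma convA f g h : nnker f -> nnker g -> nnker h ->
  conv f (conv g h) = conv (conv f g) h.
Proof.
move=> [mf f0] [mg g0] [mh h0]; apply/funext => t.
transitivity (\int[mu]_u \int[mu]_s (f (t - u)%R * (g (u - s)%R * h s))).
  apply: eq_integral => u _; rewrite -ge0_integralZl//.
    apply: emeasurable_funM => //; exact: measurable_reflect.
  by move=> s _; exact: mule_ge0.
rewrite (fubini_tonelli (fun p : measurableTypeR R * measurableTypeR R =>
  f (t - p.1)%R * (g (p.1 - p.2)%R * h p.2)))//=.
- apply: eq_integral => s _.
  transitivity (\int[mu]_u (h s * (f (t - u)%R * g (u - s)%R))).
    by apply: eq_integral => u _; rewrite muleA muleC.
  have ms : measurable_fun setT (fun u : R => f (t - u)%R * g (u - s)%R).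
    apply: emeasurable_funM; first exact: measurable_reflect.
    by apply: (measurableT_comp mg); exact: measurable_funB.
  rewrite ge0_integralZl//; last by move=> u _; exact: mule_ge0.
  rewrite muleC; congr (_ * _).
  rewrite -(ge0_integral_shift s)//; last by move=> u; exact: mule_ge0.
  by apply: eq_integral => u _; congr (f _ * g _); ring.
- apply: emeasurable_funM; last exact: measurable_conv2.
  apply: (measurableT_comp mf); exact: measurable_funB.
- by move=> x; rewrite !mule_ge0.
Qed.

Lemma nnker_add f g : nnker f -> nnker g -> nnker (f \+ g).
Proof.
move=> [mf f0] [mg g0]; split; first exact: emeasurable_funD.
by move=> x; exact: adde_ge0.
Qed.

Lemma nnker_scale (c : R) f : (0 <= c)%R -> nnker f -> nnker (fun x => c%:E * f x).
Proof.
move=> c0 [mf f0]; split; first exact: measurable_funeM.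
by move=> x; exact: mule_ge0.
Qed.

Lemma nnker_conv_integrand f g t : nnker f -> nnker g ->
  nnker (fun s => f (t - s)%R * g s).
Proof.
move=> [mf f0] [mg g0]; split; last by move=> x; exact: mule_ge0.
by apply: emeasurable_funM => //; exact: measurable_reflect.
Qed.

Lemma convDl f g h t : nnker f -> nnker g -> nnker h ->
  conv (f \+ g) h t = conv f h t + conv g h t.
Proof.
move=> kf kg kh; have [mf f0] := nnker_conv_integrand t kf kh.
have [mg g0] := nnker_conv_integrand t kg kh.
rewrite /conv -ge0_integralD//; apply: eq_integral => s _.
by rewrite ge0_muleDl//; [exact: kf.2|exact: kg.2].
Qed.

Lemma convDr f g h t : nnker f -> nnker g -> nnker h ->
  conv f (g \+ h) t = conv f g t + conv f h t.
Proof.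
move=> kf kg kh; rewrite convC//; last exact: nnker_add.
by rewrite convDl// !(convC kf).
Qed.

Lemma convZl (c : R) f g t : (0 <= c)%R -> nnker f -> nnker g ->
  conv (fun x => c%:E * f x) g t = c%:E * conv f g t.
Proof.
move=> c0 kf kg; have [mf f0] := nnker_conv_integrand t kf kg.
rewrite /conv -ge0_integralZl//.
by apply: eq_integral => s _; rewrite muleA.
Qed.

Lemma convZr (c : R) f g t : (0 <= c)%R -> nnker f -> nnker g ->
  conv f (fun x => c%:E * g x) t = c%:E * conv f g t.
Proof.
move=> c0 kf kg; rewrite convC//; last exact: nnker_scale.
by rewrite convZl// (convC kf).
Qed.

(* Monotonicity may be used at a single time t, with hypotheses on the values
   that the integrand actually sees. *)
Lemma le_conv f f' g g' t : nnker f -> nnker g -> nnker f' -> nnker g' ->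
  (forall s, f (t - s)%R * g s <= f' (t - s)%R * g' s) ->
  conv f g t <= conv f' g' t.
Proof.
move=> kf kg kf' kg' le_fg; have [mf f0] := nnker_conv_integrand t kf kg.
have [mg g0] := nnker_conv_integrand t kf' kg'.
exact: ge0_le_integral.
Qed.

(** Tonelli and translation invariance. Applied to powers weighted by exp(-s), this is what links
    the Beta integral to Gamma. *)
Lemma integral_conv f g : nnker f -> nnker g ->
  \int[mu]_t conv f g t = \int[mu]_t f t * \int[mu]_t g t.
Proof.
move=> kf kg; rewrite /conv (fubini_tonelli (fun p : measurableTypeR R * measurableTypeR R =>
  f (p.1 - p.2)%R * g p.2))//=.
- case: kf kg => mf f0 [mg g0].
  transitivity (\int[mu]_s ((\int[mu]_t f t) * g s)).
    apply: eq_integral => s _.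
    rewrite ge0_integralZr//; last first.
      by apply: (measurableT_comp mf); exact: measurable_funB.
    by rewrite (ge0_integral_shift (- s) mf f0).
  by rewrite ge0_integralZl//; exact: integral_ge0.
- by apply: measurable_conv2; [exact: kf.1|exact: kg.1].
- by move=> x; apply: mule_ge0; [exact: kf.2|exact: kg.2].
Qed.

End convolution.

(** * Gamma function and fractional integration kernels *)

Section ftc_open.
Context {R : realType}.
Local Notation mu := (@lebesgue_measure R).
Implicit Types (f F : R -> R) (a b : R).

Lemma is_derive_continuous f (x df : R) : is_derive x (1 : R) f df -> {for x, continuous f}.
Proof.
by move=> [dfx _]; apply: differentiable_continuous; exact/derivable1_diffP.
Qed.

(* The integrand may blow up at either end point. *)
Lemma ge0_integral_oo f F a b : a < b ->
  (forall x, a < x < b -> 0 <= f x) ->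
  {in `]a, b[, continuous f} ->
  (forall x, a < x < b -> is_derive x 1 F (f x)) ->
  F x @[x --> a^'+] --> F a -> F x @[x --> b^'-] --> F b ->
  (\int[mu]_(x in `]a, b[) (f x)%:E = (F b - F a)%:E)%E.
Proof.
move=> ab f0 cf dF Fa Fb; pose d := (b - a) / 2.
have d0 : 0 < d by rewrite divr_gt0// subr_gt0.
have ad_bd : a + d = b - d by rewrite /d; field.
(* Compact intervals exhausting ]a, b[; the denominator n + 2 keeps [e n] strictly below half the
   length, so that none of them degenerates. *)
pose e n := d / n.+2%:R.
have e0 n : 0 < e n by rewrite divr_gt0.
have ed n : e n < d by rewrite /e ltr_pdivrMr// ltr_pMr// ltr1n.
have aebe n : a + e n < b - e n.
  by rewrite (@lt_trans _ _ (a + d))// ?ltrD2l// ad_bd ltrD2l ltrN2.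
pose I n := `[a + e n, b - e n]%classic.
have subI n : I n `<=` `]a, b[.
  move=> x; rewrite /I /= !in_itv/= => /andP[ax xb].
  by rewrite (lt_le_trans _ ax) ?ltrDl//= (le_lt_trans xb)// ltrBlDr ltrDl.
have e_cvg : e n @[n --> \oo] --> 0.
  rewrite -(mulr0 d); apply: cvgM; first exact: cvg_cst.
  apply/gtr0_cvgV0; first by apply: nearW => n.
  by apply: (cvg_comp (addn 2%N)); [exact: cvg_addnl|exact: cvgr_idn].
have UI : \bigcup_n I n = `]a, b[%classic.
  apply/seteqP; split => [x [n _ /subI]//|x /=]; rewrite in_itv/= => /andP[ax xb].
  have : \forall n \near \oo, e n < Num.min (x - a) (b - x).
    apply: (cvgr_lt 0) => //; by rewrite lt_min !subr_gt0 ax.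
  move=> [n _ /(_ n (leqnn n))]; rewrite lt_min => /andP[xa bx].
  by exists n => //; rewrite /I/= in_itv/= -lerBrDl ltW//= lerBrDl -lerBrDr ltW.
have mf n : measurable_fun (I n) f.
  apply: measurable_funS (subI n) _ => //.
  by apply: open_continuous_measurable_fun => // x; rewrite inE; exact: cf.
have cvgI : (\int[mu]_(x in I i) (f x)%:E)%E @[i --> \oo] -->
            (\int[mu]_(x in `]a, b[) (f x)%:E)%E.
  rewrite -UI; apply: ge0_nondecreasing_set_cvg_integral.
  - move=> m n mn; apply/subsetPset => x; rewrite /I/= !in_itv/= => /andP[ax xb].
    have emn : e n <= e m.
      by rewrite /e ler_wpM2l ?(ltW d0)// lef_pV2 ?posrE// ler_nat !ltnS.
    by rewrite (le_trans _ ax) ?lerD2l//= (le_trans xb)// lerD2l lerN2.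
  - by move=> i; exact: measurable_itv.
  - by move=> i; apply/measurable_EFinP; exact: mf.
  - by move=> i x /(subI i x) /=; rewrite in_itv/= lee_fin; exact: f0.
have IE n : (\int[mu]_(x in I n) (f x)%:E = (F (b - e n))%:E - (F (a + e n))%:E)%E.
  have sI x : x \in `[a + e n, b - e n] -> a < x < b.
    by move/(subI n x); rewrite /= in_itv.
  have sI' x : x \in `]a + e n, b - e n[ -> a < x < b.
    by move=> xI; apply: sI; exact: subset_itv_oo_cc xI.
  apply: continuous_FTC2 => //.
  - apply: continuous_in_subspaceT => x; rewrite inE /= => /sI xI.
    by apply: cf; rewrite in_itv.
  - have cF : {within `[a + e n, b - e n], continuous F}.
      apply: derivable_within_continuous => x /sI xI.
      by have [] := dF _ xI.
    have [? ? ?] := (continuous_within_itvP F (aebe n)).1 cF.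
    by split=> // x /sI' xI; have [] := dF _ xI.
  - move=> x /sI' xI; rewrite derive1E; by have [] := dF _ xI.
have cvgF : ((F (b - e n))%:E - (F (a + e n))%:E)%E @[n --> \oo] --> (F b - F a)%:E.
  under eq_fun do rewrite -EFinB.
  apply: cvg_EFin; first exact: nearW.
  apply: cvgB.
    apply: (cvg_at_leftP F b (F b)).1 => //; split; first by move=> n; rewrite ltrBlDr ltrDl.
    by rewrite -[X in _ --> X]subr0; apply: cvgB => //; exact: cvg_cst.
  apply: (cvg_at_rightP F a (F a)).1 => //; split; first by move=> n; rewrite ltrDl.
  by rewrite -[X in _ --> X]addr0; apply: cvgD => //; exact: cvg_cst.
apply: (cvg_unique _ cvgI) => //.
rewrite /= [X in X @ _ --> _](_ : _ = fun n => ((F (b - e n))%:E - (F (a + e n))%:E)%E)//.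
by apply/funext => n; rewrite IE.
Qed.

End ftc_open.

(** * Gamma and Beta integrals, and the semigroup of fractional integration kernels *)

Section gamma.
Context {R : realType}.
Local Notation mu := (@lebesgue_measure R).
Implicit Types (a b x t : R).

(** The index is shifted as in the Gamma integral, so that indices add under convolution; the value
    0 for t <= 0 makes the kernel causal. *)
Definition pw a t : R := if 0 < t then t `^ (a - 1) else 0.

Lemma pw_ge0 a t : 0 <= pw a t.
Proof. by rewrite /pw; case: ifP => // _; exact: powR_ge0. Qed.

Lemma pwE a t : 0 < t -> pw a t = t `^ (a - 1).
Proof. by rewrite /pw => ->. Qed.

Lemma pw_le0 a t : t <= 0 -> pw a t = 0.
Proof. by rewrite /pw ltNge => ->. Qed.

Lemma measurable_pw a : measurable_fun setT (pw a).
Proof.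
by apply: measurable_fun_ifT => //; exact: measurable_fun_ltr.
Qed.

Lemma powR_cvg_right a : 0 < a -> t `^ a @[t --> (0 : R)^'+] --> 0 `^ a.
Proof. by move=> a0; rewrite powR0 ?gt_eqF//; exact: powR_cvg0. Qed.

Lemma powR_continuous_gt0 a x : 0 < x -> {for x, continuous (fun t : R => t `^ a)}.
Proof. by move=> x0; apply: is_derive_continuous; exact: is_derive1_powR. Qed.

Lemma integral_powR_itv a x : 0 < a -> 0 < x ->
  (\int[mu]_(t in `]0%R, x[) (t `^ (a - 1))%:E = (x `^ a / a)%:E)%E.
Proof.
move=> a0 x0.
have -> : x `^ a / a = x `^ a * a^-1 - 0 `^ a * a^-1.
  by rewrite powR0 ?gt_eqF// mul0r subr0.
apply: (ge0_integral_oo (F := fun t => t `^ a * a^-1)) => //.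
- by move=> t _; exact: powR_ge0.
- by move=> t; rewrite in_itv/= => /andP[t0 _]; exact: powR_continuous_gt0.
- move=> t /andP[t0 _].
  rewrite [X in is_derive _ _ X _](_ : _ = a^-1 *: (fun s : R => s `^ a)); last first.
    by apply/funext => s; rewrite mulrC.
  apply: is_derive_eq; first by apply: is_deriveZ; exact: is_derive1_powR.
  by rewrite /GRing.scale/= mulrA mulVf ?mul1r// gt_eqF.
- by apply: cvgM; [exact: powR_cvg_right|exact: cvg_cst].
- apply: cvgM; last exact: cvg_cst.
  by apply: cvg_at_left_filter; exact: powR_continuous_gt0.
Qed.

Lemma integral_pw a x : 0 < a -> 0 < x ->
  (\int[mu]_(t in `]0%R, x[) (pw a t)%:E = (x `^ a / a)%:E)%E.
Proof.
move=> a0 x0; rewrite -integral_powR_itv//; apply: eq_integral => t.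
by rewrite inE/= in_itv/= => /andP[t0 _]; rewrite pwE.
Qed.

Lemma GammaTE a : Gamma a = \int[mu]_s (pw a s * expR (- s)).
Proof.
rewrite /Gamma Rintegral_mkcond; congr Rintegral; apply/funext => s.
rewrite patchE mem_setE in_itv/= andbT /pw.
by case: ifP => _; rewrite ?mul0r.
Qed.

Lemma measurable_pw_expR a : measurable_fun setT (fun s => pw a s * expR (- s)).
Proof.
apply: measurable_funM; first exact: measurable_pw.
by apply: measurableT_comp => //; exact: measurable_expR.
Qed.

Lemma exponential_pdf_pos (r s : R) : 0 <= s ->
  exponential_pdf r s = r * expR (- r * s).
Proof. by move=> s0; rewrite exponential_pdfE. Qed.

(** An integrable majorant of the Gamma integrand: the bare power on ]0, 2[, and beyond 2 half of
    the exponential decay absorbs the power. Indeed s / (2 a) <= exp(s / (2 a)) gives s^a <= (2 a)^a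
    exp(s / 2), and the remaining exp(- s / 2) is twice the exponential density of rate 1/2. *)
Lemma pw_expR_le a s : 0 < a -> pw a s * expR (- s) <=
  (pw a \_ `]0, 2[) s + (2 * a) `^ a * 2 * exponential_pdf 2^-1 s.
Proof.
move=> a0; have half0 : 0 <= 2^-1 :> R by rewrite invr_ge0.
have C0 : 0 <= (2 * a) `^ a * 2 by rewrite mulr_ge0// powR_ge0.
have [s0|s0] := leP s 0.
  rewrite pw_le0// mul0r addr_ge0// ?(mulr_ge0 C0) ?exponential_pdf_ge0//.
  by rewrite patchE; case: ifP => // _; exact: pw_ge0.
have [s2|s2] := ltP s 2.
  rewrite patchE mem_setE in_itv/= s0 s2/= ler_wpDr ?mulr_ge0 ?powR_ge0 ?exponential_pdf_ge0//.
  by rewrite ler_piMr ?pw_ge0// -expR0 ler_expR oppr_le0 ltW.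
rewrite patchE mem_setE in_itv/= s0/= (ltNge s 2) s2/= add0r (exponential_pdf_pos _ (ltW s0)).
rewrite pwE//.
have -> : expR (- s) = expR (- 2^-1 * s) * expR (- 2^-1 * s).
  by rewrite -expRD; congr expR; field.
rewrite [X in _ <= X](_ : _ = (2 * a) `^ a * expR (- 2^-1 * s)); last by field.
rewrite mulrA ler_wpM2r ?expR_ge0//.
rewrite (_ : expR _ = (expR (s / 2))^-1); last by rewrite -expRN; congr expR; field.
rewrite ler_pdivrMr ?expR_gt0//.
have sa : s `^ (a - 1) <= s `^ a.
  by apply: ler_powR; [rewrite (le_trans _ s2)// ler1n|rewrite gerBl].
apply: (le_trans sa).
have -> : expR (s / 2) = expR (s / (2 * a)) `^ a.
  by rewrite -expRM; congr expR; field; rewrite gt_eqF.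
have a2 : 0 < 2 * a by rewrite mulr_gt0.
rewrite -powRM ?expR_ge0 ?(ltW a2)//.
apply: ge0_ler_powR; rewrite ?nnegrE ?(ltW s0) ?(ltW a0) ?mulr_ge0 ?expR_ge0 ?(ltW a2) ?(ltW a0)//.
rewrite mulrC -ler_pdivrMr//.
by rewrite (le_trans _ (expR_ge1Dx _))// lerDr.
Qed.

Lemma Gamma_lty a : 0 < a -> (\int[mu]_s (pw a s * expR (- s))%:E < +oo)%E.
Proof.
move=> a0; have half0 : 0 < 2^-1 :> R by rewrite invr_gt0.
have mpdf := measurable_exponential_pdf (2^-1 : R).
have C0 : 0 <= (2 * a) `^ a * 2 by rewrite mulr_ge0// powR_ge0.
have mr : measurable_fun setT (pw a \_ `]0, 2[).
  apply/(measurable_restrictT (pw a)) => //.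
  by apply: measurable_funTS; exact: measurable_pw.
apply: (@le_lt_trans _ _ (\int[mu]_s (((pw a \_ `]0, 2[) s)%:E
    + ((2 * a) `^ a * 2 * exponential_pdf 2^-1 s)%:E))%E).
  apply: ge0_le_integral => //.
  - by move=> s _; rewrite lee_fin mulr_ge0 ?pw_ge0 ?expR_ge0.
  - by apply/measurable_EFinP; exact: measurable_pw_expR.
  - by apply: emeasurable_funD; apply/measurable_EFinP => //; exact: measurable_funM.
  - by move=> s _; rewrite -EFinD lee_fin pw_expR_le.
rewrite ge0_integralD//; last 4 first.
- by move=> s _; rewrite lee_fin patchE; case: ifP => // _; exact: pw_ge0.
- exact/measurable_EFinP.
- by move=> s _; rewrite lee_fin mulr_ge0// exponential_pdf_ge0// ltW.
- by apply/measurable_EFinP => //; exact: measurable_funM.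
have -> : (\int[mu]_s ((pw a \_ `]0%R, 2[) s)%:E = (2 `^ a / a)%:E)%E.
  rewrite -integral_pw// [RHS]integral_mkcond; apply: eq_integral => s _.
  by rewrite !patchE; case: ifP.
under eq_integral do rewrite EFinM.
rewrite ge0_integralZl//; last 2 first.
- exact/measurable_EFinP.
- by move=> s _; rewrite lee_fin exponential_pdf_ge0// ltW.
by rewrite integral_exponential_pdf// mule1 -EFinD ltry.
Qed.

Lemma GammaE a : 0 < a -> (Gamma a)%:E = (\int[mu]_s (pw a s * expR (- s))%:E)%E.
Proof.
move=> a0; rewrite GammaTE /Rintegral fineK// ge0_fin_numE; first exact: Gamma_lty.
by apply: integral_ge0 => s _; rewrite lee_fin mulr_ge0 ?pw_ge0 ?expR_ge0.
Qed.

(** The integrand is estimated from below on [M, M + 1] only. Since M is free, this shows that Gamma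
    outgrows every geometric rate, which is all that the Mittag-Leffler series requires in place of
    Stirling's formula. *)
Lemma Gamma_ge_pow (M : R) a : 0 < M -> 0 < a ->
  M `^ a / (M + 1) * expR (- (M + 1)) <= Gamma a.
Proof.
move=> M0 a0; have M1 : 0 < M + 1 by rewrite addr_gt0.
rewrite -lee_fin GammaE//; set c := _ * _.
have c0 : 0 <= c by rewrite mulr_ge0 ?expR_ge0// divr_ge0 ?powR_ge0 ?(ltW M1).
have -> : c%:E = (\int[mu]_s (c%:E * (\1_(`[M, M + 1]) s)%:E))%E.
  rewrite ge0_integralZl//; last by apply/measurable_EFinP; exact: measurable_indic.
  rewrite integral_indic//= setIT lebesgue_measure_itv/= lte_fin ltrDl ltr01.
  by rewrite -EFinB addrAC subrr add0r mule1.
apply: ge0_le_integral => //.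
- by move=> s _; rewrite mule_ge0// lee_fin.
- by apply: measurable_funeM; apply/measurable_EFinP; exact: measurable_indic.
- by apply/measurable_EFinP; exact: measurable_pw_expR.
- move=> s _; rewrite indicE mem_setE in_itv/= -EFinM lee_fin.
  have [/andP[Ms sM]|_] := boolP (_ && _); last by rewrite mulr0 mulr_ge0 ?pw_ge0 ?expR_ge0.
  have s0 := lt_le_trans M0 Ms.
  have sa : s `^ (a - 1) = s `^ a / s.
    rewrite powRB ?powRr1 ?(ltW s0)//; apply/implyP => _.
    by rewrite gt_eqF.
  rewrite mulr1 pwE// /c sa.
  rewrite ler_pM ?expR_ge0 ?divr_ge0 ?powR_ge0 ?(ltW M1)// ?ler_expR ?lerN2//.
  rewrite ler_pM ?powR_ge0 ?invr_ge0 ?(ltW M1)// ?lef_pV2//.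
  by apply: ge0_ler_powR; rewrite ?nnegrE ?(ltW a0) ?(ltW M0) ?(ltW s0).
Qed.

Lemma Gamma_gt0 a : 0 < a -> 0 < Gamma a.
Proof.
move=> a0; rewrite -lte_fin GammaE//.
apply: (@lt_le_trans _ _ (\int[mu]_(s in `]0%R, 1%R[) ((expR (-1))%:E * (pw a s)%:E))%E).
  rewrite ge0_integralZl ?lee_fin ?expR_ge0//; last 2 first.
  - by apply/measurable_EFinP; apply: measurable_funTS; exact: measurable_pw.
  - by move=> s _; rewrite lee_fin pw_ge0.
  by rewrite integral_pw// powR1 mul1r -EFinM lte_fin mulr_gt0 ?expR_gt0 ?invr_gt0.
rewrite integral_mkcond; apply: ge0_le_integral => //.
- by move=> s _; apply: erestrict_ge0 => {}s _; rewrite mule_ge0 ?lee_fin ?pw_ge0 ?expR_ge0.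
- apply/(measurable_restrictT (fun s => (expR (-1))%:E * (pw a s)%:E)%E) => //.
  apply: measurable_funeM; apply/measurable_EFinP; apply: measurable_funTS.
  exact: measurable_pw.
- by apply/measurable_EFinP; exact: measurable_pw_expR.
- move=> s _; rewrite patchE mem_setE in_itv/=; case: ifPn => [/andP[s0 s1]|_].
    by rewrite -EFinM lee_fin mulrC ler_wpM2l ?pw_ge0// ler_expR lerN2 ltW.
  by rewrite lee_fin mulr_ge0 ?pw_ge0 ?expR_ge0.
Qed.

Lemma Gamma1 : Gamma (1 : R) = 1.
Proof.
apply: EFin_inj; rewrite GammaE//.
have <- := @integral_exponential_pdf R 1 ltr01.
rewrite [RHS](_ : _ = \int[mu]_(x in `]0%R, +oo[) (exponential_pdf 1 x)%:E)%E.
  rewrite [RHS]integral_mkcond; apply: eq_integral => s _; rewrite patchE mem_setE in_itv/= andbT.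
  rewrite /pw; case: ifPn => [s0|_]; last by rewrite mul0r.
  by rewrite exponential_pdf_pos ?ltW// subrr powRr0 mulN1r.
rewrite integral_itv_obnd_cbnd; last first.
  by apply/measurable_EFinP/measurable_funTS; exact: measurable_exponential_pdf.
rewrite [RHS]integral_mkcond; apply: eq_integral => s _; rewrite patchE mem_setE in_itv/= andbT.
by case: ifPn => //; rewrite -ltNge => s0; rewrite lt0_exponential_pdf.
Qed.

Lemma nnker_EFin (f : R -> R) : measurable_fun setT f -> (forall s, 0 <= f s) ->
  nnker (EFin \o f).
Proof. by move=> mf f0; split; [exact/measurable_EFinP|move=> s; rewrite lee_fin]. Qed.

Lemma nnker_pw a : nnker (EFin \o pw a).
Proof. by apply: nnker_EFin; [exact: measurable_pw|exact: pw_ge0]. Qed.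

Lemma pwM a x t : 0 < t -> pw a (t * x) = t `^ (a - 1) * pw a x.
Proof.
move=> t0; rewrite /pw pmulr_rgt0//; case: ifPn => [x0|_]; last by rewrite mulr0.
by rewrite powRM// ltW.
Qed.

(** Homogeneity: the substitution s -> t s reduces the convolution to the Beta integral at time
    1. *)
Lemma conv_pw_scale a b t : 0 < t ->
  (conv (EFin \o pw a) (EFin \o pw b) t =
   (t `^ (a + b - 1))%:E * conv (EFin \o pw a) (EFin \o pw b) 1)%E.
Proof.
move=> t0; have [mI I0] := nnker_conv_integrand t (nnker_pw a) (nnker_pw b).
have [mJ J0] := nnker_conv_integrand 1 (nnker_pw a) (nnker_pw b).
rewrite /conv (ge0_integral_affine 0 t0 mI I0).
under eq_integral => s _.
  rewrite addr0 /= (_ : t - t * s = t * (1 - s)); last by ring.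
  rewrite !pwM// -EFinM.
  rewrite (_ : t `^ (a - 1) * pw a (1 - s) * (t `^ (b - 1) * pw b s) =
     t `^ (a - 1) * t `^ (b - 1) * (pw a (1 - s) * pw b s)); last by ring.
  rewrite EFinM [X in (_ * X)%E]EFinM; over.
rewrite ge0_integralZl//; last 2 first.
- by move=> s _; rewrite -EFinM lee_fin mulr_ge0 ?pw_ge0.
- by rewrite lee_fin mulr_ge0 ?powR_ge0.
rewrite muleA -EFinM; congr (EFin _ * _)%E.
have t1 : t = t `^ 1 by rewrite powRr1 ?ltW.
have tn0 : t != 0 by rewrite gt_eqF.
rewrite [X in X * _]t1 -!powRD ?tn0 ?implybT//.
by rewrite (_ : 1 + (a - 1 + (b - 1)) = a + b - 1)//; ring.
Qed.

(** With [q c s] = s^(c - 1) exp(-s), the exponential factors out of the convolution, so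
    [conv (q a) (q b)] is B times [q (a + b)]. Integrating both sides gives Gamma a Gamma b = B
    Gamma (a + b), and the finiteness of B as well. *)
Lemma beta_Gamma a b : 0 < a -> 0 < b ->
  (conv (EFin \o pw a) (EFin \o pw b) 1 = (Gamma a * Gamma b / Gamma (a + b))%:E)%E.
Proof.
move=> a0 b0; set B := conv _ _ _.
pose q c s := (pw c s * expR (- s))%:E.
have kq c : nnker (q c).
  apply: nnker_EFin; first exact: measurable_pw_expR.
  by move=> s; rewrite mulr_ge0 ?pw_ge0 ?expR_ge0.
have B0 : (0 <= B)%E by apply: (nnker_conv _ _).2; exact: nnker_pw.
have qE t : conv (q a) (q b) t = (B * (q (a + b)%R t))%E.
  have [t0|t0] := leP t 0.
    rewrite /q pw_le0// mul0r mule0 /conv integral0_eq// => s _.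
    have [s0|s0] := leP s 0; first by rewrite (pw_le0 b s0) mul0r mule0.
    by rewrite pw_le0 ?mul0r ?mul0e// lerBlDr add0r (le_trans t0)// ltW.
  transitivity ((expR (- t))%:E * conv (EFin \o pw a) (EFin \o pw b) t)%E.
    have [mI I0] := nnker_conv_integrand t (nnker_pw a) (nnker_pw b).
    rewrite /conv -ge0_integralZl ?lee_fin ?expR_ge0//.
    apply: eq_integral => s _; rewrite /q /= -!EFinM; congr EFin.
    rewrite (_ : - t = - (t - s) + - s); last by ring.
    by rewrite expRD; ring.
  rewrite conv_pw_scale// -/B /q pwE//.
  by rewrite muleA -EFinM muleC mulrC.
have : (\int[mu]_t conv (q a) (q b) t = B * (Gamma (a + b))%:E)%E.
  rewrite GammaE ?addr_gt0// -ge0_integralZl//.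
  - by apply: eq_integral => t _; rewrite qE.
  - exact: (kq _).1.
  - by move=> s _; exact: (kq _).2.
rewrite integral_conv// -!GammaE// => /esym; rewrite -EFinM => BE.
have Gab := Gamma_gt0 (addr_gt0 a0 b0).
have Bfin : B \is a fin_num.
  rewrite ge0_fin_numE// ltNge; apply/negP; rewrite leye_eq => /eqP Bo.
  by move: BE; rewrite Bo gt0_mulye.
move: BE; rewrite -(fineK Bfin) -EFinM => -[] <-.
by rewrite mulfK// gt_eqF.
Qed.

(* The Riemann-Liouville kernel k for a = alpha, extended by 0 to t <= 0. *)
Definition kern a : R -> \bar R := fun t => (pw a t / Gamma a)%:E.

Lemma nnker_kern a : 0 < a -> nnker (kern a).
Proof.
move=> a0; apply: nnker_EFin.
  by apply: measurable_funM => //; exact: measurable_pw.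
by move=> s; rewrite mulr_ge0 ?pw_ge0// invr_ge0 ltW// Gamma_gt0.
Qed.

Lemma conv_supp (f g : R -> \bar R) t : t <= 0 ->
  (forall s, s <= 0 -> f s = 0%E) -> (forall s, s <= 0 -> g s = 0%E) ->
  conv f g t = 0%E.
Proof.
move=> t0 f0 g0; rewrite /conv integral0_eq// => s _.
have [s0|s0] := leP s 0; first by rewrite g0// mule0.
by rewrite f0 ?mul0e// lerBlDr add0r (le_trans t0)// ltW.
Qed.

Lemma kern_le0 a t : t <= 0 -> kern a t = 0%E.
Proof. by move=> t0; rewrite /kern pw_le0// mul0r. Qed.

(** The semigroup law of Riemann-Liouville integrals: the normalisation by Gamma cancels exactly the
    Beta factor. *)
Lemma conv_kern a b : 0 < a -> 0 < b -> conv (kern a) (kern b) = kern (a + b).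
Proof.
move=> a0 b0; apply/funext => t.
have [t0|t0] := leP t 0.
  by rewrite kern_le0// conv_supp// => s s0; exact: kern_le0.
have Ga := Gamma_gt0 a0; have Gb := Gamma_gt0 b0.
have Gab := Gamma_gt0 (addr_gt0 a0 b0).
have Ca : 0 <= (Gamma a)^-1 by rewrite invr_ge0 (ltW Ga).
have Cb : 0 <= (Gamma b)^-1 by rewrite invr_ge0 (ltW Gb).
have kernE c : kern c = (fun x => (Gamma c)^-1%:E * (EFin \o pw c) x)%E.
  by apply/funext => s; rewrite /kern /= -EFinM mulrC.
rewrite (kernE a) (kernE b) (convZl _ Ca (nnker_pw a) (nnker_scale Cb (nnker_pw b))).
rewrite (convZr _ Cb (nnker_pw a) (nnker_pw b)) (conv_pw_scale _ _ t0).
rewrite (beta_Gamma a0 b0) /kern (pwE _ t0) -!EFinM; congr EFin.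
move: Ga Gb Gab; move: (Gamma a) (Gamma b) (Gamma (a + b)) => A B C A0 B0 C0.
by field; rewrite !gt_eqF.
Qed.

End gamma.

(** * The resolvent kernel *)

Section rapidly_decreasing.
Context {R : realType}.
Implicit Types (a : R^nat).

(** Decay faster than any geometric sequence, that is, an infinite radius of convergence, in a form
    that passes easily to the differentiated series. *)
Definition rapid a := forall M : R, 0 < M -> exists2 C : R, 0 <= C & forall j, `|a j| <= C / M ^+ j.

(** The factor j + 1 is at most 2^(j + 1), which the decay at the rate 2 M absorbs. *)
Lemma rapid_diffs a : rapid a -> rapid (pseries_diffs a).
Proof.
move=> ra M M0; have M20 : 0 < 2 * M by rewrite mulr_gt0.
have [C C0 aC] := ra _ M20; exists (C / M); first by rewrite divr_ge0// ltW.
move=> j; rewrite /pseries_diffs normrM normr_nat.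
apply: (@le_trans _ _ (2 ^+ j.+1 * (C / (2 * M) ^+ j.+1))).
  rewrite ler_pM// -natrX ler_nat; exact: ltnW (ltn_expl _ _).
rewrite exprMn (_ : _ * _ = C / M ^+ j.+1).
  by rewrite exprS invfM mulrA mulrAC.
by field; rewrite !expf_neq0// ?gt_eqF.
Qed.

Lemma le_norm_pow (b B x : R) j : b <= B ^+ j -> 0 <= x ->
  b * x ^+ j <= `|(B * x) ^+ j|.
Proof.
move=> bB x0; rewrite exprMn normrM (ger0_norm (exprn_ge0 j x0)).
by rewrite ler_wpM2r ?exprn_ge0// (le_trans bB)// ler_norm.
Qed.

Lemma rapid_cvg a x : rapid a -> cvgn (series (fun j => `|a j * x ^+ j|)).
Proof.
(* The factor 2 leaves a geometric majorant of ratio 1/2; the summand 1 keeps M positive at x =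
   0. *)
move=> ra; pose M := 2 * (`|x| + 1).
have x1 : 0 < `|x| + 1 by rewrite ltr_wpDl.
have M0 : 0 < M by rewrite mulr_gt0.
have [C C0 aC] := ra _ M0.
apply: (@series_le_cvg _ _ (geometric C (2^-1 : R))).
- by move=> n.
- by move=> n; rewrite /= mulr_ge0// exprn_ge0// invr_ge0.
- move=> n /=; rewrite normrM normrX.
  apply: (@le_trans _ _ (C / M ^+ n * (`|x| + 1) ^+ n)).
    by rewrite ler_pM// lerXn2r ?nnegrE// ?(ltW x1)// lerDl.
  by rewrite /M exprMn exprVn -mulrA ler_wpM2l// invfM -mulrA mulVf ?mulr1.
- by apply: is_cvg_geometric_series; rewrite ger0_norm ?invf_lt1 ?ltr1n// invr_ge0.
Qed.

Lemma rapid_is_cvg a x : rapid a -> cvgn (pseries a x).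
Proof. by move=> ra; apply: normed_cvg; exact: rapid_cvg. Qed.

Lemma rapid_continuous a : rapid a -> continuous (fun x => limn (pseries a x)).
Proof.
move=> ra x; have ra' := rapid_diffs ra.
apply: is_derive_continuous.
apply: (pseries_snd_diffs (K := `|x| + 1)); try exact: rapid_is_cvg.
  exact/rapid_is_cvg/rapid_diffs.
by rewrite [X in _ < X]ger0_norm ?addr_ge0// ltrDl.
Qed.

End rapidly_decreasing.

(** * The Mittag-Leffler kernel as a series of fractional integration kernels *)

Section mittag_leffler_kernel.
Context {R : realType}.
Local Notation mu := (@lebesgue_measure R).
Variable al : R.
Hypothesis al0 : 0 < al.

Let ex (j : nat) := al * j%:R + al.

Let ex_gt0 j : 0 < ex j.
Proof. by rewrite ltr_wpDl// mulr_ge0// ltW. Qed.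

Definition ml_coef (j : nat) : R := (Gamma (ex j))^-1.

Lemma ml_coef_gt0 j : 0 < ml_coef j.
Proof. by rewrite invr_gt0 Gamma_gt0. Qed.

(** For m = M^(1 / al) one has m^(al j + al) = M^(j + 1), so the lower bound of Gamma taken at m
    gives decay at the rate M. *)
Lemma ml_coef_rapid : rapid ml_coef.
Proof.
move=> M M0; pose m := M `^ al^-1; have m0 : 0 < m by exact: powR_gt0.
have mE j : m `^ ex j = M ^+ j.+1.
  rewrite /m -powRrM /ex (_ : al^-1 * _ = j.+1%:R) ?powR_mulrn ?(ltW M0)//.
  by rewrite -natr1; field; rewrite gt_eqF.
have m1 : 0 < m + 1 by rewrite addr_gt0.
pose c := (m + 1) * (expR (- (m + 1)))^-1 / M.
exists c; first by rewrite !mulr_ge0 ?invr_ge0 ?expR_ge0// ltW.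
move=> j; rewrite gtr0_norm ?ml_coef_gt0// /ml_coef.
have := Gamma_ge_pow m0 (ex_gt0 j); rewrite mE.
move: (Gamma (ex j)) (Gamma_gt0 (ex_gt0 j)) => G G0 leG.
have e0 := expR_gt0 (- (m + 1)).
rewrite (_ : c / M ^+ j = (M ^+ j.+1 / (m + 1) * expR (- (m + 1)))^-1).
  by rewrite lef_pV2 ?posrE// !mulr_gt0 ?invr_gt0// exprn_gt0.
rewrite /c; move: (expR _) e0 => e e0; rewrite exprS; field.
by rewrite expf_neq0 ?gt_eqF.
Qed.

Lemma mittag_lefflerE s : mittag_leffler al al s = limn (pseries ml_coef s).
Proof. by []. Qed.

Lemma mittag_leffler_continuous : continuous (mittag_leffler al al).
Proof. exact/rapid_continuous/ml_coef_rapid. Qed.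

Lemma mittag_leffler0_gt0 : 0 < mittag_leffler al al 0.
Proof.
rewrite mittag_lefflerE (_ : limn _ = ml_coef 0%N); first exact: ml_coef_gt0.
apply/cvg_lim => //; rewrite -cvg_shiftS/=.
rewrite [X in X @ _ --> _](_ : _ = fun=> ml_coef 0%N); first exact: cvg_cst.
apply/funext => n; rewrite /pseries /series/= big_nat_recl// expr0 mulr1.
by rewrite big1 ?addr0// => i _; rewrite exprS mul0r mulr0.
Qed.

(** Formally K is this series with c_j = (- la)^j. It is used with nonnegative coefficients only, so
    that it may be convolved term by term. *)
Definition kser (c : R^nat) (t : R) : \bar R :=
  (\sum_(j <oo) (c j)%:E * kern (ex j) t)%E.

Section kser_theory.
Variables (c : R^nat) (c0 : forall j, 0 <= c j).

Let term_ge0 j t : (0 <= (c j)%:E * kern (ex j) t)%E.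
Proof. by apply: mule_ge0; [rewrite lee_fin|exact: (nnker_kern (ex_gt0 j)).2]. Qed.

Lemma nnker_kser : nnker (kser c).
Proof.
split; last by move=> t; apply: nneseries_ge0 => n _ _; exact: term_ge0.
apply: ge0_emeasurable_sum; [by move=> k x _ _; exact: term_ge0|move=> k _].
by apply: measurable_funeM; exact: (nnker_kern (ex_gt0 k)).1.
Qed.

(** By the semigroup law, convolution with the kernel of index al moves each term to the next index.
    Hence a relation between consecutive coefficients becomes a Volterra equation. *)
Lemma kser_rec (d : R^nat) (b : R) t : 0 <= b -> (forall j, 0 <= d j) ->
  (forall j, c j.+1 = b * d j) ->
  kser c t = ((c 0%N)%:E * kern al t + b%:E * conv (kser d) (kern al) t)%E.
Proof.
move=> b0 d0 cd; rewrite /kser nneseries_recl//.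
have -> : ex 0 = al by rewrite /ex mulr0 add0r.
congr (_ + _)%E.
have dk_ge0 j s : (0 <= (d j)%:E * kern (ex j) s)%E.
  by apply: mule_ge0; [rewrite lee_fin|exact: (nnker_kern (ex_gt0 j)).2].
have kal := nnker_kern al0.
transitivity (b%:E * \sum_(j <oo) (d j)%:E * kern (ex j.+1) t)%E.
  rewrite -nneseriesZl//; last first.
    by move=> j _; apply: mule_ge0; [rewrite lee_fin|exact: (nnker_kern (ex_gt0 j.+1)).2].
  rewrite -nneseries_addn /=; last by move=> j; exact: term_ge0.
  by apply: eq_eseriesr => j _; rewrite addn1 cd EFinM muleA.
congr (_ * _)%E; rewrite /conv.
transitivity (\int[mu]_s (\sum_(j <oo)
    ((d j)%:E * kern (ex j) (t - s)%R * kern al s)))%E; last first.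
  apply: eq_integral => s _; rewrite muleC -nneseriesZl//.
  by apply: eq_eseriesr => j _; rewrite muleC.
rewrite integral_nneseries//; last 2 first.
- move=> j; apply: emeasurable_funM; last exact: kal.1.
  by apply: measurable_funeM; apply: measurable_reflect; exact: (nnker_kern (ex_gt0 j)).1.
- by move=> j s _; rewrite mule_ge0 ?kal.2.
apply: eq_eseriesr => j _.
have -> : kern (ex j.+1) = conv (kern (ex j)) (kern al).
  rewrite (conv_kern (ex_gt0 j) al0).
  have -> : ex j + al = ex j.+1 by rewrite /ex -natr1; ring.
  by [].
by rewrite -(convZl _ (d0 j) (nnker_kern (ex_gt0 j)) kal).
Qed.

Lemma kser_le0 t : t <= 0 -> kser c t = 0%E.
Proof. by move=> t0; apply: eseries0 => j _ _; rewrite kern_le0// mule0. Qed.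

(** The geometric bound on the coefficients makes the extended sum a convergent power series in
    t^al, by comparison with the Mittag-Leffler series at B t^al. *)
Lemma kserE (B : R) t : (forall j, c j <= B ^+ j) -> 0 < t ->
  kser c t = (t `^ (al - 1) * limn (series (fun j => ml_coef j * (c j * (t `^ al) ^+ j))))%:E.
Proof.
move=> cB t0; set u := fun j => _.
have u0 j : 0 <= u j.
  by rewrite /u mulr_ge0 ?(ltW (ml_coef_gt0 _))// mulr_ge0// exprn_ge0// powR_ge0.
have cvgu : cvgn (series u).
  apply: (@series_le_cvg _ _ (fun j => `|ml_coef j * (B * t `^ al) ^+ j|)) => // [j|].
    rewrite /u normrM gtr0_norm ?ml_coef_gt0// ler_wpM2l ?(ltW (ml_coef_gt0 _))//.
    by apply: le_norm_pow; rewrite ?powR_ge0.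
  by apply: rapid_cvg; exact: ml_coef_rapid.
rewrite EFinM /kser.
have -> : (limn (series u))%:E = (\sum_(j <oo) (u j)%:E)%E.
  rewrite -EFin_lim//; congr (limn _); apply/funext => n /=.
  by rewrite /series/= sumEFin.
rewrite -nneseriesZl; last by move=> j _; rewrite lee_fin.
apply: eq_eseriesr => j _; rewrite /kern pwE// -!EFinM; congr EFin.
rewrite /u /ml_coef -powR_mulrn ?powR_ge0// -powRrM.
rewrite (_ : ex j - 1 = (al - 1) + al * j%:R); last by rewrite /ex; ring.
rewrite powRD; last by apply/implyP => _; rewrite gt_eqF.
by rewrite -/(ex j); ring.
Qed.

End kser_theory.

Variable la : R.

(* The kernel K, extended by 0 to t <= 0. *)
Definition mlk t : R := pw al t * mittag_leffler al al (- la * t `^ al).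

Lemma mlk_le0 t : t <= 0 -> mlk t = 0.
Proof. by move=> t0; rewrite /mlk pw_le0// mul0r. Qed.

Lemma measurable_mlk : measurable_fun setT mlk.
Proof.
apply: measurable_funM; first exact: measurable_pw.
apply: measurableT_comp.
  exact: continuous_measurable_fun mittag_leffler_continuous.
by apply: measurable_funM => //; exact: measurable_powR.
Qed.

Lemma mlk_continuous t : 0 < t -> {for t, continuous mlk}.
Proof.
move=> t0.
have ct a : {for t, continuous (fun s : R => s `^ a)} by exact: powR_continuous_gt0.
have cm : {for t, continuous (fun s => s `^ (al - 1) * mittag_leffler al al (- la * s `^ al))}.
  apply: continuousM; first exact: ct.
  apply: (@continuous_comp _ _ _ (fun s => - la * s `^ al)); last exact: mittag_leffler_continuous.
  by apply: continuousM; [exact: cst_continuous|exact: ct].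
rewrite /prop_for /continuous_at {2}/mlk pwE//.
apply: cvg_trans cm; apply: near_eq_cvg; near=> s; rewrite /mlk pwE//.
near: s; exact: lt_nbhsr.
Unshelve. all: by end_near. Qed.

(** By continuity, as E_{al,al}(0) = 1 / Gamma(al) > 0. It keeps the zeros of the kernel away from
    0, so that a first zero can be considered. *)
Lemma mlk_pos_near0 : exists2 d : R, 0 < d & forall t, 0 < t < d -> 0 < mlk t.
Proof.
have c0 : (fun t : R => mittag_leffler al al (- la * t `^ al)) @ (0 : R)^'+ -->
          mittag_leffler al al 0.
  have c1 : - la * t `^ al @[t --> (0 : R)^'+] --> (0 : R).
    rewrite -[X in _ --> X](mulr0 (- la)); apply: cvgM; first exact: cvg_cst.
    exact: powR_cvg0.
  exact: (cvg_comp _ _ c1 (mittag_leffler_continuous (x := 0))).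
have : \forall t \near (0 : R)^'+, 0 < mittag_leffler al al (- la * t `^ al).
  by apply: (cvgr_gt _ c0); exact: mittag_leffler0_gt0.
rewrite near_withinE => -[d /= d0 dP]; exists d => // t /andP[t0 td].
rewrite /mlk pwE// mulr_gt0 ?powR_gt0//; apply: dP => //=.
by rewrite sub0r normrN gtr0_norm.
Qed.

(** The Mittag-Leffler factor is continuous, hence bounded on the compact range [0, T^al] of t^al;
    the singularity at 0 is entirely in the power. *)
Lemma mlk_bound T : 0 < T -> exists2 C : R, 0 <= C & forall t, t <= T ->
  `|mlk t| <= C * pw al t.
Proof.
move=> T0.
have [c _ cP] : exists2 c, c \in `[0, T `^ al] & forall t, t \in `[0, T `^ al] ->
    `|mittag_leffler al al (- la * t)| <= `|mittag_leffler al al (- la * c)|.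
  apply: (EVT_max (f := fun t => `|mittag_leffler al al (- la * t)|)).
    exact: powR_ge0.
  apply: continuous_subspaceT => x.
  apply: (continuous_comp (f := fun t => mittag_leffler al al (- la * t))); last exact: norm_continuous.
  apply: (continuous_comp (f := fun t => - la * t)); last exact: mittag_leffler_continuous.
  by apply: continuousM => //; exact: cst_continuous.
exists (`|mittag_leffler al al (- la * c)|) => // t tT.
have [t0|t0] := leP t 0; first by rewrite mlk_le0// normr0 pw_le0// mulr0.
rewrite /mlk normrM (ger0_norm (pw_ge0 _ _)) mulrC ler_wpM2r ?pw_ge0//.
apply: cP; rewrite in_itv/= powR_ge0/=.
by apply: ge0_ler_powR; rewrite ?nnegrE ?(ltW al0) ?(ltW t0) ?(ltW T0).
Qed.

(** For la > 0 the series of K alternates, so K is the difference of two nonnegative series; it is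
    stated as a sum, with the finiteness that later cancellations rely on. *)
Lemma mlk_kser (c d : R^nat) (B : R) t :
  (forall j, 0 <= c j) -> (forall j, 0 <= d j) ->
  (forall j, c j <= B ^+ j) -> (forall j, d j <= B ^+ j) ->
  (forall j, (- la) ^+ j = c j - d j) ->
  [/\ (mlk t)%:E + kser d t = kser c t, kser c t \is a fin_num & kser d t \is a fin_num]%E.
Proof.
move=> c0 d0 cB dB cd; have [t0|t0] := leP t 0.
  by rewrite mlk_le0// !kser_le0// adde0.
rewrite (kserE c0 cB t0) (kserE d0 dB t0); split => //.
rewrite /mlk pwE// -EFinD -mulrDr; congr (_ * _)%:E.
set u := fun j => ml_coef j * (c j * _); set v := fun j => ml_coef j * (d j * _).
have cv (b : R^nat) : (forall j, 0 <= b j) -> (forall j, b j <= B ^+ j) ->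
    cvgn (series (fun j => ml_coef j * (b j * (t `^ al) ^+ j))).
  move=> b0 bB.
  apply: (@series_le_cvg _ _ (fun j => `|ml_coef j * (B * t `^ al) ^+ j|)) => // [j|j|].
      by rewrite mulr_ge0 ?(ltW (ml_coef_gt0 _))// mulr_ge0// exprn_ge0// powR_ge0.
    rewrite normrM gtr0_norm ?ml_coef_gt0// ler_wpM2l ?(ltW (ml_coef_gt0 _))//.
    by apply: le_norm_pow; rewrite ?powR_ge0.
  by apply: rapid_cvg; exact: ml_coef_rapid.
rewrite mittag_lefflerE (_ : pseries _ _ = series (u - v)).
  by rewrite (lim_seriesB (cv _ c0 cB) (cv _ d0 dB)) subrK.
rewrite /pseries; congr series; apply/funext => j.
transitivity (u j - v j) => //.
by rewrite /= exprMn cd /u /v; ring.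
Qed.

End mittag_leffler_kernel.

(** * Nonnegativity of the resolvent kernel and its Volterra equation *)

Section resolvent_positivity.
Context {R : realType}.
Local Notation mu := (@lebesgue_measure R).
Variables al la : R.
Hypotheses (al0 : 0 < al) (al1 : al < 1).
Local Notation K := (mlk al la).
Local Notation k := (kern al).

Lemma fin_num_summand (a b c : R) (x : \bar R) : 0 < b -> (0 <= x)%E ->
  (a%:E + b%:E * x = c%:E)%E -> x \is a fin_num.
Proof.
by move=> b0; case: x => [x| |]//= _; rewrite gt0_muley ?lte_fin.
Qed.

(** The Volterra equations at t and u turn the inequality between the two convolutions into Ku (q -
    l H) <= Kt <= 0, although l H < 1/2 <= q and Ku > 0. *)
Lemma first_zero_absurd (l q H Ku Kt ku kt : R) (c1 c2 : \bar R) :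
  0 < l -> (0 <= c1)%E -> (0 <= c2)%E ->
  (Kt%:E + l%:E * c1 = kt%:E)%E -> (Ku%:E + l%:E * c2 = ku%:E)%E ->
  (c1 <= q%:E * c2 + Ku%:E * H%:E)%E -> q * ku = kt ->
  0 < Ku -> Kt <= 0 -> 2^-1 <= q -> l * H < 2^-1 -> False.
Proof.
move=> l0 c1_ge0 c2_ge0 V1 V2.
have f1 := fin_num_summand l0 c1_ge0 V1; have f2 := fin_num_summand l0 c2_ge0 V2.
move: V1 V2; rewrite -(fineK f1) -(fineK f2); move: (fine c1) (fine c2) => x y [V1] [V2].
rewrite -!EFinM -EFinD lee_fin => key qE a0 b0 q2 hH.
have le1 : l * x <= l * (q * y + Ku * H) by rewrite ler_wpM2l// ltW.
have e1 : l * (q * y + Ku * H) = kt - q * Ku + Ku * (l * H).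
  by rewrite -qE -V2; ring.
have : Ku * (q - l * H) <= 0 by rewrite e1 in le1; lra.
by apply/negP; rewrite -ltNge mulr_gt0// subr_gt0 (lt_le_trans hH).
Qed.

Lemma conv_eq (f f' g : R -> \bar R) (t : R) :
  (forall s, 0 < s -> f (t - s) = f' (t - s)) ->
  (forall s, s <= 0 -> g s = 0%E) -> conv f g t = conv f' g t.
Proof.
move=> ff' g0; rewrite /conv; apply: eq_integral => s _.
have [s0|s0] := leP s 0; first by rewrite g0// !mule0.
by rewrite ff'.
Qed.

(* The Volterra equation K + la k * K = k, in a form that only uses the sign of
   K on ]0, t[. *)
Lemma mlk_volterra_pos (K1 : R -> \bar R) t : 0 < la -> nnker K1 ->
  (forall s, 0 < s < t -> K1 s = (K s)%:E) -> (forall s, s <= 0 -> K1 s = 0%E) ->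
  ((K t)%:E + la%:E * conv K1 k t = k t)%E.
Proof.
move=> la0 nK1 K1E K10.
(* Even and odd parts of the series: K is [kser al E] minus [kser al O], and shifting the index by
   one exchanges the two up to the factor la. *)
pose E j : R := if odd j then 0 else la ^+ j.
pose O j : R := if odd j then la ^+ j else 0.
have la_ge0 := ltW la0.
have E0 j : 0 <= E j by rewrite /E; case: ifP => // _; exact: exprn_ge0.
have O0 j : 0 <= O j by rewrite /O; case: ifP => // _; exact: exprn_ge0.
have EB j : E j <= la ^+ j by rewrite /E; case: ifP => // _; exact: exprn_ge0.
have OB j : O j <= la ^+ j by rewrite /O; case: ifP => // _; exact: exprn_ge0.
have EO j : (- la) ^+ j = E j - O j.
  rewrite exprNn /E /O -signr_odd; case: (odd j); first by rewrite expr1 sub0r mulN1r.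
  by rewrite expr0 mul1r subr0.
have kE := nnker_kser al0 E0; have kO := nnker_kser al0 O0.
have kk := nnker_kern al0.
have [KE fE fO] := mlk_kser al0 t E0 O0 EB OB EO.
have EQ : (kser al E t = k t + la%:E * conv (kser al O) k t)%E.
  rewrite (@kser_rec _ _ al0 E E0 O la)// => [|j].
    by rewrite /E/= expr0 mul1e.
  by rewrite /E /O /=; case: (odd j) => /=; rewrite ?mulr0// exprS.
have OQ : (kser al O t = la%:E * conv (kser al E) k t)%E.
  rewrite (@kser_rec _ _ al0 O O0 E la)// => [|j].
    by rewrite /O/= mul0e add0e.
  by rewrite /E /O /=; case: (odd j) => /=; rewrite ?mulr0// exprS.
(* As k is causal, only arguments t - s < t occur, and there [K1] may stand for K. *)
have cE : (conv (kser al E) k t = conv K1 k t + conv (kser al O) k t)%E.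
  rewrite -convDl//; apply: conv_eq; last by move=> s s0; exact: kern_le0.
  move=> s s0 /=; have [ts0|ts0] := leP (t - s) 0.
    by rewrite !kser_le0// K10// adde0.
  rewrite K1E; last by rewrite ts0 ltrBlDr ltrDl.
  by have [] := mlk_kser al0 (t - s) E0 O0 EB OB EO.
have c1 : (0 <= conv K1 k t)%E by exact: (nnker_conv nK1 kk).2.
have c2 : (0 <= conv (kser al O) k t)%E by exact: (nnker_conv kO kk).2.
have f2 : conv (kser al O) k t \is a fin_num.
  rewrite ge0_fin_numE// ltNge leye_eq; apply/eqP => c2E.
  by move: fE; rewrite EQ c2E gt0_muley ?lte_fin// addey// /kern.
have f1 : conv K1 k t \is a fin_num.
  rewrite ge0_fin_numE// ltNge leye_eq; apply/eqP => c1E.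
  by move: fO; rewrite OQ cE c1E addye -?ltNye ?(lt_le_trans _ c2)// gt0_muley ?lte_fin.
move: KE; rewrite OQ EQ cE -(fineK f1) -(fineK f2) /kern.
move: (fine _) (fine _) (K t) (pw al t / _) => x y z w [] KE; congr EFin; lra.
Qed.

(** Log-convexity of x^(al - 1): the ratio k(x + h) / k(x) is nondecreasing in x. After inverting
    the powers it reads (t + h) x <= (x + h) t. *)
Lemma kern_ratio h x t : 0 < h -> 0 < x -> x <= t ->
  pw al (x + h) * pw al t <= pw al (t + h) * pw al x.
Proof.
move=> h0 x0 xt; have t0 := lt_le_trans x0 xt.
rewrite !pwE ?addr_gt0// -!powRM ?addr_ge0 ?(ltW x0) ?(ltW t0) ?(ltW h0)//.
rewrite -[al - 1]opprB !powRN lef_pV2 ?posrE ?powR_gt0 ?mulr_gt0 ?addr_gt0//.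
apply: ge0_ler_powR; first by rewrite subr_ge0 ltW.
- by rewrite nnegrE mulr_ge0 ?addr_ge0 ?(ltW x0) ?(ltW t0) ?(ltW h0).
- by rewrite nnegrE mulr_ge0 ?addr_ge0 ?(ltW x0) ?(ltW t0) ?(ltW h0).
- by nra.
Qed.

Lemma integral_kern h : 0 < h ->
  (\int[mu]_s (k \_ `]0%R, h]) s = (h `^ al / (al * Gamma al))%:E)%E.
Proof.
move=> h0; rewrite -integral_mkcond -integral_itv_bndo_bndc; last first.
  by apply: measurable_funTS; exact: (nnker_kern al0).1.
rewrite /kern; under eq_integral do rewrite mulrC EFinM.
rewrite ge0_integralZl//; last 3 first.
- by apply/measurable_EFinP; apply: measurable_funTS; exact: measurable_pw.
- by move=> s _; rewrite lee_fin pw_ge0.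
- by rewrite lee_fin invr_ge0 (ltW (Gamma_gt0 al0)).
rewrite integral_pw// -EFinM; congr EFin.
by rewrite invfM; ring.
Qed.

(** x times [pw al x] is x^al, which increases; so the kernel loses at most the factor t / u <= 2
    between u and t. *)
Lemma pw_double u t : 0 < u -> u <= t -> t <= 2 * u -> pw al u <= 2 * pw al t.
Proof.
move=> u0 ut tu; have t0 := lt_le_trans u0 ut.
rewrite -(ler_pM2l u0) pwE// mulr_powRB1 ?(ltW u0)//.
apply: (@le_trans _ _ (t `^ al)).
  by apply: ge0_ler_powR; rewrite ?nnegrE ?(ltW al0) ?(ltW u0) ?(ltW t0).
rewrite -(mulr_powRB1 (ltW t0) al0) -(pwE _ t0) mulrA (mulrC u).
by rewrite ler_wpM2r ?pw_ge0.
Qed.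

(* At a first zero t of K, compare with the point u just below t where K is
   largest: log-convexity of the kernel k contradicts the Volterra equation. *)
Lemma mlk_gt0 t : 0 < la -> 0 < t -> 0 < K t.
Proof.
move=> la0 t0; have G0 := Gamma_gt0 al0; apply: contrapT => /negP.
rewrite -leNgt => Kt.
pose A := [set s | 0 < s /\ K s <= 0].
have [d d0 dP] := mlk_pos_near0 al0 la.
have Alb s : A s -> d <= s.
  by move=> [s0 Ks]; rewrite leNgt; apply/negP => sd; have := dP s; rewrite s0 sd ltNge Ks => /(_ isT).
have hA : has_inf A by split; [exists t|exists d].
pose t1 := inf A.
have dt1 : d <= t1 by apply: lb_le_inf; [exists t|].
have t10 := lt_le_trans d0 dt1.
have Kpos s : 0 < s < t1 -> 0 < K s.
  move=> /andP[s0 st1]; rewrite ltNge; apply/negP => Ks.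
  by move: st1; rewrite ltNge ge_inf//; exact: hA.2.
have Kt1 : K t1 <= 0.
  rewrite leNgt; apply/negP => Kt1.
  have : \forall s \near t1, 0 < K s.
    have cK : K @ t1 --> K t1 := mlk_continuous al0 t10.
    by apply: (cvgr_gt _ cK).
  move=> [e /= e0 eP].
  have [s As st] := inf_adherent e0 hA.
  have t1s : t1 <= s by apply: ge_inf => //; exact: hA.2.
  have : 0 < K s by apply: eP => /=; rewrite distrC ger0_norm ?subr_ge0// ltrBlDl.
  by rewrite ltNge As.2.
(* The mass of k on ]0, e] tends to 0 with e; the threshold 1/2 is the lower bound that the ratio q
   = k(t1) / k(u) will satisfy. *)
have [e e0 eP] : exists2 e : R, 0 < e & la * (e `^ al / (al * Gamma al)) < 2^-1.
  have : la * (e `^ al / (al * Gamma al)) @[e --> (0:R)^'+] --> la * (0 / (al * Gamma al)).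
    apply: cvgM; first exact: cvg_cst.
    by apply: cvgM; [exact: powR_cvg0|exact: cvg_cst].
  rewrite mul0r mulr0 => /cvgr_lt /(_ 2^-1); rewrite invr_gt0 ltr0n => /(_ isT).
  rewrite near_withinE => -[r /= r0 rP]; exists (r / 2); first by rewrite divr_gt0.
  apply: rP => /=; last by rewrite divr_gt0.
  by rewrite sub0r normrN gtr0_norm ?divr_gt0// ltr_pdivrMr// ltr_pMr// ltr1n.
(* The bound t1 / 2 gives t1 <= 2 u, hence q >= 1/2; the bound e makes the mass of k on ]0, t1 - u]
   small. *)
pose dl := Num.min e (t1 / 2).
have dl0 : 0 < dl by rewrite lt_min e0 divr_gt0.
have dle : dl <= e by rewrite ge_min lexx.
have dlt : dl <= t1 / 2 by rewrite ge_min lexx orbT.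
have t1dl : 0 < t1 - dl by lra.
have [u uI umax] : exists2 u, u \in `[t1 - dl, t1] & forall s, s \in `[t1 - dl, t1] -> K s <= K u.
  apply: EVT_max; first by rewrite gerBl ltW.
  apply: continuous_in_subspaceT => x; rewrite inE/= in_itv/= => /andP[x1 _].
  by apply: mlk_continuous => //; exact: lt_le_trans x1.
have Ku : 0 < K u.
  apply: (@lt_le_trans _ _ (K (t1 - dl))); first by apply: Kpos; rewrite t1dl gtrBl.
  by apply: umax; rewrite in_itv/= lexx gerBl ltW.
move: uI; rewrite in_itv/= => /andP[u1 u2].
have ut1 : u < t1.
  rewrite lt_neqAle u2 andbT; apply/eqP => ut1.
  by move: Ku; rewrite ut1 ltNge Kt1.
have u0 : 0 < u := lt_le_trans t1dl u1.
pose h := t1 - u; have h0 : 0 < h by rewrite subr_gt0.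
have he : h <= e by apply: le_trans dle; rewrite /h lerBlDr -lerBlDl.
(* K restricted to ]0, t1[, where it is already known to be positive: the convolution calculus for
   nonnegative kernels is not yet available for K itself. *)
pose K1 s : \bar R := ((K \_ `]0, t1[) s)%:E.
have nK1 : nnker K1.
  apply: nnker_EFin.
    by apply/(measurable_restrictT K) => //; apply: measurable_funTS; exact: measurable_mlk.
  move=> s; rewrite patchE; case: ifPn => [|_]; last exact: lexx.
  rewrite mem_setE in_itv/= => st; exact: ltW (Kpos s st).
have K1E s : 0 < s < t1 -> K1 s = (K s)%:E.
  by move=> st; rewrite /K1 patchE mem_setE in_itv/= st.
have K10 s : s <= 0 -> K1 s = 0%E.
  by move=> s0; rewrite /K1 patchE mem_setE in_itv/= ltNge s0.
have kk := nnker_kern al0.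
have V1 := mlk_volterra_pos la0 nK1 K1E K10.
have V2 : ((K u)%:E + la%:E * conv K1 k u = k u)%E.
  apply: mlk_volterra_pos => // s /andP[s0 su]; apply: K1E.
  by rewrite s0 (lt_trans su).
pose q := pw al t1 / pw al u.
have pu : 0 < pw al u by rewrite pwE// powR_gt0.
have pt : 0 < pw al t1 by rewrite pwE// powR_gt0.
have q0 : 0 <= q by rewrite divr_ge0 ?pw_ge0.
have nJ : nnker (k \_ `]0%R, h]).
  split; first by apply/(measurable_restrictT k) => //; apply: measurable_funTS; exact: kk.1.
  by move=> s; rewrite patchE; case: ifP => // _; exact: kk.2.
(* For s < u, log-convexity gives k(t1 - s) <= q k(u - s). For s in [u, t1[, K(s) <= K(u) by the
   choice of u, and the mass of k left over is that on ]0, h]. *)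
have key : (conv K1 k t1 <= q%:E * conv K1 k u + (K u)%:E * (h `^ al / (al * Gamma al))%:E)%E.
  rewrite (convC nK1 kk).
  have [mI I0] := nnker_conv_integrand u kk nK1.
  have [mJ J0] : nnker (fun s => (k \_ `]0%R, h]) (t1 - s)%R).
    by split; [exact: measurable_reflect nJ.1|move=> x; exact: nJ.2].
  rewrite -integral_kern// -(ge0_integral_reflect t1 nJ.1 nJ.2).
  rewrite -!ge0_integralZl//; [|by rewrite lee_fin ltW].
  rewrite -ge0_integralD//; last 4 first.
  - by move=> s _; rewrite mule_ge0.
  - exact: measurable_funeM.
  - by move=> s _; rewrite mule_ge0// lee_fin ltW.
  - exact: measurable_funeM.
  apply: ge0_le_integral => //.
  - by move=> s _; apply: mule_ge0; [exact: kk.2|exact: nK1.2].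
  - exact: (nnker_conv_integrand t1 kk nK1).1.
  - by apply: emeasurable_funD; exact: measurable_funeM.
  move=> s _.
  have P1 : (0 <= q%:E * (k (u - s)%R * K1 s))%E.
    by apply: mule_ge0; [rewrite lee_fin|exact: I0].
  have P2 : (0 <= (K u)%:E * (k \_ `]0%R, h]) (t1 - s)%R)%E.
    by apply: mule_ge0; [rewrite lee_fin ltW|exact: J0].
  have P12 := adde_ge0 P1 P2.
  have [s0|s0] := leP s 0; first by rewrite [in X in (X <= _)%E](K10 s s0) mule0.
  have [st|st] := leP t1 s.
    rewrite [in X in (X <= _)%E](_ : K1 s = 0%E) ?mule0//.
    by rewrite /K1 patchE mem_setE in_itv/= s0 ltNge st.
  have [su|su] := ltP s u.
    apply: (le_trans _ (leeDl _ P2)).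
    rewrite muleA; apply: lee_wpmul2r; first exact: nK1.2.
    rewrite /kern -EFinM lee_fin mulrA ler_wpM2r ?invr_ge0 ?(ltW G0)//.
    rewrite /q mulrAC ler_pdivlMr//.
    have us0 : 0 < u - s by rewrite subr_gt0.
    have := @kern_ratio h (u - s) u h0 us0; rewrite gerBl (ltW s0) => /(_ isT).
    have -> : u - s + h = t1 - s by rewrite /h addrC addrA subrK.
    by have -> : u + h = t1 by rewrite /h addrC subrK.
  apply: (le_trans _ (leeDr _ P1)); rewrite K1E ?s0// muleC.
  rewrite (_ : (k \_ `]0%R, h]) (t1 - s)%R = k (t1 - s)%R); last first.
    by rewrite patchE mem_setE in_itv/= subr_gt0 st /h lerD2l lerN2 su.
  apply: lee_wpmul2r; first exact: kk.2.
  rewrite lee_fin; apply: umax; rewrite in_itv/= (le_trans u1 su)/=; exact: ltW.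
have q2 : 2^-1 <= q.
  rewrite /q ler_pdivlMr// mulrC ler_pdivrMr// mulrC; apply: pw_double => //.
  by move: u1 dlt; clear; lra.
have hH : la * (h `^ al / (al * Gamma al)) < 2^-1.
  apply: le_lt_trans eP; rewrite ler_wpM2l ?(ltW la0)// ler_wpM2r ?invr_ge0 ?mulr_ge0 ?(ltW al0) ?(ltW G0)//.
  by apply: ge0_ler_powR; rewrite ?nnegrE ?(ltW al0) ?(ltW h0) ?(ltW e0).
have c2_ge0 : (0 <= conv K1 k u)%E by exact: (nnker_conv nK1 kk).2.
have c1_ge0 : (0 <= conv K1 k t1)%E by exact: (nnker_conv nK1 kk).2.
have qE : q * (pw al u / Gamma al) = pw al t1 / Gamma al.
  by rewrite /q mulrA divfK// gt_eqF.
exact: first_zero_absurd la0 c1_ge0 c2_ge0 V1 V2 key qE Ku Kt1 q2 hH.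
Qed.

Lemma mlk_series_neg t : la <= 0 -> (K t)%:E = kser al (fun j => (- la) ^+ j) t.
Proof.
move=> la0; have la0' : 0 <= - la by rewrite oppr_ge0.
have [| | | |j|<- _ _] := @mlk_kser _ _ al0 la (fun j => (- la) ^+ j) (fun=> 0) (- la) t => //.
- by move=> j; exact: exprn_ge0.
- by move=> j; exact: exprn_ge0.
- by rewrite subr0.
by rewrite [X in (_ + X)%E](_ : _ = 0%E) ?adde0//; apply: eseries0 => j _ _; rewrite mul0e.
Qed.

Lemma mlk_ge0 t : 0 <= K t.
Proof.
have [t0|t0] := leP t 0; first by rewrite mlk_le0.
have [la0|la0] := ltP 0 la; first by rewrite ltW// mlk_gt0.
rewrite -lee_fin mlk_series_neg//; apply: (nnker_kser al0 _).2 => j.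
by rewrite exprn_ge0// oppr_ge0.
Qed.

Lemma nnker_mlk : nnker (EFin \o K).
Proof. by apply: nnker_EFin; [exact: measurable_mlk|exact: mlk_ge0]. Qed.

(** The two parts of la stand on opposite sides, so that the equation is free of subtraction in the
    extended reals and can be convolved with any nonnegative kernel. *)
Lemma mlk_volterra t :
  ((K t)%:E + (Num.max la 0)%:E * conv (EFin \o K) k t =
   k t + (Num.max (- la) 0)%:E * conv (EFin \o K) k t)%E.
Proof.
have [la0|la0] := ltP 0 la.
  rewrite max_r ?oppr_le0 ?ltW// mul0e adde0.
  apply: mlk_volterra_pos => //; first exact: nnker_mlk.
  by move=> s s0 /=; rewrite mlk_le0.
rewrite mul0e adde0 max_l ?oppr_ge0// mlk_series_neg//.
have pow0 j : 0 <= (- la) ^+ j by rewrite exprn_ge0// oppr_ge0.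
rewrite (@kser_rec _ _ al0 _ pow0 (fun j => (- la) ^+ j) (- la)) ?oppr_ge0//; last first.
  by move=> j; rewrite exprS.
rewrite expr0 mul1e; congr (_ + _ * conv _ _ _)%E.
by apply/funext => s; rewrite /= mlk_series_neg.
Qed.

End resolvent_positivity.

(** * The regularised fractional derivative *)

Section regularised_derivative.
Context {R : realType}.
Local Notation mu := (@lebesgue_measure R).
Variable al : R.
Hypotheses (al0 : 0 < al) (al1 : al < 1).
Local Notation k := (kern al).
Local Notation one := (kern (1 : R)).
Local Notation G1 := (Gamma (1 - al)).

Let al1' : 0 < 1 - al. Proof. by rewrite subr_gt0. Qed.

Lemma one_gt0 x : 0 < x -> one x = 1%E.
Proof. by move=> x0; rewrite /kern pwE// subrr powRr0 Gamma1 divr1. Qed.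

Lemma nnker_one : nnker one.
Proof. exact: nnker_kern. Qed.

(* kappa_e, and the Phi_e for which kappa_e * k + Phi_e = e^-al k. *)
Definition kapr (e x : R) : R := if e <= x then al * x `^ (- al - 1) else 0.
Definition kap e : R -> \bar R := EFin \o kapr e.

Definition Phir (e x : R) : R := if 0 < x then
  e `^ (- al) / Gamma al * (x^-1 * (x `^ al - Num.max (x - e) 0 `^ al)) else 0.
Definition Phi e : R -> \bar R := EFin \o Phir e.

Lemma nnker_kap e : nnker (kap e).
Proof.
apply: nnker_EFin => [|x].
  apply: measurable_fun_ifT => //; first exact: measurable_fun_ler.
  by apply: measurable_funM => //; exact: measurable_powR.
by rewrite /kapr; case: ifP => // _; rewrite mulr_ge0 ?powR_ge0 ?(ltW al0).
Qed.

(** The lower bound is monotonicity of the power. The upper one, for x > e, is (1 - z)^al >= 1 - z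
    at z = e / x, which lies in ]0, 1[. *)
Lemma Phir_pow e x : 0 < e -> 0 < x ->
  0 <= x `^ al - Num.max (x - e) 0 `^ al <= e * x `^ (al - 1).
Proof.
move=> e0 x0; have x1 : x `^ (al - 1) = x `^ al / x.
  rewrite powRB ?powRr1 ?(ltW x0)//; apply/implyP => _.
  by rewrite gt_eqF.
have m0 : 0 <= Num.max (x - e) 0 by rewrite le_max lexx orbT.
apply/andP; split.
  rewrite subr_ge0; apply: ge0_ler_powR; rewrite ?nnegrE ?(ltW al0) ?(ltW x0)//.
  by rewrite ge_max (ltW x0) gerBl (ltW e0).
rewrite x1; have [xe|xe] := leP x e.
  rewrite max_r ?subr_le0// powR0 ?gt_eqF// subr0.
  rewrite mulrCA ler_peMr ?powR_ge0// ler_pdivlMr// mul1r//.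
rewrite max_l ?subr_ge0 ?(ltW xe)//.
have -> : x - e = x * (1 - e / x) by field; rewrite gt_eqF.
have ex1 : e / x < 1 by rewrite ltr_pdivrMr// mul1r.
have ex0 : 0 < e / x by rewrite divr_gt0.
rewrite powRM ?(ltW x0)//; last by rewrite subr_ge0 ltW.
have h : 1 - e / x <= (1 - e / x) `^ al.
  by apply: ger1_powR; [rewrite subr_gt0 ex1 gerBl ltW|exact: ltW].
rewrite -[X in X - _]mulr1 -mulrBr mulrCA ler_wpM2l ?powR_ge0//.
by move: h; move: (_ `^ _) => z; lra.
Qed.

Lemma nnker_Phi e : 0 < e -> nnker (Phi e).
Proof.
move=> e0; apply: nnker_EFin => [|x].
  have -> : Phir e = fun x => if 0 < x then
    e `^ (- al) / Gamma al * (x `^ (-1) * (x `^ al - Num.max (x - e) 0 `^ al)) else 0.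
    apply/funext => z; rewrite /Phir; case: ifPn => // z0.
    by rewrite powR_inv1// ltW.
  apply: measurable_fun_ifT => //; first exact: measurable_fun_ltr.
  apply: measurable_funM => //.
  apply: measurable_funM; first exact: measurable_powR.
  apply: measurable_funB; first exact: measurable_powR.
  apply: (measurableT_comp (measurable_powR al)).
  by apply: measurable_maxr => //; exact: measurable_funB.
rewrite /Phir; case: ifPn => // x0.
rewrite !mulr_ge0 ?powR_ge0 ?invr_ge0 ?(ltW (Gamma_gt0 al0)) ?(ltW x0)//.
by have /andP[] := Phir_pow e0 x0.
Qed.

(** Quantifies how [Phi e] concentrates at 0: a factor x coming from a Lipschitz bound is traded for
    the small factor e^(1 - al) and an integrable kernel. *)
Lemma Phi_le e x : 0 < e -> (x%:E * Phi e x <= (e `^ (1 - al))%:E * k x)%E.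
Proof.
move=> e0; rewrite /Phi /kern /= -!EFinM lee_fin.
rewrite /Phir /pw; case: ifPn => x0; last by rewrite mul0r !mulr0.
have /andP[_ le] := Phir_pow e0 x0.
have -> : e `^ (1 - al) = e * e `^ (- al).
  by rewrite powRD ?powRr1 ?(ltW e0)//; apply/implyP => _; rewrite gt_eqF.
rewrite (_ : x * _ = e `^ (- al) / Gamma al * (x `^ al - Num.max (x - e) 0 `^ al)).
  rewrite (_ : e * _ * _ = e `^ (- al) / Gamma al * (e * x `^ (al - 1))); last by ring.
  by rewrite ler_wpM2l// divr_ge0 ?powR_ge0 ?(ltW (Gamma_gt0 al0)).
by rewrite mulrCA mulVKf// gt_eqF.
Qed.

Lemma powR_mul_inv (a x : R) : 0 < x -> x `^ (a - 1) = x `^ a / x.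
Proof.
move=> x0; rewrite powRB ?powRr1 ?(ltW x0)//; apply/implyP => _.
by rewrite gt_eqF.
Qed.

Lemma is_derive_subl (x s : R) : is_derive s 1 (fun z : R => x - z) (-1).
Proof. by have := is_deriveB (is_derive_cst x s 1) (is_derive_id s 1); rewrite sub0r. Qed.

Lemma kap_integral e x : 0 < e -> e < x ->
  (\int[mu]_(s in `]0%R, (x - e)%R[) (al * (x - s) `^ (- al - 1) * s `^ (al - 1))%:E =
   (x^-1 * (x - e) `^ al * e `^ (- al))%:E)%E.
Proof.
move=> e0 ex; have x0 := lt_trans e0 ex; have xe0 : 0 < x - e by rewrite subr_gt0.
(* A primitive of the integrand: the two terms of the product rule combine because (x - s) + s = x.
   It vanishes at 0. *)
pose F s := x^-1 * (s `^ al * (x - s) `^ (- al)).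
have dF s : 0 < s < x ->
    is_derive s 1 F (al * (x - s) `^ (- al - 1) * s `^ (al - 1)).
  move=> /andP[s0 sx]; have xs0 : 0 < x - s by rewrite subr_gt0.
  have d1 : is_derive s 1 (fun s : R => s `^ al) (al * s `^ (al - 1)).
    exact: is_derive1_powR.
  have d2 : is_derive s 1 (fun s : R => (x - s) `^ (- al)) (al * (x - s) `^ (- al - 1)).
    have dd := is_derive_subl x s.
    have dp := is_derive1_powR (- al) xs0.
    have := @is_derive1_comp _ (fun s : R => s `^ (- al)) (fun s : R => x - s) s _ _ dp dd.
    by move=> h; apply: is_derive_eq; rewrite mulrN1 mulNr opprK.
  have d3 := @is_deriveM _ _ _ _ _ _ _ _ d1 d2.
  have d4 := @is_deriveZ _ _ _ _ x^-1 _ _ _ d3.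
  rewrite (_ : F = x^-1 \*: ((fun s : R => s `^ al) * (fun s : R => (x - s) `^ (- al)))).
    apply: (is_derive_eq d4).
    rewrite /GRing.scale/= !powR_mul_inv//; field.
    by rewrite !gt_eqF.
  by apply/funext => z.
have -> : x^-1 * (x - e) `^ al * e `^ (- al) = F (x - e) - F 0.
  by rewrite /F powR0 ?gt_eqF// mul0r mulr0 subr0 subKr mulrA.
apply: (ge0_integral_oo (f := fun s : R => al * (x - s) `^ (- al - 1) * s `^ (al - 1))
  (F := F)) => //.
- by move=> s _; rewrite !mulr_ge0 ?powR_ge0// ltW.
- move=> s; rewrite in_itv/= => /andP[s0 sx]; have xs0 : 0 < x - s by lra.
  have c1 : {for s, continuous (fun z : R => (x - z) `^ (- al - 1))}.
    apply: (@continuous_comp _ _ _ (fun s : R => x - s) (fun s : R => s `^ (- al - 1))).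
      exact: (is_derive_continuous (is_derive_subl x s)).
    exact: powR_continuous_gt0.
  have c2 : {for s, continuous (fun z : R => z `^ (al - 1))} by exact: powR_continuous_gt0.
  have c3 : {for s, continuous (fun z : R => al * (x - z) `^ (- al - 1))}.
    by apply: continuousM => //; exact: cst_continuous.
  have c4 : {for s, continuous (fun z : R => al * (x - z) `^ (- al - 1) * z `^ (al - 1))}.
    by apply: continuousM.
  exact: c4.
- by move=> s /andP[s0 sx]; apply: dF; rewrite s0; lra.
- apply: cvgM; first exact: cvg_cst.
  apply: cvgM; first exact: powR_cvg_right.
  apply: cvg_at_right_filter.
  have : is_derive (0 : R) (1 : R) (fun s : R => (x - s) `^ (- al)) (al * (x - 0) `^ (- al - 1)).
    have xs0 : 0 < x - 0 by rewrite subr0.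
    have dd := is_derive_subl x 0.
    have := @is_derive1_comp _ (fun s : R => s `^ (- al)) (fun s : R => x - s) 0 _ _ (is_derive1_powR (- al) xs0) dd.
    by move=> h; apply: is_derive_eq; rewrite mulrN1 mulNr opprK.
  exact: is_derive_continuous.
- apply: cvg_at_left_filter.
  by apply: (is_derive_continuous (dF (x - e) _)); rewrite xe0 gtrBl.
Qed.

Lemma kap_supp e x : 0 < e -> x <= 0 -> kap e x = 0%E.
Proof.
by move=> e0 x0; rewrite /kap/= /kapr leNgt (le_lt_trans x0 e0).
Qed.

(** The formula of [Phir] is read off from this identity. For x <= e the convolution vanishes, since
    [kap e] starts at e; for x > e it is the explicit integral above. *)
Lemma conv_kap_kern e x : 0 < e ->
  (conv (kap e) k x + Phi e x = (e `^ (- al))%:E * k x)%E.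
Proof.
move=> e0; have [x0|x0] := leP x 0.
  rewrite kern_le0// mule0 /Phi/= /Phir ltNge x0/= adde0 conv_supp//.
  - by move=> s; exact: kap_supp.
  - by move=> s; exact: kern_le0.
have kp := pwE al x0; rewrite powR_mul_inv// in kp.
have [xe|xe] := leP x e.
  rewrite /conv integral0_eq ?add0e => [|s _]; last first.
    have [s0|s0] := leP s 0; first by rewrite (kern_le0 _ s0) mule0.
    rewrite /kap /= /kapr leNgt (_ : x - s < e) ?mul0e//.
    by rewrite (lt_le_trans _ xe)// gtrBl.
  rewrite /Phi /kern /= -EFinM /Phir x0 max_r ?subr_le0// powR0 ?gt_eqF// subr0 kp.
  by congr EFin; ring.
have -> : (conv (kap e) k x =
    (Gamma al)^-1%:E * (x^-1 * (x - e) `^ al * e `^ (- al))%:E)%E.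
  rewrite -kap_integral// -ge0_integralZl//; last 3 first.
  - apply/measurable_EFinP/measurable_funTS; apply: measurable_funM; last exact: measurable_powR.
    apply: measurable_funM => //; apply: (measurableT_comp (measurable_powR _)).
    exact: measurable_funB.
  - by move=> s _; rewrite lee_fin !mulr_ge0 ?powR_ge0// ltW.
  - by rewrite lee_fin invr_ge0 (ltW (Gamma_gt0 al0)).
  rewrite integral_itv_bndo_bndc; last first.
    apply: measurable_funeM; apply/measurable_EFinP/measurable_funTS.
    apply: measurable_funM; last exact: measurable_powR.
    apply: measurable_funM => //; apply: (measurableT_comp (measurable_powR _)).
    exact: measurable_funB.
  rewrite [RHS]integral_mkcond; apply: eq_integral => s _.
  rewrite patchE mem_setE in_itv/=.
  have [s0|s0] := leP s 0; first by rewrite (kern_le0 _ s0) mule0.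
  rewrite /kap /kern /= /kapr pwE// lerBrDr -lerBrDl.
  by case: ifPn => _; rewrite ?mul0e// -!EFinM; congr EFin; ring.
rewrite /Phi /kern /= -!EFinM -EFinD /Phir x0 max_l ?subr_ge0 ?(ltW xe)// kp.
by congr EFin; ring.
Qed.

(** Convolution with [one] is integration from 0, and - x^(- al) is a primitive of the kernel; the
    maximum also covers x <= e, where the integral is 0. *)
Lemma conv_one_kap e x : 0 < e -> 0 < x ->
  (conv one (kap e) x + (Num.max e x `^ (- al))%:E = (e `^ (- al))%:E)%E.
Proof.
move=> e0 x0; have [xe|xe] := leP x e.
  rewrite /conv integral0_eq ?add0e// => s _.
  have [sx|sx] := leP x s; first by rewrite kern_le0 ?mul0e// subr_le0.
  by rewrite /kap /= /kapr leNgt (lt_le_trans sx xe) mule0.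
suff -> : conv one (kap e) x = (- x `^ (- al) - - e `^ (- al))%:E.
  by rewrite -EFinD; congr EFin; ring.
transitivity (\int[mu]_(s in `]e, x[) (al * s `^ (- al - 1))%:E)%E.
  rewrite integral_itv_obnd_cbnd; last first.
    by apply/measurable_EFinP/measurable_funTS; apply: measurable_funM.
  rewrite [RHS]integral_mkcond; apply: eq_integral => s _.
  rewrite patchE mem_setE in_itv/=.
  have [sx|sx] := leP x s; first by rewrite kern_le0 ?subr_le0// mul0e andbF.
  rewrite one_gt0 ?subr_gt0// mul1e andbT /kap/= /kapr.
  by case: ifP.
apply: (ge0_integral_oo (f := fun s : R => al * s `^ (- al - 1)) (F := fun s => - s `^ (- al))) => //.
- by move=> s _; rewrite mulr_ge0 ?powR_ge0// ltW.
- move=> s; rewrite in_itv/= => /andP[es _].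
  have c1 : {for s, continuous (fun z : R => z `^ (- al - 1))}.
    exact: powR_continuous_gt0 (lt_trans e0 es).
  have c2 : {for s, continuous (fun z : R => al * z `^ (- al - 1))}.
    by apply: continuousM => //; exact: cst_continuous.
  exact: c2.
- move=> s /andP[es _]; have s0 := lt_trans e0 es.
  have d := is_derive1_powR (- al) s0; apply: is_derive_eq.
  by rewrite mulNr opprK.
- apply: cvgN; apply: cvg_at_right_filter; exact: powR_continuous_gt0.
- apply: cvgN; apply: cvg_at_left_filter; exact: powR_continuous_gt0.
Qed.

(** The part near 0 of the kernel of index 1 - al. It measures by how much [Phi d] falls short of
    mass [G1], and also the influence of the times before a. *)
Definition Jker d : R -> \bar R := kern (1 - al) \_ `]0%R, d].

Lemma nnker_Jker d : nnker (Jker d).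
Proof.
have [mk k0] := nnker_kern al1'; split.
  by apply/(measurable_restrictT (kern (1 - al))) => //; exact: measurable_funTS.
by move=> s; rewrite /Jker patchE; case: ifP => // _; exact: lexx.
Qed.

(** Integrating the identity that defines [Phi] and cancelling [one] * [kap e] * k leaves [one] *
    [Phi e] = m * k with m(s) = max(e, s)^(- al). This m agrees with [G1] times the kernel of index
    1 - al beyond e and is smaller before, while that kernel convolved with k is [one]. *)
Lemma conv_one_Phi e x : 0 < e ->
  (conv one (Phi e) x <= G1%:E * one x <= conv one (Phi e) x + G1%:E * conv (Jker e) k x)%E.
Proof.
move=> e0; have kk := nnker_kern al0; have kP := nnker_Phi e0; have kkap := nnker_kap e.
have k1 := nnker_one; have kJ := nnker_Jker e; have kc := nnker_kern al1'.
have G10 : 0 <= G1 by rewrite ltW// Gamma_gt0.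
have ea0 : 0 <= e `^ (- al) by exact: powR_ge0.
have [x0|x0] := leP x 0.
  have -> : conv one (Phi e) x = 0%E.
    apply: conv_supp => // s s0; first exact: kern_le0.
    by rewrite /Phi/= /Phir ltNge s0.
  rewrite kern_le0// mule0 lexx add0e.
  by apply: mule_ge0; [rewrite lee_fin|exact: (nnker_conv kJ kk).2].
pose m s : \bar R := (if 0 < s then Num.max e s `^ (- al) else 0)%:E.
have km : nnker m.
  apply: nnker_EFin => [|s]; last by case: ifP => // _; exact: powR_ge0.
  apply: measurable_fun_ifT => //; first exact: measurable_fun_ltr.
  by apply: (measurableT_comp (measurable_powR _)); exact: measurable_maxr.
have k1kap := nnker_conv k1 kkap.
have E1 : (conv one (kap e) \+ m)%E = (fun s => (e `^ (- al))%:E * one s)%E.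
  apply/funext => s; rewrite /m /=; have [s0|s0] := ltP 0 s.
    by rewrite conv_one_kap// one_gt0// mule1.
  rewrite kern_le0// mule0 adde0; apply: conv_supp => // r r0; first exact: kern_le0.
  exact: kap_supp.
have E2 : (conv (conv one (kap e)) k x + conv m k x = (e `^ (- al))%:E * conv one k x)%E.
  by rewrite -convDl// E1 convZl.
have E3 : (conv (kap e) k \+ Phi e)%E = (fun s => (e `^ (- al))%:E * k s)%E.
  by apply/funext => s; exact: conv_kap_kern.
have E4 : (conv (conv one (kap e)) k x + conv one (Phi e) x = (e `^ (- al))%:E * conv one k x)%E.
  rewrite -convA// -convDr//; last exact: nnker_conv.
  by rewrite E3 convZr.
have PE : conv one (Phi e) x = conv m k x.
  have fin : conv (conv one (kap e)) k x \is a fin_num.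
    have c0 : (0 <= conv (conv one (kap e)) k x)%E by exact: (nnker_conv k1kap kk).2.
    rewrite ge0_fin_numE// (@le_lt_trans _ _ ((e `^ (- al))%:E * conv one k x)%E)//.
      by rewrite -E2; apply: leeDl; exact: (nnker_conv km kk).2.
    by rewrite conv_kern// /kern -EFinM ltry.
  have := E4; rewrite -E2 => /eqP; rewrite [X in _ == X]addeC [X in X == _]addeC.
  by move/eqP/(congr1 (fun z => z - conv (conv one (kap e)) k x)%E); rewrite !addeK.
have mle s : (m s <= G1%:E * kern (1 - al) s)%E.
  rewrite /m /kern /pw -EFinM lee_fin; case: ifPn => s0; last by rewrite mul0r mulr0.
  rewrite mulrCA divff ?mulr1 ?gt_eqF ?Gamma_gt0//.
  rewrite addrAC subrr sub0r !powRN lef_pV2 ?posrE ?powR_gt0 ?lt_max ?e0//.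
  by apply: ge0_ler_powR; rewrite ?nnegrE ?le_max ?(ltW al0) ?(ltW e0) ?(ltW s0) ?lexx ?orbT.
have mge s : (G1%:E * kern (1 - al) s <= m s + G1%:E * Jker e s)%E.
  rewrite /Jker patchE mem_setE in_itv/=; case: ifPn => [_|].
    by apply: leeDr; exact: km.2.
  rewrite mule0 adde0 /m; have [s0|s0] := ltP 0 s; last by rewrite kern_le0// mule0.
  rewrite -ltNge => es; rewrite max_r ?(ltW es)// /kern pwE// -EFinM lee_fin.
  by rewrite mulrCA divff ?mulr1 ?gt_eqF ?Gamma_gt0// addrAC subrr sub0r.
have kGc : nnker (fun s => G1%:E * kern (1 - al) s)%E by exact: nnker_scale.
have kGJ : nnker (fun s => G1%:E * Jker e s)%E by exact: nnker_scale.
have one_conv : (G1%:E * one x = conv (fun s => G1%:E * kern (1 - al) s)%E k x)%E.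
  by rewrite (convZl x G10 kc kk) (conv_kern al1' al0) subrK.
rewrite PE one_conv; apply/andP; split.
  apply: (le_conv km kk kGc kk) => s.
  by apply: lee_wpmul2r; [exact: kk.2|exact: mle].
rewrite -(convZl x G10 kJ kk) -(convDl x km kGJ kk).
apply: (le_conv kGc kk (nnker_add km kGJ) kk) => s.
by apply: lee_wpmul2r; [exact: kk.2|exact: mge].
Qed.

(** The exponent b - 1 may have either sign; the sum of the two end values bounds the power in both
    monotonicity cases. *)
Lemma pw_between (b x y : R) : 0 < x -> x <= y -> y <= 2 * x -> pw b y <= pw b x + pw b (2 * x).
Proof.
move=> x0 xy y2; have y0 := lt_le_trans x0 xy; have x20 := lt_le_trans y0 y2.
rewrite !pwE//; have [b1|b1] := leP 1 b.
  apply: ler_wpDl; first exact: powR_ge0.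
  by apply: ge0_ler_powR; rewrite ?nnegrE ?subr_ge0 ?(ltW y0) ?(ltW x20).
apply: ler_wpDr; first exact: powR_ge0.
rewrite -[b - 1]opprB !powRN lef_pV2 ?posrE ?powR_gt0//.
apply: ge0_ler_powR => //; [by rewrite subr_ge0 ltW|by rewrite nnegrE ltW|by rewrite nnegrE ltW].
Qed.

(** For d <= x / 2 the other kernel is only evaluated on [x / 2, x], away from its singularity,
    where it is bounded by S; the rate d^(1 - al) is the mass of [Jker d]. *)
Lemma conv_Jker_small b x : 0 < b -> 0 < x -> exists2 C : R, 0 <= C &
  forall d, 0 < d -> d <= x / 2 -> (conv (Jker d) (kern b) x <= (C * d `^ (1 - al))%:E)%E.
Proof.
move=> b0 x0; have x2 : 0 < x / 2 by rewrite divr_gt0.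
pose S := (pw b (x / 2) + pw b (2 * (x / 2))) / Gamma b.
have S0 : 0 <= S by rewrite divr_ge0 ?addr_ge0 ?pw_ge0 ?(ltW (Gamma_gt0 b0)).
have D0 : 0 <= (1 - al) * G1 by rewrite mulr_ge0 ?(ltW al1') ?(ltW (Gamma_gt0 al1')).
exists (S / ((1 - al) * G1)); first by rewrite divr_ge0.
move=> d d0 dx; have kJ := nnker_Jker d; have kb := nnker_kern b0.
rewrite (_ : _ * d `^ _ = S * (d `^ (1 - al) / ((1 - al) * G1))); last by ring.
rewrite EFinM -integral_kern// -/(Jker d) (convC kJ kb) -ge0_integralZl ?lee_fin//; last 2 first.
- exact: kJ.1.
- by move=> s _; exact: kJ.2.
apply: ge0_le_integral => //.
- by move=> s _; exact: (nnker_conv_integrand x kb kJ).2.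
- exact: (nnker_conv_integrand x kb kJ).1.
- by apply: measurable_funeM; exact: kJ.1.
move=> s _; have [sd|sd] := boolP ((0 < s) && (s <= d)); last first.
  by rewrite /Jker patchE mem_setE in_itv/= (negbTE sd) !mule0.
apply: lee_wpmul2r; first exact: kJ.2.
rewrite /kern lee_fin ler_wpM2r ?invr_ge0 ?(ltW (Gamma_gt0 b0))//.
case/andP: sd => s0 sd; apply: pw_between => //.
  by rewrite lerBrDr -lerBrDl (le_trans sd)// (le_trans dx)//; lra.
by rewrite mulrC divfK// gerBl ltW.
Qed.

End regularised_derivative.

(** * The scalar comparison principle *)

Section lower_integral.
Context {R : realType}.
Local Notation mu := (@lebesgue_measure R).
Local Open Scope ereal_scope.
Implicit Types (f g A B : R -> \bar R).

(* The integral of a nonnegative function is a supremum over simple functions,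
   so it is monotone even on functions that are not measurable. *)
Lemma le_lower_integral f g : (forall x, 0 <= f x) -> (forall x, f x <= g x) ->
  \int[mu]_x f x <= \int[mu]_x g x.
Proof.
move=> f0 fg; rewrite !ge0_integralTE//; last by move=> x; exact: le_trans (fg x).
by apply: ereal_sup_le => _ [h hf <-]; exists h => // x; exact: le_trans (fg x).
Qed.

(** Additivity may fail for a nonmeasurable f, so a measurable minorant is inserted: rho = max(0, A
    - B) satisfies rho <= f and A <= rho + B. *)
Lemma lower_integral_add f A B : (forall x, 0 <= f x) -> nnker A -> nnker B ->
  (forall x, A x <= f x + B x) ->
  \int[mu]_x A x <= \int[mu]_x f x + \int[mu]_x B x.
Proof.
move=> f0 [mA A0] [mB B0] AfB.
pose rho x := maxe 0 (A x - B x).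
have rho0 x : 0 <= rho x by rewrite /rho le_max lexx.
have mrho : measurable_fun setT rho.
  by apply: measurable_maxe => //; exact: emeasurable_funB.
have rhof x : rho x <= f x.
  rewrite /rho ge_max f0/=; move: (AfB x) (B0 x); case: (B x) => [b| |]//.
    by move=> AB _; rewrite leeBlDr.
  by move=> _ _; rewrite addeNy leNye.
have Arho x : A x <= rho x + B x.
  move: (B0 x) (A0 x); rewrite /rho; case: (B x) => [b| |]//.
    by move=> _ _; rewrite -leeBlDr// le_max lexx orbT.
  by move=> _ _; rewrite addeNy maxC maxNye add0e leey.
apply: (@le_trans _ _ (\int[mu]_x (rho x + B x))).
  by apply: ge0_le_integral => //; exact: emeasurable_funD.
rewrite ge0_integralD//; apply: leeD2r; exact: le_lower_integral.
Qed.

End lower_integral.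

(** * Kernels dominated by a power kernel *)

Section tame_kernels.
Context {R : realType}.
Local Notation mu := (@lebesgue_measure R).
Implicit Types (f g : R -> \bar R).

(** One bound that yields causality, finiteness and, by the semigroup law, stability under
    convolution. *)
Definition tame f := nnker f /\
  exists2 C : R, 0 <= C & exists2 b : R, 0 < b & forall s, (f s <= C%:E * kern b s)%E.

Lemma tame_le0 f s : tame f -> s <= 0 -> f s = 0%E.
Proof.
move=> [[_ f0] [C C0 [b b0 fb]]] s0; apply/eqP; rewrite eq_le f0 andbT.
by have := fb s; rewrite kern_le0// mule0.
Qed.

Lemma tame_fin f s : tame f -> f s \is a fin_num.
Proof.
move=> [[_ f0] [C C0 [b b0 fb]]]; rewrite ge0_fin_numE//.
by apply: (le_lt_trans (fb s)); rewrite /kern -EFinM ltry.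
Qed.

Lemma tame_kern b : 0 < b -> tame (kern b).
Proof.
move=> b0; split; first exact: nnker_kern.
by exists 1 => //; exists b => // s; rewrite mul1e.
Qed.

Lemma tame_conv f g : tame f -> tame g -> tame (conv f g).
Proof.
move=> tf tg; have nf := tf.1; have ng := tg.1; split; first exact: nnker_conv.
case: tf => _ [C C0 [b b0 fb]]; case: tg => _ [D D0 [c c0 gc]].
exists (C * D); first exact: mulr_ge0.
exists (b + c); first exact: addr_gt0.
move=> s; rewrite -(conv_kern b0 c0) EFinM.
have kb := nnker_kern b0; have kc := nnker_kern c0.
rewrite -muleA -(convZr s D0 kb kc) -(convZl s C0 kb (nnker_scale D0 kc)).
apply: (le_conv nf ng (nnker_scale C0 kb) (nnker_scale D0 kc)) => r.
by apply: lee_pmul; [exact: nf.2|exact: ng.2|exact: fb|exact: gc].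
Qed.

Lemma conv_shift f g (a t : R) : nnker f -> nnker g ->
  conv f (fun s => g (s - a)) t = conv f g (t - a).
Proof.
move=> nf ng; have [mI I0] := nnker_conv_integrand (t - a) nf ng.
rewrite /conv -(ge0_integral_shift (- a) mI I0); apply: eq_integral => s _.
by rewrite (_ : t - a - (s - a) = t - s)// opprD opprK addrACA addNr addr0.
Qed.

Lemma nnker_shift f (a : R) : nnker f -> nnker (fun s => f (s - a)).
Proof.
move=> [mf f0]; split=> [|s]; last exact: f0.
by apply: (measurableT_comp mf); exact: measurable_funB.
Qed.

End tame_kernels.

Section tame_regularised.
Context {R : realType}.
Variables al e : R.
Hypotheses (al0 : 0 < al) (al1 : al < 1) (e0 : 0 < e).

Lemma tame_kap : tame (kap al e).
Proof.
split; first exact: nnker_kap.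
exists (al * e `^ (- al - 1)); first by rewrite mulr_ge0 ?powR_ge0// ltW.
exists 1 => // s; have [es|es] := leP e s; last first.
  rewrite {1}/kap /= /kapr (leNgt e s) es /=; apply: mule_ge0; last exact: nnker_one.2.
  by rewrite lee_fin mulr_ge0 ?powR_ge0// ltW.
have s0 := lt_le_trans e0 es.
rewrite one_gt0// mule1 /kap /= /kapr es lee_fin ler_wpM2l ?(ltW al0)//.
rewrite -opprD !powRN lef_pV2 ?posrE ?powR_gt0//.
by apply: ge0_ler_powR; rewrite ?nnegrE ?addr_ge0 ?(ltW al0) ?(ltW e0) ?(ltW s0).
Qed.

Lemma tame_Phi : tame (Phi al e).
Proof.
split; first exact: nnker_Phi.
exists (e `^ (- al)); first exact: powR_ge0.
exists al => // s; rewrite -(conv_kap_kern al0 s e0).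
by apply: leeDr; exact: (nnker_conv (nnker_kap al0 e) (nnker_kern al0)).2.
Qed.

End tame_regularised.

(** * From the cut-off energy inequality to the scalar bound *)

Section comparison.
Context {R : realType}.
Local Notation mu := (@lebesgue_measure R).
Variables al la T : R.
Hypotheses (al0 : 0 < al) (al1 : al < 1) (T0 : 0 < T).
Local Notation K := (EFin \o mlk al la).
Local Notation k := (kern al).
Local Notation one := (kern (1 : R)).
Local Notation G1 := (Gamma (1 - al)).
Local Notation lp := (Num.max la 0).
Local Notation lm := (Num.max (- la) 0).

Let al1' : 0 < 1 - al. Proof. by rewrite subr_gt0. Qed.
Let G10 : 0 < G1. Proof. exact: Gamma_gt0. Qed.
Let nK : nnker K. Proof. exact: nnker_mlk. Qed.
Let nk : nnker k. Proof. exact: nnker_kern. Qed.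
Let lp0 : 0 <= lp. Proof. by rewrite le_max lexx orbT. Qed.
Let lm0 : 0 <= lm. Proof. by rewrite le_max lexx orbT. Qed.

(** On bounded time intervals K is at most a multiple of k, so every error term convolved with K
    reduces to explicit power kernels. *)
Lemma conv_mlk_le : exists2 C : R, 0 <= C & forall g t, nnker g ->
  (forall s, s <= 0 -> g s = 0%E) -> t <= T -> (conv K g t <= C%:E * conv k g t)%E.
Proof.
have [C C0 CP] := mlk_bound al0 la T0.
have G0 := Gamma_gt0 al0.
have CG : 0 <= C * Gamma al := mulr_ge0 C0 (ltW G0).
exists (C * Gamma al) => // g t ng g0 tT.
rewrite -(convZl t CG nk ng); apply: (le_conv nK ng (nnker_scale CG nk) ng) => s.
have [s0|s0] := leP s 0; first by rewrite g0// !mule0.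
apply: lee_wpmul2r; first exact: ng.2.
rewrite /kern /= -EFinM lee_fin.
have -> : C * Gamma al * (pw al (t - s) / Gamma al) = C * pw al (t - s).
  by rewrite mulrCA -mulrA mulfV ?mulr1 1?mulrC// gt_eqF.
have ts : t - s <= T by rewrite (le_trans _ tT)// gerBl ltW.
exact: le_trans (ler_norm _) (CP _ ts).
Qed.

Lemma conv_mlk_fin g t : tame g -> t <= T -> conv K g t \is a fin_num.
Proof.
move=> tg tT; have [C C0 CP] := conv_mlk_le.
rewrite ge0_fin_numE; last exact: (nnker_conv nK tg.1).2.
apply: (le_lt_trans (CP g t tg.1 (fun s => tame_le0 tg) tT)).
have := tame_fin t (tame_conv (tame_kern al0) tg).
by move=> /fineK <-; rewrite -EFinM ltry.
Qed.

(** Here a, b, c stand for convolution with K, K * k and k, the index 1 for Y and 2 for [kap e] * Y;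
    phi is [Phi e] * Y and psi is K * [Phi e] * Y, all at time t. The Volterra and cut-off
    identities give ea a1 - a2 = phi - (p - m) psi. As phi is close to G v and psi to G a1, the
    terms with p - m in the convolved energy inequality cancel up to d2 and d3, and G v <= G X
    remains up to the errors. *)
Lemma comparison_arith (G ea p m a1 a2 b1 b2 c1 c2 phi psi E P d1 d2 d3 v X : R) :
  0 < G -> 0 <= p -> 0 <= m ->
  a1 + p * b1 = c1 + m * b1 -> a2 + p * b2 = c2 + m * b2 ->
  c2 + phi = ea * c1 -> b2 + psi = ea * b1 ->
  (ea / G + p) * a1 <= X + (E + m * a1 + G^-1 * a2 + P) ->
  G * v <= phi + d1 -> psi <= G * a1 + d2 -> G * a1 <= psi + d3 ->
  v <= X + (E + P + (d1 + p * d2 + m * d3) / G).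
Proof.
move=> G0 p0 m0 V1 V2 C1 C2 A L1 U2 L3.
rewrite -(ler_pM2l G0).
have A' : ea * a1 + G * p * a1 <= G * X + G * E + G * m * a1 + a2 + G * P.
  have := ler_wpM2l (ltW G0) A.
  rewrite (_ : G * ((ea / G + p) * a1) = ea * a1 + G * p * a1); last by field; rewrite gt_eqF.
  rewrite (_ : G * (X + (E + m * a1 + G^-1 * a2 + P)) =
    G * X + G * E + G * m * a1 + a2 + G * P)//; field.
  by rewrite gt_eqF.
rewrite (_ : G * (X + (E + P + (d1 + p * d2 + m * d3) / G)) =
  G * X + G * E + G * P + d1 + p * d2 + m * d3); last by field; rewrite gt_eqF.
have := ler_wpM2l p0 U2; have := ler_wpM2l m0 L3.
have e1 : ea * a1 - a2 = phi - (p - m) * psi.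
  have -> : a1 = c1 + m * b1 - p * b1 by lra.
  have -> : a2 = c2 + m * b2 - p * b2 by lra.
  have -> : phi = ea * c1 - c2 by lra.
  have -> : psi = ea * b1 - b2 by lra.
  by ring.
rewrite !mulrDr !(mulrCA _ G) => h1 h2.
have e2 : (p - m) * psi = p * psi - m * psi by ring.
move: A'; rewrite -!mulrA; move: (ea * a1) (p * a1) (m * a1) (p * psi) (m * psi) h1 h2 e1 e2.
move=> z1 z2 z3 z4 z5 h1 h2 e1 e2 A'.
lra.
Qed.

Lemma comparison_earith (G ea p m d1 d2 d3 v Ce M : R)
    (a1 a2 b1 b2 c1 c2 phi psi X o P : \bar R) :
  0 < G -> 0 <= p -> 0 <= m ->
  a1 \is a fin_num -> a2 \is a fin_num -> b1 \is a fin_num -> b2 \is a fin_num ->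
  c1 \is a fin_num -> c2 \is a fin_num -> phi \is a fin_num -> psi \is a fin_num ->
  X \is a fin_num -> o \is a fin_num -> P \is a fin_num ->
  (a1 + p%:E * b1 = c1 + m%:E * b1 -> a2 + p%:E * b2 = c2 + m%:E * b2 ->
  c2 + phi = ea%:E * c1 -> b2 + psi = ea%:E * b1 ->
  (ea / G + p)%:E * a1 <= X + (Ce%:E * o + m%:E * a1 + (G^-1)%:E * a2 + M%:E * P) ->
  (G * v)%:E <= phi + d1%:E -> psi <= G%:E * a1 + d2%:E -> G%:E * a1 <= psi + d3%:E ->
  v%:E <= X + (Ce * fine o + M * fine P + (d1 + p * d2 + m * d3) / G)%:E)%E.
Proof.
move=> G0 p0 m0.
case: a1 => // a1 _; case: a2 => // a2 _; case: b1 => // b1 _; case: b2 => // b2 _.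
case: c1 => // c1 _; case: c2 => // c2 _; case: phi => // phi _; case: psi => // psi _.
case: X => // X _; case: o => // o _; case: P => // P _.
move=> [V1] [V2] [C1] [C2] A L1 U2 L3.
rewrite -EFinD lee_fin; apply: (comparison_arith G0 p0 m0 V1 V2 C1 C2).
- by rewrite -lee_fin; exact: A.
- by rewrite -lee_fin; exact: L1.
- by rewrite -lee_fin; exact: U2.
- by rewrite -lee_fin; exact: L3.
Qed.

Lemma mlk_volterra_conv (g : R -> \bar R) t : tame g ->
  (conv K g t + lp%:E * conv K (conv k g) t = conv k g t + lm%:E * conv K (conv k g) t)%E.
Proof.
move=> tg; have ng := tg.1; have nKk := nnker_conv nK nk.
have nA := nnker_scale lp0 nKk; have nB := nnker_scale lm0 nKk.
rewrite (convA nK nk ng) -(convZl t lp0 nKk ng) -(convZl t lm0 nKk ng).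
rewrite -(convDl t nK nA ng) -(convDl t nk nB ng); congr (conv _ g t).
by apply/funext => s; exact: (mlk_volterra la al0 al1 s).
Qed.

(** * Estimates up to a fixed time t, with y Lipschitz from a on *)

Section at_time.
Variables (y : R -> R) (M L a t : R).
Hypotheses (y0 : forall s, 0 <= y s) (M0 : 0 <= M) (L0 : 0 <= L).
Hypotheses (a0 : 0 < a) (at_ : a < t) (tT : t <= T).
Hypothesis yM : forall s, 0 < s <= T -> y s <= M.
Hypothesis yL : forall s1 s2, a <= s1 <= T -> a <= s2 <= T ->
  `|y s1 - y s2| <= L * `|s1 - s2|.

(** The cut at a keeps only the times where y is Lipschitz; t is included because [Phi e] * Y is to
    be compared with the value at t itself. *)
Definition Yker : R -> \bar R := EFin \o (y \_ `]a, t]).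
Local Notation Y := Yker.

Lemma Yker_in s : a < s <= t -> Y s = (y s)%:E.
Proof. by move=> st; rewrite /Yker /= patchE mem_setE in_itv/= st. Qed.

Lemma Yker_out s : ~~ (a < s <= t) -> Y s = 0%E.
Proof. by move=> st; rewrite /Yker /= patchE mem_setE in_itv/= (negbTE st). Qed.

Let yc : {within `[a, t], continuous y}.
Proof.
apply/subspace_continuousP => x; rewrite /= in_itv/= => /andP[ax xt].
have L1 : 0 < L + 1 by rewrite ltr_wpDl.
apply/cvgrPdist_lt => e e0; near=> z.
have /andP[az zt] : a <= z <= t.
  by near: z; apply: withinT; exact: (nbhs_filter x).
apply: (@le_lt_trans _ _ (L * `|x - z|)).
  by apply: yL; rewrite ?ax ?az (le_trans _ tT).
apply: (@le_lt_trans _ _ ((L + 1) * `|x - z|)); first by rewrite ler_wpM2r// lerDl.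
rewrite -ltr_pdivlMl//; near: z; apply: cvg_within.
by apply: nbhsx_ballx; rewrite mulr_gt0// invr_gt0.
Unshelve. all: by end_near. Qed.

Lemma tame_Yker : tame Y.
Proof.
split.
  apply: nnker_EFin => [|s]; last by rewrite patchE; case: ifP.
  apply/(measurable_restrictT y) => //.
  apply: (@measurable_funS _ _ _ _ `[a, t]) => //.
    by move=> z /=; rewrite !in_itv/= => /andP[/ltW -> ->].
  exact: subspace_continuous_measurable_fun.
exists M => //; exists 1 => // s; have [/andP[sa st]|st] := boolP (a < s <= t).
  have s0 := lt_trans a0 sa.
  rewrite Yker_in ?sa// one_gt0// mule1 lee_fin; apply: yM.
  by rewrite s0 (le_trans st).
by rewrite Yker_out//; apply: mule_ge0; [rewrite lee_fin|exact: nnker_one.2].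
Qed.

Section at_scale.
Variable e : R.
Hypothesis e0 : 0 < e.
Local Notation kapY := (conv (kap al e) Y).
Local Notation PhiY := (conv (Phi al e) Y).

Lemma Phir_le x : x * Phir al e x <= e `^ (1 - al) * (pw al x / Gamma al).
Proof. by rewrite -lee_fin !EFinM; exact: (Phi_le al0 al1 x e0). Qed.

Lemma Phir_ge0 x : 0 <= Phir al e x.
Proof. by rewrite -lee_fin; exact: ((nnker_Phi al0 al1 e0).2 x). Qed.

Let Le := L * e `^ (1 - al).
Let Le0 : 0 <= Le. Proof. by rewrite mulr_ge0// powR_ge0. Qed.
Let nP : nnker (Phi al e). Proof. exact: nnker_Phi. Qed.
Let nY : nnker Y. Proof. exact: tame_Yker.1. Qed.

Let Y_near tau s : a < tau <= t -> a < s < tau ->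
  `|y s - y tau| <= L * (tau - s).
Proof.
move=> /andP[atau taut] /andP[as_ stau].
rewrite -[X in L * X]ger0_norm ?subr_ge0 ?(ltW stau)// distrC [X in L * X]distrC.
rewrite distrC [X in L * X]distrC; apply: (le_trans (yL _ _)).
- by rewrite (ltW as_) (le_trans _ tT)// (le_trans (ltW stau)).
- by rewrite (ltW atau) (le_trans taut).
- by rewrite distrC.
Qed.

(** Replacing Y(s) by y(tau) costs at most L (tau - s) [Phi e] (tau - s), which [Phi_le] bounds by L
    e^(1 - al) k(tau - s); the total mass of [Phi e] is at most [G1]. *)
Lemma PhiY_le tau : tau <= t ->
  (PhiY tau <= G1%:E * Y tau + Le%:E * conv k one tau)%E.
Proof.
move=> taut; have n1 := @nnker_one R; have [ta|ta] := leP tau a.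
  rewrite {1}/conv integral0_eq => [|s _].
    apply: adde_ge0; apply: mule_ge0; rewrite ?lee_fin ?(ltW G10) ?Le0//.
      exact: nY.2.
    exact: (nnker_conv nk n1).2.
  have [/andP[as_ _]|st] := boolP (a < s <= t); last by rewrite Yker_out// mule0.
  by rewrite (_ : Phi al e _ = 0%E) ?mul0e// /Phi /= /Phir subr_gt0 ltNge (le_trans ta (ltW as_)).
have tau0 := lt_trans a0 ta; have inT : a < tau <= t by rewrite ta.
have nyP : nnker (fun s => (y tau)%:E * Phi al e s)%E by exact: nnker_scale.
have nLk : nnker (fun s => Le%:E * k s)%E by exact: nnker_scale.
apply: (@le_trans _ _ ((y tau)%:E * conv (Phi al e) one tau + Le%:E * conv k one tau)%E).
  rewrite -(convZl tau (y0 tau) nP n1) -(convZl tau Le0 nk n1) -(convDl tau nyP nLk n1).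
  apply: (le_conv nP nY (nnker_add nyP nLk) n1) => s.
  have rhs0 : (0 <= ((y tau)%:E * Phi al e (tau - s) + Le%:E * k (tau - s)) * one s)%E.
    by apply: mule_ge0; [exact: (nnker_add nyP nLk).2|exact: n1.2].
  have [/andP[as_ st]|st] := boolP (a < s <= t); last by rewrite Yker_out// mule0.
  have [taus|stau] := leP tau s.
    rewrite [in X in (X <= _)%E](_ : Phi al e (tau - s)%R = 0%E) ?mul0e//.
    by rewrite /Phi /= /Phir subr_gt0 ltNge taus.
  rewrite one_gt0 ?(lt_trans a0 as_)// mule1 Yker_in ?as_// /Phi /kern /= -!EFinM -EFinD lee_fin.
  have := Y_near inT (_ : a < s < tau); rewrite as_ stau => /(_ isT).
  have := Phir_le (tau - s); have := Phir_ge0 (tau - s).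
  rewrite /Le; move: (Phir al e _) (pw al _ / _) (e `^ _) => p q e' p0 pq.
  rewrite ler_norml => /andP[_ h].
  apply: (@le_trans _ _ (p * (y tau + L * (tau - s)))); first by rewrite ler_wpM2l//; lra.
  rewrite mulrDr (mulrC p (y tau)) lerD2l mulrCA -[L * e' * q]mulrA ler_wpM2l//.
  by rewrite mulrC.
apply: leeD2r; rewrite Yker_in// muleC; apply: lee_wpmul2r; first by rewrite lee_fin.
rewrite (convC nP n1); have /andP[h _] := conv_one_Phi al0 al1 tau e0.
by apply: (le_trans h); rewrite one_gt0// mule1.
Qed.

(** The same replacement from below. As Y starts at a, only the mass of [Phi e] on ]0, tau - a[
    counts; its deficit from [G1] is the [Jker] term, multiplied by y(tau) <= M. *)
Lemma PhiY_ge tau : tau <= t -> (G1%:E * Y tau <=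
  PhiY tau + Le%:E * conv k one tau + (M * G1)%:E * conv (Jker al e) k (tau - a))%E.
Proof.
move=> taut; have n1 := @nnker_one R; have nJ := nnker_Jker al1 e.
have MG0 : 0 <= M * G1 by rewrite mulr_ge0// ltW.
have Jk0 s := (nnker_conv nJ nk).2 s; have k10 s := (nnker_conv nk n1).2 s.
have PY0 s := (nnker_conv nP nY).2 s.
have [ta|ta] := leP tau a.
  rewrite Yker_out ?mule0; last by rewrite ltNge ta.
  apply: adde_ge0; first (apply: adde_ge0; first exact: PY0).
    by apply: mule_ge0; [rewrite lee_fin|exact: k10].
  by apply: mule_ge0; [rewrite lee_fin|exact: Jk0].
have tau0 := lt_trans a0 ta; have inT : a < tau <= t by rewrite ta.
have ytM : y tau <= M by apply: yM; rewrite tau0 (le_trans taut).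
have ns1 := nnker_shift a n1.
have nyP : nnker (fun s => (y tau)%:E * Phi al e s)%E by exact: nnker_scale.
have nLk : nnker (fun s => Le%:E * k s)%E by exact: nnker_scale.
have [mI I0] := nnker_conv_integrand tau nP nY.
have [mJ J0] := nnker_conv_integrand tau nLk n1.
have step : ((y tau)%:E * conv (Phi al e) one (tau - a) <=
    PhiY tau + Le%:E * conv k one tau)%E.
  rewrite -(conv_shift a tau nP n1) -(convZl tau (y0 tau) nP ns1) -(convZl tau Le0 nk n1).
  rewrite /conv -ge0_integralD//.
  apply: le_lower_integral => s; first exact: (nnker_conv_integrand tau nyP ns1).2.
  have rhs0 := adde_ge0 (I0 s) (J0 s).
  have [as_|sa] := ltP a s; last first.
    by rewrite (@kern_le0 _ 1 (s - a)) ?subr_le0// mule0.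
  have [taus|stau] := leP tau s.
    rewrite [in X in (X <= _)%E](_ : Phi al e (tau - s)%R = 0%E) ?mule0 ?mul0e//.
    by rewrite /Phi /= /Phir subr_gt0 ltNge taus.
  have st : a < s <= t by rewrite as_ (le_trans (ltW stau)).
  have sa0 : 0 < s - a by rewrite subr_gt0.
  rewrite (one_gt0 sa0) (one_gt0 (lt_trans a0 as_)) !mule1 (Yker_in st).
  rewrite /Phi /kern /= -!EFinM -EFinD lee_fin.
  have := Y_near inT (_ : a < s < tau); rewrite as_ stau => /(_ isT).
  have := Phir_le (tau - s); have := Phir_ge0 (tau - s).
  rewrite /Le; move: (Phir al e _) (pw al _ / _) (e `^ _) => p q e' p0 pq.
  rewrite ler_norml => /andP[h _].
  apply: (@le_trans _ _ (p * (y s + L * (tau - s)))).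
    by rewrite mulrC ler_wpM2l//; lra.
  rewrite mulrDr lerD2l mulrCA -[L * e' * q]mulrA ler_wpM2l//.
  by rewrite mulrC.
have /andP[_ h] := conv_one_Phi al0 al1 (tau - a) e0.
have taua0 : 0 < tau - a by rewrite subr_gt0.
rewrite (one_gt0 taua0) mule1 (convC n1 nP) in h.
rewrite (Yker_in inT) muleC.
apply: (@le_trans _ _ ((y tau)%:E * (conv (Phi al e) one (tau - a) + G1%:E * conv (Jker al e) k (tau - a)))%E).
  by apply: lee_wpmul2l; [rewrite lee_fin|exact: h].
rewrite ge0_muleDr; first last.
- by apply: mule_ge0; [rewrite lee_fin ltW|exact: Jk0].
- exact: (nnker_conv nP n1).2.
apply: leeD; first exact: step.
rewrite muleA -EFinM; apply: lee_wpmul2r; first exact: Jk0.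
by rewrite lee_fin ler_wpM2r// ltW.
Qed.

End at_scale.
Lemma hist_integral s : a < s ->
  (\int[mu]_(x in `]0%R, a]) (al * (s - x) `^ (- al - 1))%:E =
   ((s - a) `^ (- al) - s `^ (- al))%:E)%E.
Proof.
move=> as_; rewrite -integral_itv_bndo_bndc; last first.
  apply/measurable_EFinP/measurable_funTS; apply: measurable_funM => //.
  by apply: (measurableT_comp (measurable_powR _)); exact: measurable_funB.
have d x : x < s -> is_derive x 1 (fun z : R => (s - z) `^ (- al)) (al * (s - x) `^ (- al - 1)).
  move=> xs; have xs0 : 0 < s - x by rewrite subr_gt0.
  have := @is_derive1_comp _ (fun s : R => s `^ (- al)) (fun z : R => s - z) x _ _
    (is_derive1_powR (- al) xs0) (is_derive_subl s x).
  by move=> h; apply: is_derive_eq; rewrite mulrN1 mulNr opprK.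
transitivity ((s - a) `^ (- al) - (s - 0) `^ (- al))%:E; last by rewrite subr0.
apply: (ge0_integral_oo (f := fun x : R => al * (s - x) `^ (- al - 1))
  (F := fun z : R => (s - z) `^ (- al)) a0).
- by move=> x _; rewrite mulr_ge0 ?powR_ge0// ltW.
- move=> x; rewrite in_itv/= => /andP[_ xa].
  have c1 : {for x, continuous (fun z : R => (s - z) `^ (- al - 1))}.
    apply: (@continuous_comp _ _ _ (fun z : R => s - z) (fun s : R => s `^ (- al - 1))).
      exact: (is_derive_continuous (is_derive_subl s x)).
    by apply: powR_continuous_gt0; rewrite subr_gt0 (lt_trans xa).
  have c2 : {for x, continuous (fun z : R => al * (s - z) `^ (- al - 1))}.
    by apply: continuousM => //; exact: cst_continuous.
  exact: c2.
- by move=> x /andP[_ xa]; apply: d; exact: lt_trans as_.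
- by apply: cvg_at_right_filter; exact: (is_derive_continuous (d 0 (lt_trans a0 as_))).
- by apply: cvg_at_left_filter; exact: (is_derive_continuous (d a as_)).
Qed.

(* Dominates the influence at time s of the values of y before time a. *)
Definition Par (s : R) : R := if a < s then (pw (1 - al) (s - a) - pw (1 - al) s) / G1 else 0.
Definition Pa : R -> \bar R := EFin \o Par.

Lemma Par_in s : a < s -> G1 * Par s = (s - a) `^ (- al) - s `^ (- al).
Proof.
move=> as_; rewrite /Par as_ mulrC divfK ?gt_eqF//.
rewrite !pwE ?subr_gt0//; last exact: lt_trans as_.
by rewrite (_ : 1 - al - 1 = - al)//; ring.
Qed.

Lemma Par_ge0 s : 0 <= Par s.
Proof.
have [as_|sa] := ltP a s; last by rewrite /Par ltNge sa.
have s0 := lt_trans a0 as_.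
rewrite -(pmulr_rge0 _ G10) Par_in// subr_ge0 !powRN lef_pV2 ?posrE ?powR_gt0 ?subr_gt0//.
apply: ge0_ler_powR; first exact: ltW.
- by rewrite nnegrE subr_ge0 ltW.
- by rewrite nnegrE ltW.
- by rewrite gerBl ltW.
Qed.

Lemma nnker_Pa : nnker Pa.
Proof.
apply: nnker_EFin; last exact: Par_ge0.
apply: measurable_fun_ifT => //; first exact: measurable_fun_ltr.
apply: measurable_funM => //; apply: measurable_funB; last exact: measurable_pw.
by apply: (measurableT_comp (measurable_pw _)); exact: measurable_funB.
Qed.

(** Adding the kernel of index 1 - al to [Pa] gives its translate by a plus [Jker a]. Convolved with
    k, the kernel and its translate both become 1 at t > a and cancel. *)
Lemma conv_Pa : conv k Pa t = conv k (Jker al a) t.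
Proof.
have kc := nnker_kern al1'; have nJ := nnker_Jker al1 a; have t0 := lt_trans a0 at_.
have ns := nnker_shift a kc; have nP := nnker_Pa.
have E : (Pa \+ kern (1 - al) = (fun s => kern (1 - al) (s - a)) \+ Jker al a)%E.
  apply/funext => s; rewrite /Pa /Par /= /Jker patchE mem_setE in_itv/=.
  have [as_|sa] := ltP a s.
    by rewrite andbF adde0 /kern -EFinD -mulrDl subrK.
  rewrite andbT (@kern_le0 _ (1 - al) (s - a)) ?subr_le0// !add0e.
  by case: ifPn => //; rewrite -leNgt => s0; rewrite kern_le0.
have := convDr t nk nP kc; rewrite E (convDr t nk ns nJ) (conv_shift a t nk kc).
rewrite !conv_kern// (_ : al + (1 - al) = 1); last by ring.
rewrite !one_gt0 ?subr_gt0//; rewrite addeC => /(congr1 (fun z => z - 1)%E).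
by rewrite !addeK.
Qed.

Section scale_e.
Variable e : R.
Hypothesis e0 : 0 < e.
Local Notation kapY := (conv (kap al e) Y).

(** Before a, y is replaced by M and the kernel integral is explicit. Between a and c one has s - x
    >= e, so that the cut-off kernel is the true one. *)
Lemma history_le s c : a < s <= t -> c = Num.max a (s - e) ->
  (\int[mu]_(x in `]0%R, c[) (al * (s - x) `^ (- al - 1) * y x)%:E <=
   (M * G1)%:E * Pa s + kapY s)%E.
Proof.
move=> /andP[as_ st] cE; have s0 := lt_trans a0 as_.
have cs : c < s by rewrite cE gt_max as_ gtrBl.
have nkap := nnker_kap al0 e; have nY := tame_Yker.1.
pose g := (fun x : R => (al * (s - x) `^ (- al - 1))%:E) \_ `]0%R, a].
have mg : measurable_fun setT g.
  apply/(measurable_restrictT (fun x : R => (al * (s - x) `^ (- al - 1))%:E)) => //.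
  apply/measurable_EFinP/measurable_funTS; apply: measurable_funM => //.
  by apply: (measurableT_comp (measurable_powR _)); exact: measurable_funB.
have g0 x : (0 <= g x)%E.
  by rewrite /g patchE; case: ifP => // _; rewrite lee_fin mulr_ge0 ?powR_ge0// ltW.
have [mI I0] := nnker_conv_integrand s nkap nY.
have -> : ((M * G1)%:E * Pa s = \int[mu]_x (M%:E * g x))%E.
  rewrite ge0_integralZl//.
  rewrite -integral_mkcond hist_integral// /Pa /= -!EFinM; congr EFin.
  by rewrite -Par_in// mulrA.
rewrite /conv -ge0_integralD//; last 2 first.
- by move=> x _; apply: mule_ge0; [rewrite lee_fin|exact: g0].
- exact: measurable_funeM.
rewrite [X in (X <= _)%E]integral_mkcond.
apply: (@le_lower_integral R ((fun x : R => (al * (s - x) `^ (- al - 1) * y x)%:E) \_ `]0%R, c[)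
  (fun x : R => M%:E * g x + kap al e (s - x)%R * Y x)%E) => x.
  by rewrite patchE; case: ifP => // _; rewrite lee_fin !mulr_ge0 ?powR_ge0// ltW.
have Mg0 : (0 <= M%:E * g x)%E by apply: mule_ge0; [rewrite lee_fin|exact: g0].
rewrite patchE mem_setE in_itv/=; case: ifPn => [/andP[x0 xc]|_]; last by apply: adde_ge0.
have xs := lt_trans xc cs.
have p0 : 0 <= al * (s - x) `^ (- al - 1) by rewrite mulr_ge0 ?powR_ge0// ltW.
have [xa|ax] := leP x a.
  apply: (le_trans _ (leeDl _ (I0 x))).
  rewrite /g patchE mem_setE in_itv/= x0 xa/= -EFinM lee_fin mulrC ler_wpM2r//.
  by apply: yM; rewrite x0 (le_trans xa)// (le_trans (ltW at_)).
apply: (le_trans _ (leeDr _ Mg0)); rewrite Yker_in; last by rewrite ax (le_trans (ltW xs)).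
have es : e <= s - x.
  move: xc; rewrite cE lt_max ltNge (ltW ax)/= => xse.
  by rewrite lerBrDr -lerBrDl ltW.
by rewrite /kap /= /kapr es -EFinM.
Qed.

End scale_e.

Section conclusion.
Variable r : R -> R.
Hypothesis r0 : forall s, 0 <= r s.
Hypothesis energy : forall c s, a <= c -> c < s -> s <= T ->
  ((((s - c) `^ (- al) / G1 + lp) * y s)%:E <=
   (r s + L * (al / (1 - al)) * (s - c) `^ (1 - al) / G1 + lm * y s)%:E +
   (G1^-1)%:E * \int[mu]_(x in `]0%R, c[) (al * (s - x) `^ (- al - 1) * y x)%:E)%E.

Let X : \bar R := (\int[mu]_(s in `]0%R, t[) (mlk al la (t - s) * r s)%:E)%E.

Section with_scale.
Variable e : R.
Hypothesis e0 : 0 < e.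
Local Notation kapY := (conv (kap al e) Y).
Local Notation PhiY := (conv (Phi al e) Y).
Let Ce := L * (al / (1 - al)) * e `^ (1 - al) / G1.
Let Ce0 : 0 <= Ce.
Proof. by rewrite !mulr_ge0 ?invr_ge0 ?powR_ge0 ?(ltW al0) ?(ltW al1') ?(ltW G10). Qed.

Lemma energy_pointwise s : a < s <= t ->
  (((e `^ (- al) / G1 + lp) * y s)%:E <= (r s)%:E +
    (Ce%:E * one s + lm%:E * Y s + (G1^-1)%:E * kapY s + M%:E * Pa s))%E.
Proof.
move=> /[dup] st /andP[as_ st2]; have s0 := lt_trans a0 as_.
(* Since s - c <= e, the coefficient (s - c)^(- al) is at least e^(- al), and the error (s - c)^(1 -
   al) at most e^(1 - al); the maximum keeps c in the Lipschitz range. *)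
pose c := Num.max a (s - e).
have ac : a <= c by rewrite le_max lexx.
have cs : c < s by rewrite gt_max as_ gtrBl.
have sc : s - c <= e by rewrite lerBlDr -lerBlDl le_max lexx orbT.
have sc0 : 0 < s - c by rewrite subr_gt0.
have En := energy ac cs (le_trans st2 tT).
have Hi := history_le e0 st (erefl c).
have fY : kapY s \is a fin_num.
  by apply: tame_fin; apply: tame_conv; [exact: tame_kap|exact: tame_Yker].
have G1V : 0 <= G1^-1 by rewrite invr_ge0 ltW.
have {}En : ((((s - c) `^ (- al) / G1 + lp) * y s)%:E <=
    (r s + L * (al / (1 - al)) * (s - c) `^ (1 - al) / G1 + lm * y s)%:E +
    (G1^-1)%:E * ((M * G1)%:E * Pa s + kapY s))%E.
  apply: (le_trans En); apply: leeD2l; apply: lee_wpmul2l; last exact: Hi.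
  by rewrite lee_fin.
rewrite (one_gt0 s0) mule1 (Yker_in st); move: En.
rewrite /Pa /= -(fineK fY); move: (fine _) (Par s) => q p.
move=> En; have {}En : ((s - c) `^ (- al) / G1 + lp) * y s <=
    (r s + L * (al / (1 - al)) * (s - c) `^ (1 - al) / G1 + lm * y s) + G1^-1 * (M * G1 * p + q).
  by rewrite -lee_fin; exact: En.
change (((e `^ (- al) / G1 + lp) * y s)%:E <=
  (r s + (Ce + lm * y s + G1^-1 * q + M * p))%:E)%E; rewrite lee_fin.
have p1 : e `^ (- al) <= (s - c) `^ (- al).
  rewrite !powRN lef_pV2 ?posrE ?powR_gt0//.
  by apply: ge0_ler_powR; rewrite ?nnegrE ?(ltW al0) ?(ltW e0) ?(ltW sc0).
have p2 : (s - c) `^ (1 - al) <= e `^ (1 - al).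
  by apply: ge0_ler_powR; rewrite ?nnegrE ?(ltW al1') ?(ltW e0) ?(ltW sc0).
have h1 : (e `^ (- al) / G1 + lp) * y s <= ((s - c) `^ (- al) / G1 + lp) * y s.
  by rewrite ler_wpM2r// lerD2r ler_wpM2r.
have h2 : L * (al / (1 - al)) * (s - c) `^ (1 - al) / G1 <= Ce.
  rewrite /Ce ler_wpM2r// ler_wpM2l// mulr_ge0// mulr_ge0 ?invr_ge0 ?(ltW al0)//.
  exact: ltW.
have h3 : G1^-1 * (M * G1 * p + q) = M * p + G1^-1 * q.
  by field; rewrite gt_eqF.
rewrite h3 in En.
apply: (le_trans h1); apply: (le_trans En).
by move: h2; set z1 := _ / G1; set z2 := lm * _; set z3 := G1^-1 * _; lra.
Qed.

(** No measurability of [r] is at hand, so the sum is split by [lower_integral_add], with [r] only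
    in the nonmeasurable summand. Nonnegativity of K is what allows multiplying the pointwise
    inequality by it. *)
Lemma energy_conv :
  ((e `^ (- al) / G1 + lp)%:E * conv K Y t <= X +
   (Ce%:E * conv K one t + lm%:E * conv K Y t + (G1^-1)%:E * conv K kapY t + M%:E * conv K Pa t))%E.
Proof.
have nY := tame_Yker.1; have n1 := @nnker_one R; have nPa := nnker_Pa.
have nkY := nnker_conv (nnker_kap al0 e) nY.
have ea0 : 0 <= e `^ (- al) / G1 + lp.
  by rewrite addr_ge0// divr_ge0 ?powR_ge0// ltW.
have G1V : 0 <= G1^-1 by rewrite invr_ge0 ltW.
rewrite -(convZr t ea0 nK nY) -(convZr t Ce0 nK n1) -(convZr t lm0 nK nY).
rewrite -(convZr t G1V nK nkY) -(convZr t M0 nK nPa).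
have nB1 := nnker_scale Ce0 n1; have nB2 := nnker_scale lm0 nY.
have nB3 := nnker_scale G1V nkY; have nB4 := nnker_scale M0 nPa.
have nA := nnker_scale ea0 nY.
rewrite -(convDr t nK nB1 nB2) -(convDr t nK (nnker_add nB1 nB2) nB3).
have nB := nnker_add (nnker_add (nnker_add nB1 nB2) nB3) nB4.
rewrite -(convDr t nK (nnker_add (nnker_add nB1 nB2) nB3) nB4).
rewrite /X integral_mkcond /conv.
set f := (fun s : R => (mlk al la (t - s) * r s)%:E) \_ `]0%R, t[.
have f0 s : (0 <= f s)%E.
  rewrite /f patchE; case: ifP => // _.
  by rewrite lee_fin mulr_ge0// mlk_ge0.
apply: (lower_integral_add f0 (nnker_conv_integrand t nK nA) (nnker_conv_integrand t nK nB)) => s.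
have rhs0 := adde_ge0 (f0 s) ((nnker_conv_integrand t nK nB).2 s).
have [/[dup] st /andP[as_ st2]|st] := boolP (a < s <= t); last first.
  by rewrite [in X in (X <= _)%E](Yker_out st) !mule0.
have [ts|st'] := leP t s.
  by rewrite [in X in (X <= _)%E](_ : K (t - s)%R = 0%E) ?mul0e//= mlk_le0// subr_le0.
rewrite /f patchE mem_setE in_itv/= (lt_trans a0 as_) st'/=.
rewrite {1}(Yker_in st) -EFinM.
apply: (@le_trans _ _ ((mlk al la (t - s))%:E * ((r s)%:E +
    (Ce%:E * one s + lm%:E * Y s + (G1^-1)%:E * kapY s + M%:E * Pa s)))%E).
  rewrite [X in (X <= _)%E]EFinM.
  by apply: lee_wpmul2l; [rewrite lee_fin mlk_ge0|exact: energy_pointwise].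
by rewrite EFinM ge0_muleDr// ?lee_fin//; exact: nB.2.
Qed.

End with_scale.

Lemma le_conv_mlk (f g : R -> \bar R) s : nnker f -> nnker g ->
  (forall x, x <= s -> (f x <= g x)%E) -> (conv K f s <= conv K g s)%E.
Proof.
move=> nf ng fg; apply: (le_conv nK nf nK ng) => x.
have [xs|sx] := leP x s; first by apply: lee_wpmul2l; [exact: nK.2|exact: fg].
rewrite (_ : K (s - x)%R = 0%E) ?mul0e//= mlk_le0//.
by rewrite subr_le0 ltW.
Qed.

(** All errors of the scale e are multiples of e^(1 - al), collected in D. This D depends on a,
    through L and through the distance t - a; the [Pa] term is independent of e and is kept
    apart. *)
Lemma at_time_bound : X \is a fin_num -> exists2 D : R, 0 <= D &
  forall e, 0 < e -> e <= (t - a) / 2 ->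
  ((y t)%:E <= X + (D * e `^ (1 - al) + M * fine (conv K Pa t))%:E)%E.
Proof.
move=> fX; have [cK cK0 cKP] := conv_mlk_le; have ta0 : 0 < t - a by rewrite subr_gt0.
have [J1 J10 J1P] := conv_Jker_small al1 al0 ta0.
(* The index is 2 al because K is replaced by a multiple of k in K * ([Jker e] * k), and k * k has
   index 2 al. *)
have [J2 J20 J2P] := conv_Jker_small al1 (addr_gt0 al0 al0) ta0.
have tY := tame_Yker; have nY := tY.1; have tk := tame_kern al0; have t1 := tame_kern (@ltr01 R).
have n1 := @nnker_one R; have nPa := nnker_Pa; have nk1 := nnker_conv nk n1.
have tk1 := tame_conv tk t1.
have t0 := lt_trans a0 at_.
have fK1 := conv_mlk_fin t1 tT; have fk1 := tame_fin t tk1; have fKk1 := conv_mlk_fin tk1 tT.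
have fKY := conv_mlk_fin tY tT; have fKkY := conv_mlk_fin (tame_conv tk tY) tT.
have fkY := tame_fin t (tame_conv tk tY).
have fKPa : conv K Pa t \is a fin_num.
  rewrite ge0_fin_numE; last exact: (nnker_conv nK nPa).2.
  apply: (le_lt_trans (cKP Pa t nPa _ tT)).
    by move=> s s0; rewrite /Pa /= /Par ltNge (le_trans s0 (ltW a0)).
  have tJ : tame (Jker al a).
    split; first exact: nnker_Jker.
    exists 1 => //; exists (1 - al) => // s; rewrite mul1e /Jker patchE.
    by case: ifP => // _; exact: (nnker_kern al1').2.
  by rewrite conv_Pa -(fineK (tame_fin t (tame_conv tk tJ))) -EFinM ltry.
pose k1 := fine (conv K one t); pose k2 := fine (conv k one t).
pose k3 := fine (conv K (conv k one) t).
have k10 : 0 <= k1 by apply: fine_ge0; exact: (nnker_conv nK n1).2.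
have k20 : 0 <= k2 by apply: fine_ge0; exact: nk1.2.
have k30 : 0 <= k3 by apply: fine_ge0; exact: (nnker_conv nK nk1).2.
have G1V : 0 <= G1^-1 by rewrite invr_ge0 ltW.
have G1_ge0 := ltW G10.
pose D1 := L * k2 + M * G1 * J1; pose D2 := L * k3; pose D3 := L * k3 + M * G1 * (cK * J2).
pose D := L * (al / (1 - al)) / G1 * k1 + (D1 + lp * D2 + lm * D3) / G1.
have D0 : 0 <= D.
  by rewrite !(addr_ge0, mulr_ge0) ?invr_ge0 ?(ltW al0) ?(ltW al1').
exists D => // e e0 eta.
have tkap := tame_kap al0 e0; have nkap := tkap.1.
have tkapY := tame_conv tkap tY; have nkapY := tkapY.1.
have tPhi := tame_Phi al0 al1 e0; have nPhi := tPhi.1.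
have tPhiY := tame_conv tPhi tY; have nPhiY := tPhiY.1.
have nkkapY := nnker_conv nk nkapY; have nkY := nnker_conv nk nY.
have fKkapY := conv_mlk_fin tkapY tT; have fKkkapY := conv_mlk_fin (tame_conv tk tkapY) tT.
have fkkapY := tame_fin t (tame_conv tk tkapY).
have fPhiY := tame_fin t tPhiY; have fKPhiY := conv_mlk_fin tPhiY tT.
have ea0 : 0 <= e `^ (- al) by exact: powR_ge0.
have nJ := nnker_Jker al1 e; have nJk := nnker_conv nJ nk; have nsJk := nnker_shift a nJk.
pose e' := e `^ (1 - al); have e'0 : 0 <= e' by exact: powR_ge0.
have Le0 : 0 <= L * e' by exact: mulr_ge0.
have MG0 : 0 <= M * G1 by exact: mulr_ge0.
have CF : (conv k (conv (kap al e) Y) \+ conv (Phi al e) Y)%E =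
    (fun s => (e `^ (- al))%:E * conv k Y s)%E.
  apply/funext => s /=; rewrite (convA nk nkap nY) (convC nk nkap).
  rewrite -(convDl s (nnker_conv nkap nk) nPhi nY) -(convZl s ea0 nk nY).
  by congr (conv _ Y s); apply/funext => x; exact: conv_kap_kern.
have V1 := mlk_volterra_conv t tY.
have V2 := mlk_volterra_conv t tkapY.
have C1 := congr1 (fun F : R -> \bar R => F t) CF.
have C2 := congr1 (fun F : R -> \bar R => conv K F t) CF.
rewrite /= (convDr t nK nkkapY nPhiY) (convZr t ea0 nK nkY) in C2.
have En := energy_conv e0.
have Lo := PhiY_ge e0 (lexx t).
have nG1Y := nnker_scale G1_ge0 nY; have nLk1 := nnker_scale Le0 nk1.
have nMJ := nnker_scale MG0 nsJk.
have Up : (conv K (conv (Phi al e) Y) t <=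
    G1%:E * conv K Y t + (L * e')%:E * conv K (conv k one) t)%E.
  rewrite -(convZr t G1_ge0 nK nY) -(convZr t Le0 nK nk1) -(convDr t nK nG1Y nLk1).
  apply: (le_conv_mlk nPhiY (nnker_add nG1Y nLk1)) => x xt; exact: PhiY_le.
have Lo3 : (G1%:E * conv K Y t <= conv K (conv (Phi al e) Y) t +
    (L * e')%:E * conv K (conv k one) t +
    (M * G1)%:E * conv K (fun s => conv (Jker al e) k (s - a)) t)%E.
  rewrite -(convZr t G1_ge0 nK nY) -(convZr t Le0 nK nk1) -(convZr t MG0 nK nsJk).
  rewrite -(convDr t nK nPhiY nLk1) -(convDr t nK (nnker_add nPhiY nLk1) nMJ).
  apply: (le_conv_mlk nG1Y (nnker_add (nnker_add nPhiY nLk1) nMJ)) => x xt.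
  exact: PhiY_ge.
have KJ : (conv K (fun s => conv (Jker al e) k (s - a)) t <= (cK * J2 * e')%:E)%E.
  apply: (le_trans (cKP _ t nsJk _ tT)).
    move=> s s0; apply: conv_supp; first by rewrite subr_le0 (le_trans s0 (ltW a0)).
      move=> x x0; rewrite /Jker patchE mem_setE in_itv/= ltNge x0; by [].
    by move=> x; exact: kern_le0.
  rewrite (conv_shift a t nk nJk) (convC nk nJk) -(convA nJ nk nk) (conv_kern al0 al0).
  rewrite -mulrA [X in (_ <= X)%E]EFinM; apply: lee_wpmul2l; first by rewrite lee_fin.
  exact: J2P.
have Lo' : ((G1 * y t)%:E <= conv (Phi al e) Y t + (L * e' * k2 + M * G1 * J1 * e')%:E)%E.
  move: Lo; rewrite Yker_in ?at_ ?lexx// -EFinM => /le_trans; apply.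
  rewrite -addeA; apply: leeD2l; rewrite EFinD; apply: leeD.
    by rewrite [X in (_ <= X)%E]EFinM /k2 (fineK fk1) lexx.
  rewrite -mulrA [X in (_ <= X)%E]EFinM; apply: lee_wpmul2l; first by rewrite lee_fin.
  exact: J1P.
have Lo3' : (G1%:E * conv K Y t <= conv K (conv (Phi al e) Y) t +
    (L * e' * k3 + M * G1 * (cK * J2 * e'))%:E)%E.
  apply: (le_trans Lo3); rewrite -addeA; apply: leeD2l; rewrite EFinD; apply: leeD.
    by rewrite [X in (_ <= X)%E]EFinM /k3 (fineK fKk1) lexx.
  by rewrite [X in (_ <= X)%E]EFinM; apply: lee_wpmul2l; [rewrite lee_fin|exact: KJ].
have Up' : (conv K (conv (Phi al e) Y) t <= G1%:E * conv K Y t + (L * e' * k3)%:E)%E.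
  by apply: (le_trans Up); apply: leeD2l; rewrite [X in (_ <= X)%E]EFinM /k3 (fineK fKk1) lexx.
have -> : D * e `^ (1 - al) + M * fine (conv K Pa t) =
    L * (al / (1 - al)) * e `^ (1 - al) / G1 * k1 + M * fine (conv K Pa t) +
    ((L * e' * k2 + M * G1 * J1 * e') + lp * (L * e' * k3) +
     lm * (L * e' * k3 + M * G1 * (cK * J2 * e'))) / G1.
  by rewrite /D /D1 /D2 /D3 -/e'; ring.
exact: (comparison_earith G10 lp0 lm0 fKY fKkapY fKkY fKkkapY fkY fkkapY
  fPhiY fKPhiY fX fK1 fKPa V1 V2 C1 C2 En Lo' Up' Lo3').
Qed.

End conclusion.

End at_time.

Lemma le_vanishing (b d D y x c : R) : 0 < b -> 0 < d -> 0 <= D ->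
  (forall e, 0 < e -> e <= d -> y <= x + (D * e `^ b + c)) -> y <= x + c.
Proof.
move=> b0 d0 D0 H; rewrite leNgt; apply/negP => lt.
pose g := y - (x + c); have g0 : 0 < g by rewrite subr_gt0.
have D1 : 0 < D + 1 by lra.
have q0 : 0 < g / (D + 1) by rewrite divr_gt0.
pose e := Num.min d ((g / (D + 1)) `^ b^-1).
have e0 : 0 < e by rewrite lt_min d0 powR_gt0.
have ed : e <= d by rewrite ge_min lexx.
have eb : e `^ b <= g / (D + 1).
  apply: (@le_trans _ _ (((g / (D + 1)) `^ b^-1) `^ b)).
    apply: ge0_ler_powR; rewrite ?nnegrE ?powR_ge0 ?(ltW b0) ?(ltW e0)//.
    by rewrite ge_min lexx orbT.
  by rewrite -powRrM mulVf ?gt_eqF// powRr1// ltW.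
have := H e e0 ed; apply/negP; rewrite -ltNge.
have : D * e `^ b < g.
  apply: (@le_lt_trans _ _ (D * (g / (D + 1)))); first by rewrite ler_wpM2l.
  by rewrite mulrA ltr_pdivrMr// mulrC ltr_pM2l// ltrDl.
by rewrite /g; set z := D * _; lra.
Qed.

(** The scalar statement behind the theorem: M is uniform in time, while L may depend on a, as y
    need not be continuous at 0. *)
Theorem caputo_comparison (y r : R -> R) (M t : R) :
  (forall s, 0 <= y s) -> (forall s, 0 <= r s) -> 0 <= M ->
  (forall s, 0 < s <= T -> y s <= M) ->
  (forall a, 0 < a -> exists L, [/\ 0 <= L,
    forall s1 s2, a <= s1 <= T -> a <= s2 <= T -> `|y s1 - y s2| <= L * `|s1 - s2| &
    forall c s, a <= c -> c < s -> s <= T ->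
    ((((s - c) `^ (- al) / G1 + lp) * y s)%:E <=
     (r s + L * (al / (1 - al)) * (s - c) `^ (1 - al) / G1 + lm * y s)%:E +
     (G1^-1)%:E * \int[mu]_(x in `]0%R, c[) (al * (s - x) `^ (- al - 1) * y x)%:E)%E]) ->
  0 < t <= T ->
  ((y t)%:E <= \int[mu]_(s in `]0%R, t[) (mlk al la (t - s) * r s)%:E)%E.
Proof.
move=> y0 r0 M0 yM H /andP[t0 tT].
set X := (\int[mu]_(s in _) _)%E.
have X0 : (0 <= X)%E.
  by apply: integral_ge0 => s _; rewrite lee_fin mulr_ge0// mlk_ge0.
have [fX|] := boolP (X \is a fin_num); last first.
  by rewrite ge0_fin_numE// -leNgt leye_eq => /eqP ->; rewrite leey.
have [cK cK0 cKP] := conv_mlk_le.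
have [C C0 CP] := conv_Jker_small al1 al0 t0.
have t2 : 0 < t / 2 by rewrite divr_gt0.
rewrite -(fineK fX) lee_fin -[fine X]addr0.
(* Outer limit a -> 0: none of M, cK, C depends on a. *)
apply: (@le_vanishing (1 - al) (t / 2) (M * (cK * C)) (y t)) => //.
  by rewrite !mulr_ge0.
move=> a a0 a2; rewrite addr0.
have at_ : a < t by apply: (le_lt_trans a2); lra.
have [L [L0 yL En]] := H a a0.
have [D D0 DP] := at_time_bound y0 M0 L0 a0 at_ tT yM yL r0 En fX.
apply: (@le_trans _ _ (fine X + M * fine (conv K (Pa a) t))); last first.
  rewrite lerD2l -!mulrA ler_wpM2l//.
  have nP := nnker_Pa a0; have nJ := nnker_Jker al1 a.
  have := cKP (Pa a) t nP _ tT; rewrite (conv_Pa a0 at_) (convC nk nJ) => /(_ _)/le_trans h.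
  have cP : (conv K (Pa a) t <= (cK * (C * a `^ (1 - al)))%:E)%E.
    apply: h; last by rewrite EFinM; apply: lee_wpmul2l; [rewrite lee_fin|exact: CP].
    by move=> s s0; rewrite /Pa /= /Par ltNge (le_trans s0 (ltW a0)).
  have P0 : (0 <= conv K (Pa a) t)%E by exact: (nnker_conv nK nP).2.
  rewrite -lee_fin fineK// ge0_fin_numE//.
  by apply: (le_lt_trans cP); rewrite ltry.
(* Inner limit e -> 0 at fixed a, on which D depends. *)
apply: (@le_vanishing (1 - al) ((t - a) / 2) D (y t)) => //.
  by rewrite divr_gt0// subr_gt0.
move=> e e0 ee; have := DP e e0 ee.
by rewrite -/X -{1}(fineK fX) -EFinD lee_fin.
Qed.

End comparison.

(** * Functions on Omega *)

Section rV_borel.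
Context {R : realType} {d : nat}.
Local Notation mu := (lebesgue_rV R d).

Lemma measurable_rV_box (A : 'I_d -> set R) :
  (forall i, measurable (A i : set (measurableTypeR R))) ->
  measurable [set x : 'rV[R]_d | forall i, A i (x ord0 i)].
Proof. by move=> mA; have [] := lebesgue_rV_box mA. Qed.

(** The sigma-algebra is generated by the coordinates, so topology has to be connected to it: an
    open set is the union of the countably many boxes with rational centre and radius that it
    contains. *)
Lemma open_measurable_rV (U : set 'rV[R]_d) : open U -> measurable U.
Proof.
move=> oU.
pose box (p : {ffun 'I_d -> rat} * rat) :=
  [set x : 'rV[R]_d | forall i, ball (ratr (p.1 i) : R) (ratr p.2) (x ord0 i)].
pose F p := if `[< box p `<=` U >] then box p else set0.
suff -> : U = \bigcup_p F p.
  apply: countable_bigcupT_measurable => [|p]; first exact: countableP.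
  rewrite /F; case: ifP => // _.
  apply: (measurable_rV_box (A := fun i => ball (ratr (p.1 i) : R) (ratr p.2))) => i.
  exact: measurable_ball.
apply/seteqP; split => [x Ux|x [p _]]; last first.
  by rewrite /F; case: ifP => // /asboolP; apply.
have /nbhs_ballP[e /= e0 xeU] : nbhs x U by exact: open_nbhs_nbhs.
(* The centre will lie within r of x, so every point of the box is within 2 r < e of x. *)
have [r] := @rat_in_itvoo R 0 (e / 2) (divr_gt0 e0 (ltr0Sn _ _)).
rewrite in_itv/= => /andP[r0 re].
have q_ i : {q : rat | ball (ratr q : R) (ratr r) (x ord0 i)}.
  apply: cid; have [q] := @rat_in_itvoo R (x ord0 i - ratr r) (x ord0 i + ratr r) ltac:(lra).
  rewrite in_itv/= => qx; exists q; rewrite /ball/= ltr_distlC.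
  by lra.
exists ([ffun i => sval (q_ i)], r) => //.
have bx : box ([ffun i => sval (q_ i)], r) x by move=> i; rewrite /= ffunE; case: (q_ i).
rewrite /F; case: ifPn => // /negP[]; apply/asboolP => z bz.
apply: xeU; split=> // i j; rewrite ord1.
have := bz j; have := bx j; rewrite /= => /ball_sym h1 h2.
by have := ball_triangle h1 h2; apply: le_ball; lra.
Qed.

Lemma closed_measurable_rV (U : set 'rV[R]_d) : closed U -> measurable U.
Proof.
by move=> cU; rewrite -[U]setCK; apply: measurableC; apply: open_measurable_rV; exact: closed_openC.
Qed.

Lemma continuous_measurable_rV (f : 'rV[R]_d -> R) : continuous f -> measurable_fun setT f.
Proof.
move=> cf; apply: (measurability _ (RGenOpens.measurableE R)) => _ [_ [a [b ->] <-]].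
rewrite setTI; apply: open_measurable_rV; move/continuousP : cf; apply.
exact: interval_open.
Qed.

Lemma bounded_rV_finite (U : set 'rV[R]_d) : measurable U -> bounded_set U -> (mu U < +oo)%E.
Proof.
move=> mU [N [_ UN]]; pose M := N + 1.
have {}UM : forall x, U x -> `|x| <= M by apply: UN; rewrite ltrDl.
have mA (i : 'I_d) : measurable (`[- M, M]%classic : set (measurableTypeR R)).
  exact: measurable_itv.
have [mB BE] := lebesgue_rV_box mA.
apply: (@le_lt_trans _ _ (mu [set x : 'rV[R]_d | forall i, `[- M, M]%classic (x ord0 i)])).
  apply: le_measure; rewrite ?inE// => x Ux i /=.
  rewrite in_itv/= -ler_norml; apply: le_trans (UM x Ux).
  rewrite -[`|x|]/(mx_norm x) mx_normrE; exact: (le_bigmax _ _ (ord0, i)).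
suff BF : (mu [set x : 'rV[R]_d | forall i, `[- M, M]%classic (x ord0 i)]) \is a fin_num.
  by rewrite ltey_eq BF.
rewrite BE; apply: (big_ind (fun z => z \is a fin_num)) => //; first by move=> x y; exact: fin_numM.
by move=> i _; rewrite lebesgue_measure_itv/=; case: ifP => // _; rewrite -EFinB.
Qed.

End rV_borel.

(** * Inner product and norm on square integrable functions *)

Section L2_theory.
Context {R : realType} {d : nat} (Omega : set 'rV[R]_d).
Hypothesis mO : measurable Omega.
Local Notation mu := (lebesgue_rV R d).
Local Notation L2 := (L2 Omega).
Local Notation L2norm := (L2norm Omega).
Local Notation L2dot := (L2dot Omega).
Implicit Types f g h : 'rV[R]_d -> R.

Lemma Lnorm_restrict f : ('N[mu]_2%:E[EFin \o (f \_ Omega)] `^ 2 =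
  \int[mu]_(x in Omega) (f x ^+ 2)%:E)%E.
Proof.
rewrite poweR_Lnorm// [RHS]integral_mkcond; apply: eq_integral => x _.
by rewrite /= !patchE; case: ifP => _; rewrite ?normr0 -?EFinM ?powR0// powR_mulrn// real_normK ?num_real.
Qed.

Lemma L2P f : L2 f <-> measurable_fun Omega f /\ (\int[mu]_(x in Omega) (f x ^+ 2)%:E < +oo)%E.
Proof.
have I : ('N[mu]_2%:E[EFin \o (f \_ Omega)] < +oo)%E = (\int[mu]_(x in Omega) (f x ^+ 2)%:E < +oo)%E.
  apply/idP/idP => [h|]; first by rewrite -Lnorm_restrict; exact: poweR_lty.
  by rewrite -Lnorm_restrict => /(@lty_poweRy _ _ 2); apply.
rewrite /Defs.L2; split.
  case/andP; rewrite !inE/= /finite_norm I => /(measurable_restrictT _ mO) mf fi.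
  by split.
case=> /(measurable_restrictT _ mO) mf fi; apply/andP; rewrite !inE/= /finite_norm I.
by split.
Qed.

Lemma L2_lin f g c : L2 f -> L2 g -> L2 (fun x => c * f x + g x).
Proof.
move=> f2 g2; have := (@Lfun_submod_closed _ _ R mu 2%:E (lee1n 2)).2 c _ _ f2 g2.
rewrite (_ : c *: f \_ Omega + g \_ Omega = (fun x => c * f x + g x) \_ Omega)//.
apply/funext => x; rewrite patchE.
by rewrite -[LHS]/(c * (f \_ Omega) x + (g \_ Omega) x) !patchE; case: ifP => _; rewrite ?mulr0 ?addr0.
Qed.

Lemma L2_mul_integrable f g : L2 f -> L2 g -> mu.-integrable Omega (EFin \o (fun x => f x * g x)).
Proof.
move=> /L2P[mf fi] /L2P[mg gi]; apply/integrableP; split.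
  by apply/measurable_EFinP; exact: measurable_funM.
have m2 h : measurable_fun Omega h -> measurable_fun Omega (fun x => (h x ^+ 2)%:E).
  by move=> mh; apply/measurable_EFinP; exact: measurable_funX.
apply: (@le_lt_trans _ _ (\int[mu]_(x in Omega) ((f x ^+ 2)%:E + (g x ^+ 2)%:E))%E).
  apply: ge0_le_integral => //.
  - by apply: measurableT_comp => //; apply/measurable_EFinP; exact: measurable_funM.

  - by apply: emeasurable_funD; exact: m2.
  move=> x _; rewrite /= -EFinD lee_fin normrM -(real_normK (num_real (f x))) -(real_normK (num_real (g x))).
  by have := sqr_ge0 (`|f x| - `|g x|); have := sqr_ge0 (`|f x| + `|g x|); nra.
rewrite ge0_integralD//.
- exact: lte_add_pinfty.
- by move=> x _; rewrite lee_fin sqr_ge0.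
- exact: m2.
- by move=> x _; rewrite lee_fin sqr_ge0.
- exact: m2.
Qed.

Lemma eq_L2 f g : {in Omega, f =1 g} -> L2 f -> L2 g.
Proof.
move=> fg; rewrite /Defs.L2 (_ : f \_ Omega = g \_ Omega)//.
by apply/funext => x; rewrite !patchE; case: ifPn => // xO; exact: fg.
Qed.

Lemma L20 : L2 (fun=> 0).
Proof.
apply/L2P; split; first exact: measurable_cst.
by rewrite integral0_eq ?ltry// => x _; rewrite expr0n.
Qed.

Lemma L2D f g : L2 f -> L2 g -> L2 (fun x => f x + g x).
Proof. by move=> f2 g2; apply: eq_L2 (L2_lin 1 f2 g2) => x _; rewrite mul1r. Qed.

Lemma L2Z c f : L2 f -> L2 (fun x => c * f x).
Proof. by move=> f2; apply: eq_L2 (L2_lin c f2 L20) => x _; rewrite addr0. Qed.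

Lemma L2B f g : L2 f -> L2 g -> L2 (fun x => f x - g x).
Proof.
by move=> f2 g2; apply: eq_L2 (L2_lin (-1) g2 f2) => x _; rewrite mulN1r addrC.
Qed.

Lemma L2_sum n (F : 'I_n -> 'rV[R]_d -> R) :
  (forall i, L2 (F i)) -> L2 (fun x => \sum_(i < n) F i x).
Proof.
elim: n F => [|n IH] F F2.
  by apply: eq_L2 L20 => x _; rewrite big_ord0.
apply: eq_L2 (L2D (IH _ (fun i => F2 (widen_ord (leqnSn n) i))) (F2 ord_max)) => x _.
by rewrite big_ord_recr.
Qed.

Lemma L2dotC f g : L2dot f g = L2dot g f.
Proof. by apply: eq_Rintegral => x _; rewrite mulrC. Qed.

Lemma L2dotDl f g h : L2 f -> L2 g -> L2 h ->
  L2dot (fun x => f x + g x) h = L2dot f h + L2dot g h.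
Proof.
move=> f2 g2 h2; rewrite /Defs.L2dot -RintegralD//; try exact: L2_mul_integrable.
by apply: eq_Rintegral => x _; rewrite mulrDl.
Qed.

Lemma L2dotBl f g h : L2 f -> L2 g -> L2 h ->
  L2dot (fun x => f x - g x) h = L2dot f h - L2dot g h.
Proof.
move=> f2 g2 h2; rewrite /Defs.L2dot -RintegralB//; try exact: L2_mul_integrable.
by apply: eq_Rintegral => x _; rewrite mulrBl.
Qed.

Lemma L2dotZl c f h : L2 f -> L2 h -> L2dot (fun x => c * f x) h = c * L2dot f h.
Proof.
move=> f2 h2; rewrite /Defs.L2dot -RintegralZl//; last exact: L2_mul_integrable.
by apply: eq_Rintegral => x _; rewrite mulrA.
Qed.

Lemma L2dotBr f g h : L2 f -> L2 g -> L2 h ->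
  L2dot h (fun x => f x - g x) = L2dot h f - L2dot h g.
Proof. by move=> f2 g2 h2; rewrite L2dotC L2dotBl// !(L2dotC h). Qed.

Lemma L2dot_suml n (F : 'I_n -> 'rV[R]_d -> R) h : (forall i, L2 (F i)) -> L2 h ->
  L2dot (fun x => \sum_(i < n) F i x) h = \sum_(i < n) L2dot (F i) h.
Proof.
move=> F2 h2; elim: n F F2 => [|n IH] F F2.
  rewrite big_ord0 -[RHS](mul0r (fine (mu Omega))) -Rintegral_cst//.
  by apply: eq_Rintegral => x _; rewrite big_ord0 mul0r.
rewrite big_ord_recr/= -(IH (fun i => F (widen_ord (leqnSn n) i)))// -L2dotDl//.
  by apply: eq_Rintegral => x _; rewrite big_ord_recr.
exact: L2_sum.
Qed.

Lemma L2norm_ge0 f : 0 <= L2norm f.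
Proof. by apply: fine_ge0; exact: Lnorm_ge0. Qed.

Lemma L2norm_sqr f : L2 f -> L2norm f ^+ 2 = L2dot f f.
Proof.
move=> f2; rewrite -powR_mulrn ?L2norm_ge0//.
have fin : ('N[mu]_2%:E[EFin \o (f \_ Omega)])%E \is a fin_num.
  rewrite ge0_fin_numE ?Lnorm_ge0//.
  by case/andP : f2 => _; rewrite inE.
rewrite /Defs.L2dot /Defs.L2norm /Rintegral.
under eq_integral => x _ do rewrite -expr2.
by rewrite -Lnorm_restrict -{2}(fineK fin) poweR_EFin.
Qed.

Lemma cauchy_schwarz f g : L2 f -> L2 g -> `|L2dot f g| <= L2norm f * L2norm g.
Proof.
move=> f2 g2.
have H c : 0 <= L2norm f ^+ 2 - 2 * c * L2dot f g + c ^+ 2 * L2norm g ^+ 2.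
  have cg2 := L2Z c g2; have fcg := L2B f2 cg2.
  have := sqr_ge0 (L2norm (fun x => f x - c * g x)).
  rewrite (L2norm_sqr fcg) (L2dotBl f2 cg2 fcg) (L2dotBr f2 cg2 f2) (L2dotBr f2 cg2 cg2).
  rewrite (L2dotC f (fun x => c * g x)) !(L2dotZl c g2)//.
  rewrite (L2dotC g (fun x => c * g x)) (L2dotZl c g2 g2) (L2norm_sqr f2) (L2norm_sqr g2).
  rewrite (L2dotC g f); set a := L2dot f f; set b := L2dot g g; set s := L2dot f g.
  by rewrite (_ : _ - _ - _ = a - 2 * c * s + c ^+ 2 * b)//; ring.
rewrite -[X in _ <= X]ger0_norm ?mulr_ge0 ?L2norm_ge0// -ler_sqr ?nnegrE//.
rewrite !real_normK ?num_real//.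
move: H; move: (L2norm f) (L2norm g) (L2dot f g) => a b s H.
have [b0|b0] := eqVneq b 0.
  have [->|s0] := eqVneq s 0; first by rewrite expr0n/= sqr_ge0.
  (* When g has norm 0 the quadratic in c degenerates to an affine function of slope - 2 s; this c
     gives it the value -1. *)
  have := H ((a ^+ 2 + 1) / (2 * s)); rewrite b0 expr0n/= mulr0 addr0.
  rewrite (_ : a ^+ 2 - _ = - 1); first by rewrite oppr_ge0 ler10.
  by field.
have := H (s / b ^+ 2).
rewrite (_ : _ + _ = (a ^+ 2 * b ^+ 2 - s ^+ 2) / b ^+ 2); last by field.
rewrite pmulr_lge0 ?invr_gt0 ?exprn_even_gt0//.
by rewrite subr_ge0 exprMn.
Qed.

Lemma L2dot_le f g : L2 f -> L2 g -> L2dot f g <= L2norm f * L2norm g.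
Proof. by move=> f2 g2; exact: le_trans (ler_norm _) (cauchy_schwarz f2 g2). Qed.

Lemma L2normD_le f g : L2 f -> L2 g -> L2norm (fun x => f x + g x) <= L2norm f + L2norm g.
Proof.
move=> f2 g2; have fg := L2D f2 g2.
rewrite -ler_sqr ?nnegrE ?addr_ge0 ?L2norm_ge0//.
rewrite L2norm_sqr// L2dotDl// !(L2dotC _ (fun x => f x + g x)) !L2dotDl// -!L2norm_sqr//.
have := L2dot_le f2 g2; rewrite (L2dotC g f).
by move: (L2norm f) (L2norm g) (L2dot f g) => a b s ?; nra.
Qed.

Lemma L2normBC f g : L2norm (fun x => f x - g x) = L2norm (fun x => g x - f x).
Proof.
rewrite /Defs.L2norm -oppe_Lnorm; congr (fine (Lnorm _ _ _)); apply/funext => x /=.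
by rewrite !patchE; case: ifP => _; rewrite ?opprB ?oppr0.
Qed.

Lemma L2norm_dist f g : L2 f -> L2 g ->
  `|L2norm f - L2norm g| <= L2norm (fun x => f x - g x).
Proof.
move=> f2 g2; have H a b : L2 a -> L2 b -> L2norm a - L2norm b <= L2norm (fun x => a x - b x).
  move=> a2 b2; rewrite lerBlDr.
  rewrite -[X in L2norm X <= _](_ : (fun x => a x - b x + b x) = a).
    exact: L2normD_le (L2B a2 b2) b2.
  by apply/funext => x; rewrite subrK.
by rewrite ler_norml lerNl opprB H// andbT L2normBC H.
Qed.

End L2_theory.

Section integral_sum.
Context d (T : measurableType d) (R : realType) (mu : {measure set T -> \bar R}).
Variables (D : set T) (mD : measurable D).

Lemma Rintegral_sum n (F : 'I_n -> T -> R) :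
  (forall i, mu.-integrable D (EFin \o F i)) ->
  mu.-integrable D (EFin \o (fun x => \sum_(i < n) F i x)) /\
  \int[mu]_(x in D) (\sum_(i < n) F i x) = \sum_(i < n) \int[mu]_(x in D) F i x.
Proof.
elim: n F => [|n IH] F iF.
  split.
    rewrite (_ : EFin \o _ = cst 0%E); first exact: integrable0.
    by apply/funext => x /=; rewrite big_ord0.
  rewrite big_ord0 -[RHS](mul0r (fine (mu D))) -Rintegral_cst//.
  by apply: eq_Rintegral => x _; rewrite big_ord0.
have [I1 E1] := IH (fun i => F (widen_ord (leqnSn n) i)) (fun i => iF _).
split.
  rewrite (_ : EFin \o _ = ((EFin \o (fun x => \sum_(i < n) F (widen_ord (leqnSn n) i) x)%R) \+
    (EFin \o F ord_max))%E); first exact: integrableD.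
  by apply/funext => x /=; rewrite big_ord_recr/= EFinD.
rewrite big_ord_recr/= -E1 -RintegralD//.
by apply: eq_Rintegral => x _; rewrite big_ord_recr.
Qed.

End integral_sum.

(** * Test functions, bounded coefficients and differences in the energy space *)

Section test_functions.
Context {R : realType} {d : nat} (Omega : set 'rV[R]_d).
Hypotheses (oO : open Omega) (bO : bounded_set Omega).
Local Notation mu := (lebesgue_rV R d).
Local Notation L2 := (L2 Omega).
Local Notation L2norm := (L2norm Omega).
Local Notation L2dot := (L2dot Omega).
Local Notation test_function := (test_function Omega).
Implicit Types (f v w W r phi psi : 'rV[R]_d -> R) (g h gphi : 'I_d -> 'rV[R]_d -> R).

Let mO : measurable Omega. Proof. exact: open_measurable_rV. Qed.

Lemma bounded_L2 f (C : R) : measurable_fun Omega f -> (forall x, `|f x| <= C) -> L2 f.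
Proof.
move=> mf fC; apply/(L2P mO); split => //.
apply: (@le_lt_trans _ _ (\int[mu]_(x in Omega) (C ^+ 2)%:E)%E).
  apply: ge0_le_integral => //.
  - by move=> x _; rewrite lee_fin sqr_ge0.
  - by apply/measurable_EFinP; exact: measurable_funX.
  move=> x _; rewrite lee_fin -(real_normK (num_real (f x))) ler_sqr ?nnegrE//.
  by rewrite (le_trans _ (fC x)).
rewrite integral_cst// lte_mul_pinfty ?lee_fin ?sqr_ge0//.
exact: bounded_rV_finite.
Qed.

Lemma compact_support_bounded f K : continuous f -> compact K ->
  (forall x, ~ K x -> f x = 0) -> exists2 C : R, 0 <= C & forall x, `|f x| <= C.
Proof.
move=> cf cK f0.
have /compact_bounded[N [_ NB]] : compact (f @` K).
  by apply: continuous_compact => //; apply: continuous_subspaceT.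
exists (`|N| + 1) => [|x]; first by rewrite addr_ge0.
have [Kx|Kx] := pselect (K x); last by rewrite f0// normr0 addr_ge0.
apply: NB; first by rewrite (le_lt_trans (ler_norm _))// ltrDl.
by exists x.
Qed.

Lemma test_functionP phi : test_function phi -> exists K, [/\ compact K, K `<=` Omega,
  continuous phi, forall x, ~ K x -> phi x = 0 &
  forall i, continuous (partial i phi) /\ forall x, ~ K x -> partial i phi x = 0].
Proof.
move=> [sm cK KO]; exists (closure [set x | phi x != 0]).
have phi0 x : ~ closure [set x | phi x != 0] x -> phi x = 0.
  by move=> /(contra_not (@subset_closure _ _ _)) /negP; rewrite negbK => /eqP.
split => //; first exact: (sm [::]).1.
move=> i; split; first exact: (sm [:: i]).1.
move=> x Kx; rewrite /partial -(derive_cst (0 : R) x (delta_mx ord0 i)).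
apply: near_eq_derive.
have oC : open (~` closure [set x | phi x != 0]) by apply: closed_openC; exact: closed_closure.
by apply: filterS (open_nbhs_nbhs (conj oC Kx)) => z; exact: phi0.
Qed.

Lemma test_function_L2 phi : test_function phi -> L2 phi /\ forall i, L2 (partial i phi).
Proof.
case/test_functionP => K [cK KO cphi phi0 dphi].
have H f : continuous f -> (forall x, ~ K x -> f x = 0) -> L2 f.
  move=> cf f0; have [C _ fC] := compact_support_bounded cf cK f0.
  by apply: bounded_L2 fC; apply: measurable_funTS; exact: continuous_measurable_rV.
by split=> [|i]; apply: H => //; case: (dphi i).
Qed.

Lemma smoothB phi psi : smooth phi -> smooth psi -> smooth (phi \- psi).
Proof.
move=> sp sq.
have E (s : seq 'I_d) : foldr (@partial R d) (phi \- psi) s =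
    foldr (@partial R d) phi s \- foldr (@partial R d) psi s.
  elim: s => //= i s ->; apply/funext => x; rewrite /partial deriveB//.
    exact: (sp s).2.
  exact: (sq s).2.
move=> s; rewrite E; split => [x|i x].
  apply: (@continuousB _ _ _ (foldr (@partial R d) phi s) (foldr (@partial R d) psi s)); first exact: (sp s).1.
  exact: (sq s).1.
by apply: derivableB; [exact: (sp s).2|exact: (sq s).2].
Qed.

Lemma partialB phi psi i : smooth phi -> smooth psi ->
  partial i (phi \- psi) = (fun x => partial i phi x - partial i psi x).
Proof.
move=> sp sq; apply/funext => x; rewrite /partial deriveB//.
  exact: (sp [::]).2.
exact: (sq [::]).2.
Qed.

Lemma test_functionB phi psi : test_function phi -> test_function psi ->
  test_function (phi \- psi).
Proof.
move=> [sp cp pO] [sq cq qO].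
have sub : closure [set x | (phi \- psi) x != 0] `<=`
    closure [set x | phi x != 0] `|` closure [set x | psi x != 0].
  rewrite -closureU; apply: closure_subset => x /= h.
  have [p0|] := eqVneq (phi x) 0; last by left.
  by right; move: h; rewrite /= p0 sub0r oppr_eq0.
split; first exact: smoothB.
  apply: (subclosed_compact _ _ sub); first exact: closed_closure.
  exact: compactU.
by apply: (subset_trans sub) => x [/pO|/qO].
Qed.

(** This covers the data f and the initial values, which are only locally integrable: on the compact
    support the product is at most a constant times |f|. *)
Lemma L1loc_mul_test f phi : L1loc Omega f -> test_function phi ->
  mu.-integrable Omega (EFin \o (fun x => f x * phi x)).
Proof.
move=> [mf fi] /test_functionP[K [cK KO cphi phi0 _]].
have [C C0 pC] := compact_support_bounded cphi cK phi0.
have mp : measurable_fun Omega phi by apply: measurable_funTS; exact: continuous_measurable_rV.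
have mK : measurable K.
  by apply: closed_measurable_rV; apply: compact_closed => //; exact: norm_hausdorff.
have mfK : measurable_fun K f by exact: measurable_funS mf.
apply/integrableP; split; first by apply/measurable_EFinP; exact: measurable_funM.
apply: (@le_lt_trans _ _ (\int[mu]_(x in Omega) ((fun x => C%:E * `|f x|%:E)%E \_ K) x)%E).
  apply: ge0_le_integral => //.
  - by apply: measurableT_comp => //; apply/measurable_EFinP; exact: measurable_funM.
  - apply: measurable_funTS; apply/(measurable_restrictT _ mK).
    by apply: measurable_funeM; apply/measurable_EFinP; exact: measurableT_comp.
  move=> x _; rewrite patchE; case: ifPn => [_|/negP]; last first.
    by rewrite inE => nK; rewrite /= phi0// mulr0 normr0.
  by rewrite /= -EFinM lee_fin normrM mulrC ler_wpM2r.
rewrite -integral_mkcondr (setIidr KO) ge0_integralZl//.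
- by rewrite lte_mul_pinfty// fi.
- by apply/measurable_EFinP; exact: measurableT_comp.
Qed.

Lemma Linfty_mul a f : Linfty Omega a -> L2 f -> L2 (fun x => a x * f x).
Proof.
move=> /andP[]; rewrite !inE/= /finite_norm => /(measurable_restrictT _ mO) ma aoo.
move=> /(L2P mO)[mf fi]; apply/(L2P mO); split; first exact: measurable_funM.
have [C C0 aC] : exists2 C : R, 0 <= C & {ae mu, forall x, Omega x -> `|a x| <= C}.
  move: aoo; rewrite unlock /=; case: ifPn => [mu0 aoo|].
    have [C C0 aC] : exists2 C : R, 0 <= C &
        (ess_sup mu (abse \o (EFin \o (a \_ Omega))) <= C%:E)%E.
      case: (ess_sup _ _) aoo => // [r _|_]; last by exists 0; rewrite ?leNye.
      by exists (Num.max r 0); rewrite ?lee_fin le_max lexx ?orbT.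
    exists C => //; apply: filterS (ess_sup_ge mu (abse \o (EFin \o (a \_ Omega)))) => x.
    by move=> /le_trans - /(_ _ aC); rewrite /= patchE lee_fin => h Ox; rewrite mem_set in h.
  (* If the whole space is null, the norm of index +oo is 0 by convention, and any bound holds
     almost everywhere. *)
  rewrite -leNgt => mu0 _; exists 0 => //; exists setT; split => //.
  by apply/eqP; rewrite eq_le mu0 measure_ge0.
apply: (@le_lt_trans _ _ (\int[mu]_(x in Omega) ((C ^+ 2)%:E * (f x ^+ 2)%:E))%E).
  apply: ae_ge0_le_integral => //.
  - by move=> x _; rewrite lee_fin sqr_ge0.
  - by apply/measurable_EFinP; apply: measurable_funX; exact: measurable_funM.
  - by move=> x _; rewrite -EFinM lee_fin mulr_ge0// sqr_ge0.
  - by apply: measurable_funeM; apply/measurable_EFinP; exact: measurable_funX.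
  apply: filterS aC => x aC Ox; rewrite -EFinM lee_fin exprMn ler_wpM2r ?sqr_ge0//.
  by rewrite -(real_normK (num_real (a x))) ler_sqr ?nnegrE//; exact: aC.
rewrite ge0_integralZl//.
- by rewrite lte_mul_pinfty// lee_fin sqr_ge0.
- by apply/measurable_EFinP; exact: measurable_funX.
- by move=> x _; rewrite lee_fin sqr_ge0.
- by rewrite lee_fin sqr_ge0.
Qed.

Lemma L2dot_cvg A (phi : nat -> 'rV[R]_d -> R) v : L2 A -> (forall n, L2 (phi n)) -> L2 v ->
  L2norm (phi n \- v) @[n --> \oo] --> 0 -> L2dot A (phi n) @[n --> \oo] --> L2dot A v.
Proof.
move=> A2 p2 v2 pv; apply/cvgrPdist_le => e e0.
have /cvgrPdist_le := pv; move=> /(_ (e / (L2norm A + 1))).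
have A0 := L2norm_ge0 Omega A; have A1 : 0 < L2norm A + 1 by rewrite ltr_wpDl.
rewrite divr_gt0// => /(_ isT); apply: filterS => n; rewrite sub0r normrN => h.
rewrite distrC -(L2dotBr mO (p2 n) v2 A2).
have CS := cauchy_schwarz mO A2 (L2B (p2 n) v2).
apply: (@le_trans _ _ (L2norm A * L2norm (phi n \- v))); first exact: CS.
apply: (@le_trans _ _ (L2norm A * (e / (L2norm A + 1)))).
  by rewrite ler_wpM2l// (le_trans (ler_norm _) h).
by rewrite mulrCA ler_piMr ?(ltW e0)// ler_pdivrMr// mul1r lerDl.
Qed.

Lemma H10_gradB v w g h : H10_grad Omega v g -> H10_grad Omega w h ->
  H10_grad Omega (v \- w) (fun i => g i \- h i).
Proof.
move=> [v2 g2 vg [phi [tphi phiv phig]]] [w2 h2 wh [psi [tpsi psiw psih]]].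
have cvgB (a b : nat -> 'rV[R]_d -> R) a0 b0 : (forall n, L2 (a n)) -> (forall n, L2 (b n)) ->
    L2 a0 -> L2 b0 ->
    L2norm (a n \- a0) @[n --> \oo] --> 0 -> L2norm (b n \- b0) @[n --> \oo] --> 0 ->
    L2norm (fun x => (a n x - b n x) - (a0 x - b0 x)) @[n --> \oo] --> 0.
  move=> a2 b2 a02 b02 ca cb.
  apply: (@squeeze_cvgr _ _ _ _ (fun=> 0) (fun n => L2norm (a n \- a0) + L2norm (b n \- b0))).
  - apply: nearW => n; rewrite L2norm_ge0/= [X in _ + X]L2normBC.
    have := L2normD_le mO (L2B (a2 n) a02) (L2B b02 (b2 n)).
    rewrite (_ : (fun x => a n x - a0 x + (b0 x - b n x)) = (fun x => (a n x - b n x) - (a0 x - b0 x)))//.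
    by apply/funext => x; ring.
  - exact: cvg_cst.
  - by rewrite -[X in _ --> X]addr0; exact: cvgD.
split.
- exact: L2B.
- by move=> i; exact: L2B.
- move=> f i tf; have [f2 df2] := test_function_L2 tf.
  rewrite [LHS](L2dotBl mO v2 w2 (df2 i)) vg// wh//.
  by rewrite [L2dot (_ \- _) _](L2dotBl mO (g2 i) (h2 i) f2) opprB opprK addrC.
exists (fun n => phi n \- psi n); split.
- by move=> n; exact: test_functionB.
- have T n := (test_function_L2 (tphi n)).1; have S n := (test_function_L2 (tpsi n)).1.
  exact: cvgB.
move=> i; have T n := (test_function_L2 (tphi n)).2 i; have S n := (test_function_L2 (tpsi n)).2 i.
rewrite (_ : (fun n => _) = (fun n => L2norm (fun x => (partial i (phi n) x - partial i (psi n) x) - (g i x - h i x)))).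
  exact: (cvgB _ _ (g i) (h i) T S).
apply/funext => n; congr L2norm; rewrite partialB//.
  by case: (tphi n).
by case: (tpsi n).
Qed.

End test_functions.

(** * The bilinear form of the operator *)

Section operator.
Context {R : realType} {d : nat} (Omega : set 'rV[R]_d).
Hypotheses (oO : open Omega) (bO : bounded_set Omega).
Local Notation mu := (lebesgue_rV R d).
Local Notation L2 := (L2 Omega).
Local Notation L2norm := (L2norm Omega).
Local Notation L2dot := (L2dot Omega).
Local Notation test_function := (test_function Omega).
Implicit Types (f v w W r phi psi : 'rV[R]_d -> R) (g h gphi : 'I_d -> 'rV[R]_d -> R).

Let mO : measurable Omega. Proof. exact: open_measurable_rV. Qed.

Variable L : second_order_operator R d.
Hypothesis hL : elliptic Omega L.

(** Grouping the coefficients with the first argument writes the pairing as finitely many L_2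
    products with the second argument and its gradient. *)
Definition flux v g i : 'rV[R]_d -> R :=
  fun x => \sum_j op_a L i j x * g j x + op_b L i x * v x.

Definition drift v g : 'rV[R]_d -> R :=
  fun x => \sum_i op_c L i x * g i x + op_e L x * v x.

Lemma flux_L2 v g i : L2 v -> (forall j, L2 (g j)) -> L2 (flux v g i).
Proof.
case: hL => ha hb _ _ _ v2 g2; apply: L2D => //; last exact: Linfty_mul.
by apply: L2_sum => // j; exact: Linfty_mul.
Qed.

Lemma drift_L2 v g : L2 v -> (forall j, L2 (g j)) -> L2 (drift v g).
Proof.
case: hL => _ _ hc he _ v2 g2; apply: L2D => //; last exact: Linfty_mul.
by apply: L2_sum => // j; exact: Linfty_mul.
Qed.

Lemma op_pairingE v g phi gphi : L2 v -> (forall j, L2 (g j)) ->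
  L2 phi -> (forall j, L2 (gphi j)) ->
  op_pairing Omega L v g phi gphi =
    \sum_i L2dot (flux v g i) (gphi i) + L2dot (drift v g) phi.
Proof.
move=> v2 g2 p2 gp2.
have iF i : mu.-integrable Omega (EFin \o (fun x => flux v g i x * gphi i x)).
  by apply: L2_mul_integrable => //; exact: flux_L2.
have [I E] := Rintegral_sum mO iF.
rewrite /op_pairing RintegralD ?E//.
by apply: L2_mul_integrable => //; exact: drift_L2.
Qed.

Lemma op_pairingB v g w h phi gphi : L2 v -> (forall j, L2 (g j)) ->
  L2 w -> (forall j, L2 (h j)) -> L2 phi -> (forall j, L2 (gphi j)) ->
  op_pairing Omega L (v \- w) (fun i => g i \- h i) phi gphi =
  op_pairing Omega L v g phi gphi - op_pairing Omega L w h phi gphi.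
Proof.
move=> v2 g2 w2 h2 p2 gp2.
rewrite !op_pairingE//; [|exact: L2B|by move=> j; exact: L2B].
have -> : drift (v \- w) (fun i => g i \- h i) = (fun x => drift v g x - drift w h x).
  apply/funext => x; rewrite /drift /= (eq_bigr (fun i => op_c L i x * g i x - op_c L i x * h i x)).
    by rewrite sumrB; ring.
  by move=> i _; rewrite mulrBr.
have fE i : flux (v \- w) (fun i => g i \- h i) i = (fun x => flux v g i x - flux w h i x).
  apply/funext => x; rewrite /flux /= (eq_bigr (fun j => op_a L i j x * g j x - op_a L i j x * h j x)).
    by rewrite sumrB; ring.
  by move=> j _; rewrite mulrBr.
rewrite L2dotBl//; [|exact: drift_L2|exact: drift_L2].
rewrite (eq_bigr (fun i => L2dot (flux v g i) (gphi i) - L2dot (flux w h i) (gphi i))).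
  by rewrite sumrB; ring.
by move=> i _; rewrite fE L2dotBl//; exact: flux_L2.
Qed.

(** [flux] and [drift] are in L_2, so for fixed v every term is continuous in the second argument
    with respect to the H^1 norm, in which test functions approach v. *)
Lemma weak_form_dense v g W r : H10_grad Omega v g -> L2 W -> L2 r ->
  (forall phi, test_function phi ->
    L2dot W phi + op_pairing Omega L v g phi (fun i => partial i phi) = L2dot r phi) ->
  L2dot W v + op_pairing Omega L v g v g = L2dot r v.
Proof.
move=> [v2 g2 _ [phi [tphi phiv phig]]] W2 r2 H.
have T n := (test_function_L2 oO bO (tphi n)).1; have S n := (test_function_L2 oO bO (tphi n)).2.
have c1 := L2dot_cvg oO r2 T v2 phiv.
have c2 : L2dot W (phi n) + op_pairing Omega L v g (phi n) (fun i => partial i (phi n)) @[n --> \oo] -->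
    L2dot W v + op_pairing Omega L v g v g.
  apply: cvgD; first exact: L2dot_cvg.
  rewrite op_pairingE//.
  rewrite (_ : (fun n => _) = (fun n => \sum_i L2dot (flux v g i) (partial i (phi n)) +
    L2dot (drift v g) (phi n))); last by apply/funext => n; rewrite op_pairingE.
  apply: cvgD; last by apply: L2dot_cvg => //; exact: drift_L2.
  apply: cvg_big; first exact: add_continuous.
  by move=> i _; apply: L2dot_cvg => //; exact: flux_L2.
rewrite (_ : (fun n => _) = (fun n => L2dot r (phi n))) in c2; last by apply/funext => n; exact: H.
exact: (cvg_unique _ c2 c1).
Qed.

End operator.

(** * Time integrals and the energy inequality *)

Section bochner.
Context {R : realType} {d : nat} (Omega : set 'rV[R]_d).
Hypotheses (oO : open Omega) (bO : bounded_set Omega).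
Local Notation mu := (@lebesgue_measure R).
Local Notation L2 := (L2 Omega).
Local Notation L2norm := (L2norm Omega).
Local Notation L2dot := (L2dot Omega).

Let mO : measurable Omega. Proof. exact: open_measurable_rV. Qed.

Lemma integrable_indicM (D A : set R) (c : R) :
  measurable (D : set (measurableTypeR R)) -> measurable (A : set (measurableTypeR R)) ->
  A `<=` D -> (mu A < +oo)%E ->
  mu.-integrable D (EFin \o (fun s => \1_A s * c)) /\
  \int[mu]_(s in D) (\1_A s * c) = fine (mu A) * c.
Proof.
move=> mD mA AD Aoo.
have iA : mu.-integrable D (EFin \o (\1_A : R -> R)).
  apply/integrableP; split; first by apply/measurable_EFinP; exact: measurable_indic.
  rewrite (_ : (\int[mu]_(x in D) _)%E = mu A)//.
  rewrite -[X in _ = mu X](setIidl AD) -integral_indic//.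
  by apply: eq_integral => x _; rewrite /= ger0_norm.
split.
  rewrite (_ : EFin \o _ = (fun x => (EFin \o (\1_A : R -> R)) x * c%:E)%E)//.
  exact: integrableZr.
by rewrite RintegralZr// /Rintegral /= integral_indic// (setIidl AD).
Qed.

(** For the simple functions S n the identity is finite linearity. Cauchy-Schwarz bounds the
    remainder by the norm of v times the L_1 distance of S n to F, which tends to 0. *)
Lemma L2dot_bochner (D : set R) (F : R -> 'rV[R]_d -> R) B v :
  measurable (D : set (measurableTypeR R)) -> bochner_integral Omega D F B -> L2 v ->
  measurable_fun D (fun s => L2dot (F s) v) ->
  mu.-integrable D (EFin \o (fun s => L2dot (F s) v)) /\
  L2dot B v = \int[mu]_(s in D) L2dot (F s) v.
Proof.
move=> mD [F2 B2 [k [A [g]]]] /=.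
set S := fun n s x => \sum_(i < k n) \1_(A n i) s * g n i x.
set IS := fun n x => \sum_(i < k n) fine (mu (A n i)) * g n i x => -[Ag mN cN cB] v2 mFv.
have mA n i : measurable (A n i) by case: (Ag n i).
have g2 n i : L2 (g n i) by case: (Ag n i).
have S2 n s : L2 (S n s) by apply: L2_sum => // i; exact: L2Z.
have IS2 n : L2 (IS n) by apply: L2_sum => // i; exact: L2Z.
pose q n s := \sum_(i < k n) \1_(A n i) s * L2dot (g n i) v.
have qE n s : L2dot (S n s) v = q n s.
  rewrite L2dot_suml//; last by move=> i; exact: L2Z.
  by apply: eq_bigr => i _; rewrite L2dotZl.
have [iq Iq] : (forall n, mu.-integrable D (EFin \o q n)) /\
    forall n, \int[mu]_(s in D) q n s = L2dot (IS n) v.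
  have iqi n (i : 'I_(k n)) : mu.-integrable D (EFin \o (fun s => \1_(A n i) s * L2dot (g n i) v)) /\
      \int[mu]_(s in D) (\1_(A n i) s * L2dot (g n i) v) = fine (mu (A n i)) * L2dot (g n i) v.
    by case: (Ag n i) => ? ? ? _; exact: integrable_indicM.
  split=> n; have [Q1 Q2] := Rintegral_sum mD (fun i => (iqi n i).1) => //.
  rewrite Q2 L2dot_suml//; last by move=> i; exact: L2Z.
  by apply: eq_bigr => i _; rewrite L2dotZl// (iqi n i).2.
pose N n s := L2norm (F s \- S n s).
have diff n s : D s -> `|L2dot (F s) v - q n s| <= L2norm v * N n s.
  move=> Ds; rewrite -qE -(L2dotBl mO (F2 s Ds) (S2 n s) v2) mulrC.
  exact: (cauchy_schwarz mO (L2B (F2 s Ds) (S2 n s)) v2).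
have N0 n s : 0 <= N n s by exact: L2norm_ge0.
have v0 : 0 <= L2norm v by exact: L2norm_ge0.
move/fine_cvgP : cN => [finN cN].
have iN : \forall n \near \oo, mu.-integrable D (EFin \o N n).
  apply: filterS finN => n fN; apply/integrableP; split; first by apply/measurable_EFinP; exact: (mN n).
  have fN' : (\int[mu]_(s in D) (N n s)%:E)%E \is a fin_num := fN.
  rewrite (_ : (\int[mu]_(x in D) _)%E = (\int[mu]_(s in D) (N n s)%:E)%E).
    by rewrite ltey_eq fN'.
  by apply: eq_integral => s _; rewrite /= ger0_norm.
have ivN : \forall n \near \oo, mu.-integrable D (EFin \o (fun s => L2norm v * N n s)).
  apply: filterS iN => n iN.
  rewrite (_ : EFin \o _ = (fun s => (L2norm v)%:E * (EFin \o N n) s)%E)//.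
  exact: integrableZl.
(* One index n with a finite L_1 error suffices: the integrand is then dominated by |q n| plus that
   error. *)
have iF : mu.-integrable D (EFin \o (fun s => L2dot (F s) v)).
  have [n _ /(_ n (leqnn n)) ivn] := ivN.
  have iqn := integrableD mD (integrable_abse (iq n)) ivn.
  apply: (le_integrable mD _ _ iqn); first exact/measurable_EFinP.
  move=> s Ds; change ((`|L2dot (F s) v| : R)%:E <= (`| `|q n s| + L2norm v * N n s|%R : R)%:E)%E.
  rewrite lee_fin [X in _ <= X]ger0_norm; last by rewrite addr_ge0// mulr_ge0.
  by rewrite -lerBlDl (le_trans _ (diff n s Ds))// lerB_dist.
split=> //.
have c1 : L2dot (IS n) v @[n --> \oo] --> L2dot B v.
  under eq_fun do rewrite L2dotC; rewrite (L2dotC _ B).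
  apply: L2dot_cvg => //.
  by rewrite (_ : (fun n => _) = (fun n => L2norm (B \- IS n)))//; apply/funext => n; rewrite [LHS]L2normBC.
have c2 : L2dot (IS n) v @[n --> \oo] --> \int[mu]_(s in D) L2dot (F s) v.
  apply/subr_cvg0.
  apply: (@squeeze_cvgr _ _ _ _ (fun n => - (L2norm v * fine (\int[mu]_(s in D) (N n s)%:E)%E))
     (fun n => L2norm v * fine (\int[mu]_(s in D) (N n s)%:E)%E)).
  - near=> n; rewrite -ler_norml.
    have iNn : mu.-integrable D (EFin \o N n) by near: n.
    have ivNn : mu.-integrable D (EFin \o (fun s => L2norm v * N n s)) by near: n.
    have iFq : mu.-integrable D (EFin \o (fun s => L2dot (F s) v - q n s)).
      rewrite (_ : EFin \o _ = ((EFin \o (fun s => L2dot (F s) v)) \- (EFin \o q n))%E)//.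
      exact: integrableB.
    rewrite -Iq distrC -RintegralB//.
    apply: (le_trans (le_normr_Rintegral mD iFq)).
    rewrite -[X in _ * X]/(\int[mu]_(s in D) N n s) -RintegralZl//.
    apply: le_Rintegral => //; last by move=> s Ds; exact: diff.
    exact: (integrable_abse iFq).
  - rewrite -oppr0; apply: cvgN; rewrite -(mulr0 (L2norm v)); apply: cvgM => //; exact: cvg_cst.
  - rewrite -(mulr0 (L2norm v)); apply: cvgM => //; exact: cvg_cst.
exact: (cvg_unique _ c1 c2).
Unshelve. all: by end_near. Qed.

Lemma locally_lipschitz_measurable (z : R -> R) (t : R) :
  (forall eps, 0 < eps < t -> exists K, forall s1 s2, eps <= s1 <= t -> eps <= s2 <= t ->
     `|z s1 - z s2| <= K * `|s1 - s2|) -> measurable_fun (`]0, t[ : set R) z.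
Proof.
move=> zL; apply: open_continuous_measurable_fun; first exact: interval_open.
move=> x; rewrite inE/= in_itv/= => /andP[x0 xt].
have [K KP] : exists K, forall s1 s2, x / 2 <= s1 <= t -> x / 2 <= s2 <= t ->
     `|z s1 - z s2| <= K * `|s1 - s2| by apply: zL; lra.
have K1 : 0 < `|K| + 1 by rewrite ltr_wpDl.
apply/cvgrPdist_lt => e e0; near=> w.
have w1 : x / 2 < w by near: w; apply: lt_nbhsr; lra.
have w2 : w < t by near: w; exact: lt_nbhsl.
apply: (@le_lt_trans _ _ (K * `|x - w|)).
  by apply: KP; lra.
apply: (@le_lt_trans _ _ ((`|K| + 1) * `|x - w|)).
  by rewrite ler_wpM2r// (le_trans (ler_norm K))// lerDl.
rewrite -ltr_pdivlMl//; near: w; exists ((`|K| + 1)^-1 * e) => //=.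
by rewrite mulr_gt0// invr_gt0.
Unshelve. all: by end_near. Qed.

(** The pairing moves under the memory integral; the measurability of the scalar integrand comes
    from the local Lipschitz bound in time. *)
Lemma caputo_L2dot (al T : R) v t B phi : time_regular Omega T v -> 0 < t <= T ->
  bochner_integral Omega `]0, t[
      (fun s x => al * (t - s) `^ (- al - 1) * (v t x - v s x)) B -> L2 phi ->
  mu.-integrable `]0, t[ (EFin \o (fun s => al * (t - s) `^ (- al - 1) * L2dot (v t \- v s) phi)) /\
  L2dot B phi = \int[mu]_(s in `]0, t[) (al * (t - s) `^ (- al - 1) * L2dot (v t \- v s) phi).
Proof.
move=> [_ reg] tT bB phi2.
have [vt2 _ lip] := reg t tT.
have v2 s : `]0, t[%classic s -> L2 (v s).
  rewrite /= in_itv/= => /andP[s0 st].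
  by case: (reg s) => //; rewrite s0 (le_trans (ltW st))//; case/andP : tT.
have E s : `]0, t[%classic s -> L2dot (fun x => al * (t - s) `^ (- al - 1) * (v t x - v s x)) phi =
    al * (t - s) `^ (- al - 1) * L2dot (v t \- v s) phi.
  by move=> st; rewrite L2dotZl//; apply: L2B => //; exact: v2.
have mD : measurable_fun (`]0, t[ : set R) (fun s => L2dot (v t \- v s) phi).
  apply: locally_lipschitz_measurable => eps epst.
  have v2' s : eps <= s <= t -> L2 (v s).
    move=> st; case: (reg s) => //; case/andP : epst => e0 _; case/andP : tT => _ tT.
    by case/andP : st => es st; rewrite (lt_le_trans e0 es) (le_trans st tT).
  have [K KP] := lip eps epst; exists (K * L2norm phi) => s1 s2 h1 h2.
  have a1 := v2' s1 h1; have a2 := v2' s2 h2.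
  rewrite !L2dotBl// opprB addrC addrA subrK -L2dotBl// mulrAC.
  apply: (le_trans (cauchy_schwarz mO (L2B a2 a1) phi2)); rewrite ler_wpM2r ?L2norm_ge0//.
  by rewrite distrC; exact: KP.
have mE : measurable_fun (`]0, t[ : set R) (fun s => al * (t - s) `^ (- al - 1) * L2dot (v t \- v s) phi).
  apply: measurable_funM => //; apply: measurable_funTS; apply: measurable_funM => //.
  by apply: (measurableT_comp (measurable_powR _)); exact: measurable_funB.
have := L2dot_bochner (measurable_itv _) bB phi2.
have -> : \int[mu]_(s in `]0, t[) L2dot (fun x => al * (t - s) `^ (- al - 1) * (v t x - v s x)) phi =
  \int[mu]_(s in `]0, t[) (al * (t - s) `^ (- al - 1) * L2dot (v t \- v s) phi).
  by apply: eq_Rintegral => s; rewrite inE => /E.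
case=> [|iB EB].
  by apply: eq_measurable_fun mE => s; rewrite inE => /E.
split=> //; apply: eq_integrable iB => // s; rewrite inE => /E h.
by rewrite /= h.
Qed.

End bochner.

(** * The cut-off energy inequality for a scalar function *)

Section energy.
Context {R : realType} (al la : R).
Hypotheses (al0 : 0 < al) (al1 : al < 1).
Local Notation mu := (@lebesgue_measure R).
Local Notation G1 := (Gamma (1 - al)).

Let al1' : 0 < 1 - al. Proof. by rewrite subr_gt0. Qed.
Let G10 : 0 < G1. Proof. exact: Gamma_gt0. Qed.

Lemma integrable_bounded (D : set R) (f : R -> R) (C : R) :
  measurable (D : set (measurableTypeR R)) -> (mu D < +oo)%E -> measurable_fun D f ->
  (forall x, D x -> `|f x| <= C) -> mu.-integrable D (EFin \o f).
Proof.
move=> mD Doo mf fC.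
apply/integrableP; split; first exact/measurable_EFinP.
apply: (@le_lt_trans _ _ (\int[mu]_(x in D) (`|C|)%:E)%E).
  apply: ge0_le_integral => //.
  - by apply: measurableT_comp => //; exact/measurable_EFinP.
  - by move=> x Dx; rewrite /= lee_fin (le_trans (fC x Dx))// ler_norm.
by rewrite integral_cst// lte_mul_pinfty.
Qed.

Lemma recent_integral (c s : R) : c < s ->
  (\int[mu]_(x in `[c, s[) ((s - x) `^ (- al))%:E = ((s - c) `^ (1 - al) / (1 - al))%:E)%E.
Proof.
move=> cs; have sc : 0 < s - c by rewrite subr_gt0.
have mf : measurable_fun setT (fun x : R => ((s - x) `^ (- al))%:E).
  apply/measurable_EFinP.
  by apply: (measurableT_comp (measurable_powR _)); exact: measurable_funB.
rewrite -(integral_itv_obnd_cbnd (measurable_funTS mf)).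
rewrite -(integral_pw al1' sc).
rewrite [RHS]integral_mkcond -(ge0_integral_reflect s); last 2 first.
- apply/(measurable_restrictT (fun t : R => (pw (1 - al) t)%:E)) => //.
  by apply/measurable_EFinP; apply: measurable_funTS; exact: measurable_pw.
- by move=> x; rewrite patchE; case: ifP => // _; rewrite lee_fin pw_ge0.
rewrite [LHS]integral_mkcond; apply: eq_integral => x _.
rewrite !patchE !mem_setE !in_itv/= subr_gt0 ltrD2l ltrN2 andbC.
case: ifP => // /andP[xs _]; rewrite pwE ?subr_gt0//.
by rewrite (_ : 1 - al - 1 = - al)//; ring.
Qed.

(** I1 and I2 are the memory integrals before and after the cut, and g is 1 / [G1]. In the sum the
    contributions of [sa] cancel, leaving [sca]; then one divides by y, the case y = 0 being
    immediate. *)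
Lemma energy_arith (r L y g sa sca sc1 I1 I2 Q : R) :
  0 <= r -> 0 <= L -> 0 <= y -> 0 < g -> 0 <= sc1 -> 0 <= Q ->
  y ^+ 2 * (sca - sa) - y * Q <= I1 ->
  - (y * L * al) * (sc1 / (1 - al)) <= I2 ->
  g * (sa * y ^+ 2 + (I1 + I2)) + la * y ^+ 2 <= r * y ->
  (sca * g + Num.max la 0) * y <=
  r + L * (al / (1 - al)) * sc1 * g + Num.max (- la) 0 * y + g * Q.
Proof.
move=> r0 L0 y0 g0 sc10 Q0 B1 B2 weak.
have laE : la = Num.max la 0 - Num.max (- la) 0.
  by have [l0|l0] := leP la 0; have [l1|l1] := leP (- la) 0; lra.
have lm0 : 0 <= Num.max (- la) 0 by rewrite le_max lexx orbT.
move: laE lm0; move: (Num.max la 0) (Num.max (- la) 0) => lp lm laE lm0.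
have b0 : 0 < (1 - al)^-1 by rewrite invr_gt0.
have [ys0|ys0] := eqVneq y 0.
  by rewrite ys0 !mulr0 addr0 !addr_ge0// ?mulr_ge0// ?(ltW g0) ?(ltW al0) ?(ltW b0).
have ysp : 0 < y by rewrite lt_neqAle eq_sym ys0 y0.
rewrite -(ler_pM2r ysp); rewrite laE in weak.
have W : g * (sa * y ^+ 2 + (y ^+ 2 * (sca - sa) - y * Q + (- (y * L * al) * (sc1 / (1 - al))))) +
   (lp - lm) * y ^+ 2 <= r * y.
  by apply: le_trans weak; rewrite lerD2r ler_wpM2l ?(ltW g0)// lerD2l lerD.
move: W; rewrite expr2; set b := (1 - al)^-1 => W.
have E1 : (sca * g + lp) * y * y =
    g * (sa * (y * y) + (y * y * (sca - sa) - y * Q + (- (y * L * al) * (sc1 * b)))) +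
    (lp - lm) * (y * y) + (g * Q + L * (al * b) * sc1 * g + lm * y) * y by ring.
have E2 : (r + L * (al * b) * sc1 * g + lm * y + g * Q) * y =
    r * y + (g * Q + L * (al * b) * sc1 * g + lm * y) * y by ring.
by rewrite E1 E2 lerD2r.
Qed.

(** [p x] stands for <e(s) - e(x), e(s)>. Over ]0, c[ the kernel integrates to (s - c)^(- al) - s^(-
    al), whose second term cancels the boundary term of the Caputo derivative. Over [c, s[ the
    factor s - x of the Lipschitz bound lowers the singularity to the integrable (s - x)^(- al). *)
Lemma energy_of_weak_form (y p : R -> R) (r M L c s : R) :
  0 <= r -> 0 <= M -> 0 <= L -> 0 < c -> c < s ->
  (forall x, 0 <= y x) -> (forall x, 0 < x < s -> y x <= M) ->
  measurable_fun (`]0, s[ : set R) y ->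
  (forall x, 0 < x < s -> y s * (y s - y x) <= p x) ->
  (forall x, c <= x < s -> - (y s * (L * (s - x))) <= p x) ->
  mu.-integrable `]0, s[ (EFin \o (fun x => al * (s - x) `^ (- al - 1) * p x)) ->
  G1^-1 * (s `^ (- al) * y s ^+ 2 + \int[mu]_(x in `]0, s[) (al * (s - x) `^ (- al - 1) * p x))
    + la * y s ^+ 2 <= r * y s ->
  ((((s - c) `^ (- al) / G1 + Num.max la 0) * y s)%:E <=
     (r + L * (al / (1 - al)) * (s - c) `^ (1 - al) / G1 + Num.max (- la) 0 * y s)%:E +
     (G1^-1)%:E * \int[mu]_(x in `]0%R, c[) (al * (s - x) `^ (- al - 1) * y x)%:E)%E.
Proof.
move=> r0 M0 L0 c0 cs y0 yM my p1 p2 ip weak; have s0 := lt_trans c0 cs.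
have sc0 : 0 < s - c by rewrite subr_gt0.
have G1V : 0 < G1^-1 by rewrite invr_gt0.
pose k x := al * (s - x) `^ (- al - 1).
have k0 x : 0 <= k x by rewrite /k mulr_ge0 ?powR_ge0// ltW.
have mk : measurable_fun setT k.
  apply: measurable_funM => //.
  by apply: (measurableT_comp (measurable_powR _)); exact: measurable_funB.
have m1 : measurable (`]0, c[%classic : set (measurableTypeR R)) by exact: measurable_itv.
have m2 : measurable (`[c, s[%classic : set (measurableTypeR R)) by exact: measurable_itv.
have f1 : (mu (`]0%R, c[%classic : set R) < +oo)%E.
  by rewrite lebesgue_measure_itv/=; case: ifP => // _; rewrite -EFinB ltry.
have DU : `]0, s[%classic = `]0, c[%classic `|` `[c, s[%classic :> set R.
  apply/seteqP; split => x /=; rewrite !in_itv/=.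
    by move=> /andP[x0 xs]; have [xc|cx] := ltP x c; [left|right]; rewrite ?x0 ?cx.
  by move=> [/andP[x0 xc]|/andP[cx xs]]; [rewrite x0 (lt_trans xc)|rewrite xs (lt_le_trans c0)].
have S1 : (`]0, c[%classic : set R) `<=` `]0, s[%classic by rewrite DU; left.
have S2 : (`[c, s[%classic : set R) `<=` `]0, s[%classic by rewrite DU; right.
have my1 : measurable_fun (`]0, c[ : set R) y.
  by apply: measurable_funS my => //; exact: measurable_itv.
have kC x : `]0, c[%classic x -> k x <= al * (s - c) `^ (- al - 1).
  rewrite /= in_itv/= => /andP[x0 xc]; rewrite ler_wpM2l ?(ltW al0)//.
  rewrite -opprD !powRN lef_pV2 ?posrE ?powR_gt0//; last by rewrite subr_gt0 (lt_trans xc).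
  apply: ge0_ler_powR; first by rewrite addr_ge0// ltW.
  - by rewrite nnegrE ltW.
  - by rewrite nnegrE subr_ge0 ltW// (lt_trans xc).
  - by rewrite lerD2l lerN2 ltW.
have kC0 : 0 <= al * (s - c) `^ (- al - 1) by rewrite mulr_ge0 ?powR_ge0// ltW.
have yM1 x : `]0, c[%classic x -> y x <= M.
  by move=> /S1; rewrite /= in_itv/= => /yM.
have ik : mu.-integrable `]0, c[ (EFin \o k).
  apply: (integrable_bounded m1 f1 (measurable_funTS mk)) => x cx.
  by rewrite ger0_norm//; exact: kC.
have iky : mu.-integrable `]0, c[ (EFin \o (fun x => k x * y x)).
  apply: (integrable_bounded (C := al * (s - c) `^ (- al - 1) * M) m1 f1) => [|x cx].
    by apply: measurable_funM => //; exact: measurable_funTS.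
  by rewrite ger0_norm; [apply: ler_pM => //; [exact: kC|exact: yM1]|exact: mulr_ge0].
have ip1 : mu.-integrable `]0, c[ (EFin \o (fun x => k x * p x)).
  by apply: integrableS ip => //; exact: measurable_itv.
have ip2 : mu.-integrable `[c, s[ (EFin \o (fun x => k x * p x)).
  by apply: integrableS ip => //; exact: measurable_itv.
have Ik : \int[mu]_(x in `]0, c[) k x = (s - c) `^ (- al) - s `^ (- al).
  rewrite /Rintegral.
  rewrite (_ : (\int[mu]_(x in `]0%R, c[) (k x)%:E)%E = ((s - c) `^ (- al) - s `^ (- al))%:E)//.
  rewrite -(hist_integral al0 c0 cs) integral_itv_bndo_bndc//.
  by apply/measurable_EFinP; exact: measurable_funTS.
have iy1 : mu.-integrable `]0, c[ (EFin \o (fun x => y s ^+ 2 * k x)).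
  rewrite (_ : EFin \o _ = (fun x => (y s ^+ 2)%:E * (EFin \o k) x)%E)//.
  exact: integrableZl.
have iy2 : mu.-integrable `]0, c[ (EFin \o (fun x => y s * (k x * y x))).
  rewrite (_ : EFin \o _ = (fun x => (y s)%:E * (EFin \o (fun x => k x * y x)%R) x)%E)//.
  exact: integrableZl.
set Q := \int[mu]_(x in `]0, c[) (k x * y x).
have B1 : y s ^+ 2 * ((s - c) `^ (- al) - s `^ (- al)) - y s * Q <=
    \int[mu]_(x in `]0, c[) (k x * p x).
  rewrite -Ik -RintegralZl// -RintegralZl// -RintegralB//.
  apply: le_Rintegral => //.
    rewrite (_ : EFin \o _ = ((EFin \o (fun x => y s ^+ 2 * k x)%R) \- (EFin \o (fun x => y s * (k x * y x))%R))%E)//.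
    exact: integrableB.
  move=> x cx; rewrite (_ : _ - _ = k x * (y s * (y s - y x))); last by ring.
  by rewrite ler_wpM2l//; apply: p1; move: (S1 _ cx); rewrite /= in_itv.
pose q x := (s - x) `^ (- al).
have Iq : (\int[mu]_(x in `[c, s[) (q x)%:E = ((s - c) `^ (1 - al) / (1 - al))%:E)%E.
  exact: recent_integral.
have mq : measurable_fun setT q.
  by apply: (measurableT_comp (measurable_powR _)); exact: measurable_funB.
have iq : mu.-integrable `[c, s[ (EFin \o q).
  apply/integrableP; split; first by apply/measurable_EFinP; exact: measurable_funTS.
  rewrite (_ : (\int[mu]_(x in `[c, s[) _)%E = (\int[mu]_(x in `[c, s[) (q x)%:E)%E).
    by rewrite Iq ltry.
  by apply: eq_integral => x _; rewrite /= ger0_norm ?powR_ge0.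
have B2 : - (y s * L * al) * ((s - c) `^ (1 - al) / (1 - al)) <= \int[mu]_(x in `[c, s[) (k x * p x).
  rewrite -[_ / (1 - al)]/(fine ((s - c) `^ (1 - al) / (1 - al))%:E) -Iq.
  rewrite -[fine _]/(\int[mu]_(x in `[c, s[) q x) -RintegralZl//.
  apply: le_Rintegral => //.
    rewrite (_ : EFin \o _ = (fun x => (- (y s * L * al))%:E * (EFin \o q) x)%E)//.
    exact: integrableZl.
  move=> x; rewrite /= in_itv/= => cx; have xs0 : 0 < s - x by case/andP: cx; rewrite subr_gt0.
  have -> : q x = (s - x) `^ (- al - 1) * (s - x).
    rewrite /q -[X in _ = _ * X](powRr1 (ltW xs0)) -powRD ?subrK//.
    by rewrite (gt_eqF xs0) implybT.
  rewrite (_ : _ * _ = k x * (- (y s * (L * (s - x))))); last by rewrite /k; ring.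
  by rewrite ler_wpM2l//; exact: p2.
have II : \int[mu]_(x in `]0, s[) (k x * p x) =
    \int[mu]_(x in `]0, c[) (k x * p x) + \int[mu]_(x in `[c, s[) (k x * p x).
  rewrite DU Rintegral_setU//; first by rewrite -DU.
  apply/disj_setPS => x [/=]; rewrite !in_itv/= => /andP[_ xc] /andP[cx _].
  by move: xc; rewrite ltNge cx.
have Q0 : 0 <= Q by apply: Rintegral_ge0 => x _; rewrite mulr_ge0.
have -> : (\int[mu]_(x in `]0%R, c[) (al * (s - x) `^ (- al - 1) * y x)%:E)%E = Q%:E.
  rewrite /Q /Rintegral fineK//.
  exact: (integrable_fin_num m1 iky).
move: weak; rewrite II.
move: (\int[mu]_(x in `]0, c[) (k x * p x)) (\int[mu]_(x in `[c, s[) (k x * p x)) Q Q0 B1 B2.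
move=> I1 I2 Q1; rewrite -EFinM -EFinD lee_fin; move: I1 I2 Q1.
move: (s `^ (- al)) ((s - c) `^ (- al)) ((s - c) `^ (1 - al)) (powR_ge0 (s - c) (1 - al)) => sa sca sc1 sc10 I1 I2 Q Q0 B1 B2 weak.
exact: (energy_arith r0 L0 (y0 s) G1V sc10 Q0 B1 B2 weak).
Qed.

End energy.

(** * The error u_h - u: weak equation, time regularity and energy inequality *)

Section error.
Context {R : realType} (alpha T : R) {d : nat} (Omega : set 'rV[R]_d)
  (L : second_order_operator R d) (lambda : R)
  (f : R -> 'rV[R]_d -> R) (u uh Rh : R -> 'rV[R]_d -> R).
Hypotheses (al0 : 0 < alpha) (al1 : alpha < 1).
Hypotheses (oO : open Omega) (bO : bounded_set Omega) (hL : elliptic Omega L).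
Hypothesis hlambda : forall v g, H10_grad Omega v g ->
  lambda * L2norm Omega v ^+ 2 <= op_pairing Omega L v g v g.
Hypothesis hf : forall t, 0 < t <= T -> L1loc Omega (f t).
Hypotheses (ureg : time_regular Omega T u) (uhreg : time_regular Omega T uh).
Hypothesis init : uh 0 = u 0 %[ae lebesgue_rV R d in Omega].
Hypothesis hRh_L2 : forall t, 0 < t <= T -> L2 Omega (Rh t).
Hypothesis hu : forall t, 0 < t <= T -> evolution_eq Omega alpha L u t (f t).
Hypothesis huh : forall t, 0 < t <= T -> evolution_eq Omega alpha L uh t (f t \+ Rh t).

Local Notation mu := (lebesgue_rV R d).
Local Notation L2 := (L2 Omega).
Local Notation L2norm := (L2norm Omega).
Local Notation L2dot := (L2dot Omega).
Local Notation G1 := (Gamma (1 - alpha)).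

Let mO : measurable Omega. Proof. exact: open_measurable_rV. Qed.

(** As the initial value is only locally integrable, the terms of the derivative can be separated
    under the pairing with a test function, but not with a general L_2 function. *)
Lemma caputo_test v t B phi : L1loc Omega (v 0) -> L2 (v t) -> L2 B -> test_function Omega phi ->
  L2dot (fun x => G1^-1 * (t `^ (- alpha) * (v t x - v 0 x) + B x)) phi =
  G1^-1 * (t `^ (- alpha) * (L2dot (v t) phi - L2dot (v 0) phi) + L2dot B phi).
Proof.
move=> v0 vt B2 tphi; have [phi2 _] := test_function_L2 oO bO tphi.
have i1 := L2_mul_integrable mO vt phi2; have i2 := L1loc_mul_test oO v0 tphi.
have i3 := L2_mul_integrable mO B2 phi2.
have i12 : mu.-integrable Omega (EFin \o (fun x => v t x * phi x - v 0 x * phi x)).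
  rewrite (_ : EFin \o _ = ((EFin \o (fun x => v t x * phi x)%R) \- (EFin \o (fun x => v 0 x * phi x)%R))%E)//.
  exact: integrableB.
have i4 : mu.-integrable Omega (EFin \o (fun x => t `^ (- alpha) * (v t x * phi x - v 0 x * phi x))).
  rewrite (_ : EFin \o _ = (fun x => (t `^ (- alpha))%:E * (EFin \o (fun x => v t x * phi x - v 0 x * phi x)%R) x)%E)//.
  exact: integrableZl.
have i5 : mu.-integrable Omega (EFin \o (fun x => t `^ (- alpha) * (v t x * phi x - v 0 x * phi x) + B x * phi x)).
  rewrite (_ : EFin \o _ = ((EFin \o (fun x => t `^ (- alpha) * (v t x * phi x - v 0 x * phi x))%R) \+ (EFin \o (fun x => B x * phi x)%R))%E)//.
  exact: integrableD.
rewrite /Defs.L2dot -RintegralB// -RintegralZl// -RintegralD// -RintegralZl//.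
by apply: eq_Rintegral => x _; ring.
Qed.

Let e s := uh s \- u s.
Let y s := L2norm (e s).

Let u2 s : 0 < s <= T -> L2 (u s). Proof. by case: ureg => _ h /h[]. Qed.
Let uh2 s : 0 < s <= T -> L2 (uh s). Proof. by case: uhreg => _ h /h[]. Qed.
Let e2 s : 0 < s <= T -> L2 (e s). Proof. by move=> sT; apply: L2B; [exact: uh2|exact: u2]. Qed.

Lemma init_test phi : test_function Omega phi -> L2dot (uh 0) phi = L2dot (u 0) phi.
Proof.
move=> tphi; congr fine.
have /integrableP[i1 _] := L1loc_mul_test oO ureg.1 tphi.
have /integrableP[i2 _] := L1loc_mul_test oO uhreg.1 tphi.
apply: ae_eq_integral => //.
by apply: filterS init => x h /h ->.
Qed.

Lemma error_weak t : 0 < t <= T ->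
  lebesgue_measure.-integrable `]0, t[
    (EFin \o (fun s => alpha * (t - s) `^ (- alpha - 1) * L2dot (e t \- e s) (e t))) /\
  G1^-1 * (t `^ (- alpha) * y t ^+ 2 +
    \int[lebesgue_measure]_(s in `]0, t[) (alpha * (t - s) `^ (- alpha - 1) * L2dot (e t \- e s) (e t)))
    + lambda * y t ^+ 2 <= L2norm (Rh t) * y t.
Proof.
move=> tT; have [gu [wu [Hu [Bu bu wuE] Eu]]] := hu tT.
have [gh [wh [Hh [Bh bh whE] Eh]]] := huh tT.
have [gu2 gh2] : (forall i, L2 (gu i)) /\ (forall i, L2 (gh i)) by case: Hu; case: Hh.
have [Bu2 Bh2] : L2 Bu /\ L2 Bh by case: bu; case: bh.
have ut2 := u2 tT; have uht2 := uh2 tT; have et2 := e2 tT; have Rt2 := hRh_L2 tT.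
have H := H10_gradB oO bO Hh Hu.
(* The difference of the two Caputo derivatives with the common initial value left out. Unlike each
   derivative by itself, it is known to be in L_2, so the weak equation extends from test functions
   to e(t). *)
pose W x := G1^-1 * (t `^ (- alpha) * e t x + (Bh x - Bu x)).
have BB := L2B Bh2 Bu2.
have te2 : L2 (fun x => t `^ (- alpha) * e t x) by exact: L2Z.
have tB2 := L2D te2 BB.
have W2 : L2 W by apply: L2Z.
have Wdot phi : L2 phi -> L2dot W phi =
    G1^-1 * (t `^ (- alpha) * L2dot (e t) phi + (L2dot Bh phi - L2dot Bu phi)).
  move=> p2; rewrite (L2dotZl mO _ tB2 p2) (L2dotDl mO te2 BB p2) (L2dotZl mO _ et2 p2).
  by rewrite (L2dotBl mO Bh2 Bu2 p2).
have weak phi : test_function Omega phi -> L2dot W phi +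
    op_pairing Omega L (e t) (fun i => gh i \- gu i) phi (fun i => partial i phi) = L2dot (Rh t) phi.
  move=> tphi; have [p2 dp2] := test_function_L2 oO bO tphi.
  have := Eh _ tphi; have := Eu _ tphi.
  rewrite (op_pairingB oO hL uht2 gh2 ut2 gu2 p2 dp2) (Wdot _ p2) (L2dotBl mO uht2 ut2 p2).
  rewrite wuE whE (caputo_test ureg.1 ut2 Bu2 tphi) (caputo_test uhreg.1 uht2 Bh2 tphi) (init_test tphi).
  have -> : L2dot (f t \+ Rh t) phi = L2dot (f t) phi + L2dot (Rh t) phi.
    rewrite /Defs.L2dot -RintegralD//; last exact: L2_mul_integrable.
      by apply: eq_Rintegral => x _; rewrite mulrDl.
    by apply: (L1loc_mul_test oO) => //; exact: hf.
  by move=> E1 E2; apply: (addrI (L2dot (f t) phi)); rewrite -E2 -{1}E1; ring.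
have := weak_form_dense oO bO hL H W2 Rt2 weak.
have := hlambda H; rewrite -/(e t) -/(y t) (Wdot _ et2) -(L2norm_sqr et2) -/(y t).
have := L2dot_le mO Rt2 et2; rewrite -/(y t).
have [ih Ih] := caputo_L2dot oO uhreg tT bh et2.
have [iu Iu] := caputo_L2dot oO ureg tT bu et2.
have E s : `]0, t[%classic s -> alpha * (t - s) `^ (- alpha - 1) * L2dot (e t \- e s) (e t) =
    alpha * (t - s) `^ (- alpha - 1) * L2dot (uh t \- uh s) (e t) -
    alpha * (t - s) `^ (- alpha - 1) * L2dot (u t \- u s) (e t).
  rewrite /= in_itv/= => /andP[s0 st]; have sT : 0 < s <= T.
    by rewrite s0 (le_trans (ltW st))//; case/andP: tT.
  have := u2 sT; have := uh2 sT; have := e2 sT => es2 uhs2 us2.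
  rewrite (L2dotBl mO et2 es2 et2) (L2dotBl mO uht2 uhs2 et2) (L2dotBl mO ut2 us2 et2).
  rewrite (L2dotBl mO uhs2 us2 et2) (L2dotBl mO uht2 ut2 et2); ring.
have mt : measurable (`]0, t[%classic : set (measurableTypeR R)) by exact: measurable_itv.
have -> : L2dot Bh (e t) - L2dot Bu (e t) = \int[lebesgue_measure]_(s in `]0, t[)
    (alpha * (t - s) `^ (- alpha - 1) * L2dot (e t \- e s) (e t)).
  rewrite Ih Iu -(RintegralB mt ih iu); apply: eq_Rintegral => s /set_mem st.
  by rewrite (E s st).
move=> h1 h2 h3; split; last by rewrite -h3 in h1; apply: le_trans h1; rewrite lerD2l.
apply: eq_integrable (integrableB mt ih iu) => // s /set_mem st.
by rewrite /= (E s st).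
Qed.

Lemma error_lipschitz a : 0 < a -> exists2 K : R, 0 <= K &
  forall s1 s2, a <= s1 <= T -> a <= s2 <= T -> L2norm (e s1 \- e s2) <= K * `|s1 - s2|.
Proof.
move=> a0; have [aT|Ta] := ltP a T; last first.
  (* For T <= a the interval [a, T] has at most one point, so s1 = s2. *)
  exists 0 => // s1 s2 /andP[h1 h2] /andP[h3 h4]; rewrite mul0r.
  have -> : s1 = s2 by lra.
  suff -> : L2norm (e s2 \- e s2) = 0 by [].
  rewrite /Defs.L2norm (_ : EFin \o _ = cst 0%E) ?Lnorm0//.
  by apply/funext => x /=; rewrite patchE; case: ifP => // _; congr EFin; exact: subrr.
have T0 := lt_trans a0 aT.
have inT s : a <= s <= T -> 0 < s <= T by move=> /andP[h ->]; rewrite (lt_le_trans a0 h).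
have [_ /(_ T)[|_ _ /(_ a)[|K1 h1]]] := ureg; rewrite ?T0 ?lexx ?a0//.
have [_ /(_ T)[|_ _ /(_ a)[|K2 h2]]] := uhreg; rewrite ?T0 ?lexx ?a0//.
exists (`|K1| + `|K2|) => [|s1 s2 s1T s2T]; first by rewrite addr_ge0.
have := L2normD_le mO (L2B (uh2 (inT _ s1T)) (uh2 (inT _ s2T))) (L2B (u2 (inT _ s2T)) (u2 (inT _ s1T))).
rewrite (_ : (fun x => _) = e s1 \- e s2); last by apply/funext => x; rewrite /e /=; ring.
move=> /le_trans; apply; rewrite addrC mulrDl lerD//.
  rewrite distrC; apply: (le_trans (h1 _ _ s2T s1T)).
  by rewrite ler_wpM2r// ler_norm.
by apply: (le_trans (h2 _ _ s1T s2T)); rewrite ler_wpM2r// ler_norm.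
Qed.

Lemma error_bounded : 0 < T -> exists2 M : R, 0 <= M & forall s, 0 < s <= T -> y s <= M.
Proof.
move=> T0; have [_ /(_ T)[|_ [M1 h1] _]] := ureg; rewrite ?T0 ?lexx//.
have [_ /(_ T)[|_ [M2 h2] _]] := uhreg; rewrite ?T0 ?lexx//.
(* The regularity hypothesis at time T bounds the norms for s < T only; the value at T is added by
   hand. *)
exists (`|M1| + `|M2| + y T) => [|s /andP[s0]]; first by rewrite !addr_ge0// L2norm_ge0.
have yT0 : 0 <= y T by exact: L2norm_ge0.
rewrite le_eqVlt => /predU1P[->|sT]; first by rewrite lerDr addr_ge0.
have s_in : 0 < s <= T by rewrite s0 ltW.
have N1 := h1 s; have N2 := h2 s; rewrite s0 sT in N1 N2.
have := N1 isT; have := N2 isT; have := ler_norm M1; have := ler_norm M2.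

have : y s <= L2norm (uh s) + L2norm (u s).
  have := L2normD_le mO (uh2 s_in) (L2Z mO (-1) (u2 s_in)).
  rewrite (_ : (fun x => uh s x + _) = e s); last by apply/funext => x; rewrite mulN1r.
  suff -> : L2norm (fun x => -1 * u s x) = L2norm (u s) by [].
  have := L2normBC Omega (fun=> 0) (u s); rewrite (_ : (fun x => u s x - 0) = u s); last by apply/funext => x; rewrite subr0.
  by move=> <-; congr L2norm; apply/funext => x; rewrite mulN1r sub0r.
by lra.
Qed.

Lemma error_energy a : 0 < a -> 0 < T -> exists K, [/\ 0 <= K,
    forall s1 s2, a <= s1 <= T -> a <= s2 <= T -> `|y s1 - y s2| <= K * `|s1 - s2| &
    forall c s, a <= c -> c < s -> s <= T ->
    ((((s - c) `^ (- alpha) / G1 + Num.max lambda 0) * y s)%:E <=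
     (L2norm (Rh s) + K * (alpha / (1 - alpha)) * (s - c) `^ (1 - alpha) / G1 + Num.max (- lambda) 0 * y s)%:E +
     (G1^-1)%:E * \int[lebesgue_measure]_(x in `]0%R, c[) (alpha * (s - x) `^ (- alpha - 1) * y x)%:E)%E].
Proof.
move=> a0 T0; have [M M0 yM] := error_bounded T0.
have yL b K : 0 < b -> (forall s1 s2, b <= s1 <= T -> b <= s2 <= T -> L2norm (e s1 \- e s2) <= K * `|s1 - s2|) ->
    forall s1 s2, b <= s1 <= T -> b <= s2 <= T -> `|y s1 - y s2| <= K * `|s1 - s2|.
  move=> b0 h s1 s2 s1T s2T; apply: le_trans (h _ _ s1T s2T).
  by apply: L2norm_dist => //; apply: e2; [case/andP: s1T|case/andP: s2T] => h1 ->; rewrite (lt_le_trans b0).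
have [K K0 KP] := error_lipschitz a0.
exists K; split=> //; first exact: (yL a K a0 KP).
move=> c s ac cs sT; have c0 := lt_le_trans a0 ac; have s0 := lt_trans c0 cs.
have s_in : 0 < s <= T by rewrite s0 sT.
have [ip weak] := error_weak s_in.
have es2 := e2 s_in.
apply: (@energy_of_weak_form _ alpha lambda al0 al1 y _ _ M K c s _ M0 K0 c0 cs _ _ _ _ _ ip weak).
- exact: L2norm_ge0.
- by move=> x; exact: L2norm_ge0.
- by move=> x /andP[x0 xs]; apply: yM; rewrite x0 (le_trans (ltW xs)).
- apply: locally_lipschitz_measurable => b /andP[b0 bs]; have [Kb _ KbP] := error_lipschitz b0.
  by exists Kb => s1 s2 /andP[h1 h2] /andP[h3 h4]; apply: (yL b Kb b0 KbP); rewrite ?h1 ?h3 ?(le_trans h2) ?(le_trans h4).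
- move=> x /andP[x0 xs]; have xT : 0 < x <= T by rewrite x0 (le_trans (ltW xs)).
  rewrite (L2dotBl mO es2 (e2 xT) es2) -(L2norm_sqr es2) -/(y s) mulrBr -expr2 lerD2l lerN2 mulrC.
  exact: (L2dot_le mO (e2 xT) es2).
- move=> x /andP[cx xs]; have x0 := lt_le_trans c0 cx.
  have xT : 0 < x <= T by rewrite x0 (le_trans (ltW xs)).
  have := cauchy_schwarz mO (L2B es2 (e2 xT)) es2; rewrite -/(y s) ler_norml => /andP[h _].
  apply: le_trans h; rewrite lerN2 mulrC ler_wpM2l ?L2norm_ge0//.
  rewrite -[X in K * X]ger0_norm ?subr_ge0 ?(ltW xs)//.
  by apply: KP; rewrite ?sT ?(le_trans (ltW xs) sT) ?(le_trans ac cx) ?(le_trans ac (ltW cs)).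
Qed.

End error.

Theorem theorem2p2 (R : realType) (alpha T : R) (d : nat)
    (Omega : set 'rV[R]_d) (L : second_order_operator R d) (lambda : R)
    (f : R -> 'rV[R]_d -> R) (u0 : 'rV[R]_d -> R)
    (u uh Rh : R -> 'rV[R]_d -> R)
    (halpha : 0 < alpha < 1) (hT : 0 < T) (hd : (1 <= d <= 3)%N)
    (hOmega : bounded_lipschitz_domain Omega)
    (hL : elliptic Omega L)
    (hlambda : forall v g, H10_grad Omega v g ->
      lambda * L2norm Omega v ^+ 2 <= op_pairing Omega L v g v g)
    (hf : forall t, 0 < t <= T -> L1loc Omega (f t))
    (hu : is_solution Omega alpha T L f u0 u)
    (hunique : forall v, is_solution Omega alpha T L f u0 v ->
      forall t, 0 < t <= T -> v t = u t %[ae lebesgue_rV R d in Omega])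
    (huh_reg : time_regular Omega T uh)
    (huh_H10 : forall t, 0 < t <= T -> H10 Omega (uh t))
    (huh_init : uh 0 = u0 %[ae lebesgue_rV R d in Omega])
    (hRh_L2 : forall t, 0 < t <= T -> L2 Omega (Rh t))
    (hRh : forall t, 0 < t <= T ->
      evolution_eq Omega alpha L uh t (f t \+ Rh t)) :
  forall t, 0 < t <= T ->
    ((L2norm Omega (uh t \- u t))%:E
       <= caputo_inv alpha lambda (fun s => L2norm Omega (Rh s)) t)%E.
Proof.
move=> t tT; have /andP[al0 al1] := halpha.
have [oO _ _ bO _] := hOmega; have [ureg _ uinit ueq] := hu.
have init : uh 0 = u 0 %[ae lebesgue_rV R d in Omega].
  by apply: filterS2 huh_init uinit => x h1 h2 xO; rewrite h1// h2.
have [M M0 yM] := error_bounded oO ureg huh_reg hT.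
have En a (a0 : 0 < a) := error_energy al0 al1 oO bO hL hlambda hf ureg huh_reg init hRh_L2 ueq hRh a0 hT.
(* On ]0, t[ the argument t - s is positive, so the extension of the kernel by 0 does not show. *)
suff -> : caputo_inv alpha lambda (fun s => L2norm Omega (Rh s)) t =
    (\int[lebesgue_measure]_(s in `]0%R, t[) (mlk alpha lambda (t - s) * L2norm Omega (Rh s))%:E)%E.
  exact: (caputo_comparison al0 al1 hT (fun s => L2norm_ge0 Omega (uh s \- u s))
    (fun s => L2norm_ge0 Omega (Rh s)) M0 yM En tT).
apply: eq_integral => s /set_mem; rewrite /= in_itv/= => /andP[_ st].
by rewrite /mlk pwE// subr_gt0.
Qed.
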